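(* Let $f(x,y)$ be a real homogeneous polynomial of degree $d$ in the $\sigma(n)+m$ variables $x=(x_{ij})_{1\le i\le j\le n}$, $y=(y_1,\dots,y_m)$. Then the Algorithm described in the context, applied to $f$, terminates in finitely many iterations. More specifically: (i) If $f$ is $\mathcal{S}^n_+\times\mathbb{R}^m_+$-copositive, then $f'_{k,mom}\ge 0$ for all sufficiently large $k$; consequently, the Algorithm outputs that $f$ is $\mathcal{S}^n_+\times\mathbb{R}^m_+$-copositive. (ii) If $f$ is not $\mathcal{S}^n_+\times\mathbb{R}^m_+$-copositive, then the Algorithm returns a nonzero vector $(u,v)\in\mathbb{R}^{\sigma(n)}\times\mathbb{R}^m$ satisfying $X(u)\succeq 0$, $v\ge 0$ and $f(u,v)<0$. Here the vector $\xi$ chosen in Step 0 is generic: there is a Lebesgue-null set $\Omega\subseteq\mathbb{R}^{\mathbb{N}^{\sigma(n)+m}_d}$ (depending on $f$) such that the assertions hold for every choice of $\xi\in\mathbb{R}^{\mathbb{N}^{\sigma(n)+m}_d}\setminus\Omega$.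
   Context: **Variables and copositivity.** $\sigma(n)=n(n+1)/2$; $x=(x_{11},x_{12},\dots,x_{1n},x_{22},\dots,x_{nn})$ is a vector of $\sigma(n)$ real variables, $y=(y_1,\dots,y_m)$, and $X(x)$ is the $n\times n$ symmetric matrix whose $(i,j)$ entry is $x_{ij}$ for $i\le j$. A homogeneous polynomial $f(x,y)$ is $\mathcal{S}^n_+\times\mathbb{R}^m_+$-copositive if $f(x,y)\ge 0$ for all $(x,y)\in\mathbb{R}^{\sigma(n)}\times\mathbb{R}^m$ with $X(x)\succeq 0$ and $y\ge 0$ (entrywise). $\|\cdot\|_F$ is the Frobenius norm and $\|\cdot\|$ the Euclidean norm. **The polynomials $\Theta$, $p_t$.** $\Theta(x,y)$ is the $n\times n$ symmetric polynomial matrix with entries $\Theta_{ii}=\partial_{x_{ii}}f-d\cdot f$ and $\Theta_{ij}=\tfrac12\partial_{x_{ij}}f$ for $i<j$; and $p_t(x,y)=\partial_{y_t}f-d\cdot f$ for $t=1,\dots,m$. **Moment notation.** Let $N=\sigma(n)+m$ and $\mathbb{N}^N_{r}=\{\alpha\in\mathbb{N}^N:|\alpha|\le r\}$. $[x\ y]_r$ is the column vector of all monomials in $(x,y)$ of degree at most $r$. For $z=(z_\alpha)_{\alpha\in\mathbb{N}^N_{2k}}\in\mathbb{R}^{\mathbb{N}^N_{2k}}$, let $\langle\sum_\alpha p_\alpha (x,y)^\alpha,z\rangle=\sum_\alpha p_\alpha z_\alpha$ for polynomials of degree at most $2k$. For a polynomial $q$ of degree at most $2k$, $L_q^{(k)}(z)=\langle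 q\,[x\ y]_s[x\ y]_s^T,z\rangle$ (applied entrywise) with $s=k-\lceil\deg(q)/2\rceil$. $M_k(z)=L_1^{(k)}(z)$. For a polynomial matrix $T=(T_{ij})$, $L_T^{(k)}(z)$ is the block matrix with blocks $\langle T_{ij}[x\ y]_s[x\ y]_s^T,z\rangle$, where $s=k-\lceil\deg(T)/2\rceil$ and $\deg(T)$ is the maximal degree of the entries. $w_{e_i}$ denotes the entry of $w$ indexed by the $i$-th standard basis vector $e_i\in\mathbb{N}^N$. **Moment relaxation.** For $k\ge\lceil (d+1)/2\rceil$, $f'_{k,mom}$ is the optimal value of $$\min\ \langle f,z\rangle\quad\text{s.t.}\quad L^{(k)}_{\operatorname{tr}(X)+y_1+\cdots+y_m-1}(z)=0,\ L^{(k)}_X(z)\succeq 0,\ L^{(k)}_\Theta(z)\succeq 0,\ L^{(k)}_{X\Theta}(z)=0,$$ $$L^{(k)}_{y_t}(z)\succeq 0,\ L^{(k)}_{p_t}(z)\succeq 0,\ L^{(k)}_{p_ty_t}(z)=0\ (t=1,\dots,m),$$ $$L^{(k)}_{1-\|X\|_F^2-\|y\|^2}(z)\succeq 0,\ L^{(k)}_{\|X\|_F^2+\|y\|^2-\frac1{n+m}}(z)\succeq 0,\ \langle 1,z\rangle=1,\ M_k(z)\succeq 0,\ z\in\mathbb{R}^{\mathbb{N}^{\sigma(n)+m}_{2k}}.$$ **The Algorithm** (all semidefinite programs are solved exactly). Input: a homogeneous polynomial $f(x,y)$ of degree $d$. Step 0. Choose a generic vector $\xi\in\mathbb{R}^{\mathbb{N}^{\sigma(n)+m}_d}$.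 Let $k:=\lceil (d+1)/2\rceil$. Step 1. Compute $f'_{k,mom}$. If $f'_{k,mom}\ge 0$, output that $f$ is $\mathcal{S}^n_+\times\mathbb{R}^m_+$-copositive and stop; otherwise go to Step 2. Step 2. Solve the semidefinite program $$\min\ \langle\xi^T[x\ y]_d,w\rangle\quad\text{s.t.}\quad L^{(k)}_{\operatorname{tr}(X)+y_1+\cdots+y_m-1}(w)=0,\ L^{(k)}_X(w)\succeq 0,\ L^{(k)}_{f'_{k,mom}-f}(w)\succeq 0,$$ $$L^{(k)}_{y_t}(w)\succeq 0\ (t=1,\dots,m),\ L^{(k)}_{1-\|X\|_F^2-\|y\|^2}(w)\succeq 0,\ L^{(k)}_{\|X\|_F^2+\|y\|^2-\frac1{n+m}}(w)\succeq 0,$$ $$\langle 1,w\rangle=1,\ M_k(w)\succeq 0,\ w\in\mathbb{R}^{\mathbb{N}^{\sigma(n)+m}_{2k}}.$$ If it is feasible, compute an optimizer $w^*$ and go to Step 3; otherwise let $k:=k+1$ and go to Step 1. Step 3. Let $u=(w^*_{e_1},\dots,w^*_{e_{\sigma(n)}})$ and $v=(w^*_{e_{\sigma(n)+1}},\dots,w^*_{e_{\sigma(n)+m}})$. If $f(u,v)<0$, output that $f$ is not $\mathcal{S}^n_+\times\mathbb{R}^m_+$-copositive, return $(u,v)$ and stop; otherwise let $k:=k+1$ and go to Step 1. *)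

(* Defs.v *)
From mathcomp Require Import all_boot all_order all_algebra.
From mathcomp Require Import mpoly.
From mathcomp Require Import boolp classical_sets reals ereal.
Set Implicit Arguments.
Unset Strict Implicit.
Unset Printing Implicit Defensive.
Import Order.TTheory GRing.Theory Num.Theory.
Local Open Scope ring_scope.
Local Open Scope classical_set_scope.

Definition sigma (n : nat) : nat := (n * n.+1) %/ 2.

(* With 0-based indices, the rows of the upper triangle preceding row i hold
   n + (n - 1) + ... + (n - i + 1) entries; so, for i <= j, this is the rank of
   x_ij in the list x_11, x_12, ..., x_1n, x_22, ..., x_nn. *)
Definition symrank (n i j : nat) : nat :=
  (\sum_(a < minn i j) (n - a) + (maxn i j - minn i j))%N.

Lemma sum_rows (n : nat) : (\sum_(a < n) (n - a))%N = sigma n.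
Proof.
rewrite /sigma (reindex_inj rev_ord_inj) /=.
rewrite (eq_bigr (fun i : 'I_n => i.+1)); last first.
  by move=> i _; rewrite subKn.
elim: n => [|n IHn]; first by rewrite big_ord0.
rewrite big_ord_recr /= IHn.
have -> : (n.+1 * n.+2 = n * n.+1 + n.+1 * 2)%N.
  by rewrite -addn2 mulnDr [in RHS]mulnC.
by rewrite divnDr ?dvdn_mull // mulnK.
Qed.

Lemma symrank_lt (n : nat) (i j : 'I_n) : (symrank n i j < sigma n)%N.
Proof.
have ltM : (maxn i j < n)%N by rewrite gtn_max !ltn_ord.
have lemM : (minn i j <= maxn i j)%N by rewrite geq_min leq_max leqnn.
have ltm := leq_ltn_trans lemM ltM.
rewrite /symrank -sum_rows -!(big_mkord xpredT (fun a => n - a)%N).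
rewrite (@big_cat_nat _ _ _ (minn i j) 0 n) //= ?(ltnW ltm) // ltn_add2l.
by rewrite big_ltn // (leq_trans _ (leq_addr _ _)) // ltn_sub2r.
Qed.

Definition symidx (n : nat) (i j : 'I_n) : 'I_(sigma n) :=
  Ordinal (symrank_lt i j).

Definition symmx (T : Type) (n : nat) (x : 'I_(sigma n) -> T) : 'M[T]_n :=
  \matrix_(i, j) x (symidx i j).

Definition psdmx (R : realType) (p : nat) (A : 'M[R]_p) : Prop :=
  A^T = A /\ forall v : 'cV[R]_p, 0 <= (v^T *m A *m v) 0 0.

(* Lebesgue-null: for every e > 0, covered by countably many boxes of total
   volume at most e. *)
Definition lebesgue_null (R : realType) (I : finType) (A : set {ffun I -> R})
  : Prop :=
  forall e : R, 0 < e -> exists a b : nat -> I -> R,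
    [/\ forall j i, a j i <= b j i,
        forall x, A x -> exists j, forall i, a j i <= x i <= b j i
      & forall l : nat, \sum_(j < l) \prod_(i : I) (b j i - a j i) <= e].

Section Moments.
Variables (R : realType) (N : nat).

(* Degree, with the convention that the zero polynomial has degree 0. *)
Definition pdeg (p : {mpoly R[N]}) : nat := (msize p).-1.

Definition mxdeg (r : nat) (T : 'M[{mpoly R[N]}]_r) : nat :=
  (\max_(i < r) \max_(j < r) pdeg (T i j))%N.

Definition tms (r : nat) : Type := {ffun 'X_{1..N < r.+1} -> R}.

(* The entry z_a; the default value 0 is only reached when |a| > r. *)
Definition tms_entry (r : nat) (z : tms r) (a : 'X_{1..N}) : R :=
  if insub a is Some b then z b else 0.

Definition riesz (r : nat) (p : {mpoly R[N]}) (z : tms r) : R :=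
  \sum_(a <- msupp p) p@_a * tms_entry z a.

Definition locmx (k : nat) (q : {mpoly R[N]}) (z : tms (2 * k)) :=
  let s := (k - uphalf (pdeg q))%N in
  \matrix_(a < #|{: 'X_{1..N < s.+1}}|, b < #|{: 'X_{1..N < s.+1}}|)
    riesz (q * ('X_[enum_val a] * 'X_[enum_val b])) z.

Definition momentmx (k : nat) (z : tms (2 * k)) := locmx 1 z.

(* Rows and columns are indexed by the pairs (i, a), where i selects the block
   and a the monomial. *)
Definition locblockmx (k r : nat) (T : 'M[{mpoly R[N]}]_r) (z : tms (2 * k)) :=
  let s := (k - uphalf (mxdeg T))%N in
  \matrix_(a < #|{: 'I_r * 'X_{1..N < s.+1}}|,
           b < #|{: 'I_r * 'X_{1..N < s.+1}}|)
    riesz (T (enum_val a).1 (enum_val b).1 *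
           ('X_[(enum_val a).2] * 'X_[(enum_val b).2])) z.

End Moments.

Section Copositivity.
Variables (R : realType) (n m : nat).
Local Notation N := (sigma n + m)%N.
Local Notation poly_xy := {mpoly R[N]}.

Definition xvar (i j : 'I_n) : 'I_N := lshift m (symidx i j).
Definition yvar (t : 'I_m) : 'I_N := rshift (sigma n) t.

Definition Xmx : 'M[poly_xy]_n := symmx (fun a => 'X_(lshift m a)).

Definition evalxy (f : poly_xy) (u : 'rV[R]_(sigma n)) (v : 'rV[R]_m) : R :=
  f.@[fun i => row_mx u v 0 i].

Definition in_cone (u : 'rV[R]_(sigma n)) (v : 'rV[R]_m) : Prop :=
  psdmx (symmx (u 0)) /\ forall t, 0 <= v 0 t.

Definition copositive (f : poly_xy) : Prop :=
  forall u v, in_cone u v -> 0 <= evalxy f u v.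

Definition Theta (f : poly_xy) (d : nat) : 'M[poly_xy]_n :=
  \matrix_(i, j) if i == j then f^`M(xvar i i) - d%:R *: f
                 else 2^-1 *: f^`M(xvar i j).

Definition pmul (f : poly_xy) (d : nat) (t : 'I_m) : poly_xy :=
  f^`M(yvar t) - d%:R *: f.

Definition trace1 : poly_xy := \tr Xmx + \sum_(t < m) 'X_(yvar t) - 1.

Definition sqnorm : poly_xy :=
  \sum_(i < n) \sum_(j < n) Xmx i j ^+ 2 + \sum_(t < m) 'X_(yvar t) ^+ 2.

Definition outer_ball : poly_xy := 1 - sqnorm.
Definition inner_ball : poly_xy := sqnorm - ((n + m)%N%:R^-1)%:MP.

Record mom_feasible (f : poly_xy) (d k : nat) (z : tms R N (2 * k)) : Prop :=
  MomFeasible {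
    mom_trace : locmx trace1 z = 0;
    mom_X : psdmx (locblockmx Xmx z);
    mom_Theta : psdmx (locblockmx (Theta f d) z);
    mom_XTheta : locblockmx (Xmx *m Theta f d) z = 0;
    mom_y : forall t, psdmx (locmx 'X_(yvar t) z);
    mom_p : forall t, psdmx (locmx (pmul f d t) z);
    mom_py : forall t, locmx (pmul f d t * 'X_(yvar t)) z = 0;
    mom_outer : psdmx (locmx outer_ball z);
    mom_inner : psdmx (locmx inner_ball z);
    mom_mass : riesz 1 z = 1;
    mom_psd : psdmx (momentmx z)
  }.

(* Equal to +oo when the relaxation is infeasible. *)
Definition mom_value (f : poly_xy) (d k : nat) : \bar R :=
  ereal_inf [set c | exists2 z : tms R N (2 * k),
                       mom_feasible f d z & c = (riesz f z)%:E].

Record min_feasible (f : poly_xy) (c : R) (k : nat) (w : tms R N (2 * k))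
  : Prop := MinFeasible {
    min_trace : locmx trace1 w = 0;
    min_X : psdmx (locblockmx Xmx w);
    min_level : psdmx (locmx (c%:MP - f) w);
    min_y : forall t, psdmx (locmx 'X_(yvar t) w);
    min_outer : psdmx (locmx outer_ball w);
    min_inner : psdmx (locmx inner_ball w);
    min_mass : riesz 1 w = 1;
    min_psd : psdmx (momentmx w)
  }.

Definition genpoly (d : nat) (xi : tms R N d) : poly_xy :=
  \sum_(a : 'X_{1..N < d.+1}) xi a *: 'X_[a].

Definition min_optimizer (f : poly_xy) (d : nat) (xi : tms R N d) (c : R)
    (k : nat) (w : tms R N (2 * k)) : Prop :=
  min_feasible f c w /\
  forall w' : tms R N (2 * k), min_feasible f c w' ->
    riesz (genpoly xi) w <= riesz (genpoly xi) w'.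

Definition xpart (k : nat) (w : tms R N (2 * k)) : 'rV[R]_(sigma n) :=
  \row_a tms_entry w U_(lshift m a).

Definition ypart (k : nat) (w : tms R N (2 * k)) : 'rV[R]_m :=
  \row_t tms_entry w U_(yvar t).

Inductive outcome : Type :=
  | IsCopositive
  | NotCopositive (u : 'rV[R]_(sigma n)) (v : 'rV[R]_m).

(* Step2 carries the value c of the relaxation computed in Step1, and Step3 the
   optimizer computed in Step2. *)
Inductive state : Type :=
  | Step1 (k : nat)
  | Step2 (k : nat) (c : R)
  | Step3 (k : nat) (w : tms R N (2 * k))
  | Halt (o : outcome).

(* The only nondeterminism is the choice among the optimizers in Step2. *)
Inductive step (f : poly_xy) (d : nat) (xi : tms R N d)
  : state -> state -> Prop :=
  | Step1_stop k :
      (0 <= mom_value f d k)%E -> step f xi (Step1 k) (Halt IsCopositive)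
  | Step1_continue k c :
      mom_value f d k = c%:E -> c < 0 -> step f xi (Step1 k) (Step2 k c)
  | Step2_feasible k c w :
      min_optimizer f xi c w -> step f xi (Step2 k c) (@Step3 k w)
  | Step2_infeasible k c :
      (forall w : tms R N (2 * k), ~ min_feasible f c w) ->
      step f xi (Step2 k c) (Step1 k.+1)
  | Step3_stop k w :
      evalxy f (xpart w) (ypart w) < 0 ->
      step f xi (@Step3 k w) (Halt (NotCopositive (xpart w) (ypart w)))
  | Step3_continue k w :
      0 <= evalxy f (xpart w) (ypart w) ->
      step f xi (@Step3 k w) (Step1 k.+1).

Definition start (d : nat) : state := Step1 (uphalf d.+1).

(* Whatever optimizers are chosen, the execution from s never gets stuck, is
   finite, and halts with an outcome satisfying P. *)
Inductive halts_with (f : poly_xy) (d : nat) (xi : tms R N d)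
    (P : outcome -> Prop) : state -> Prop :=
  | halts_now o : P o -> halts_with f xi P (Halt o)
  | halts_later s :
      (exists s', step f xi s s') ->
      (forall s', step f xi s s' -> halts_with f xi P s') ->
      halts_with f xi P s.

End Copositivity.

Arguments start {R} n m d.
Arguments IsCopositive {R n m}.

(* Main.v *)
Require Import Defs.
From HB Require Import structures.
From mathcomp Require Import all_boot all_order all_algebra.
From mathcomp Require Import mpoly ssrcomplements zify ring lra.
From mathcomp Require Import generic_quotient ring_quotient fraction.
From mathcomp Require Import boolp classical_sets reals ereal.
From mathcomp Require filter.
Import Order.TTheory GRing.Theory Num.Theory.
Set Implicit Arguments.
Unset Strict Implicit.
Unset Printing Implicit Defensive.
Local Open Scope ring_scope.
Local Open Scope classical_set_scope.

(** By homogeneity, f is copositive exactly when its minimum c on the compact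
    slice tr X + y_1 + ... + y_m = 1 of the cone is nonnegative. A minimizer
    satisfies the optimality conditions encoded by Theta and the p_t, with the
    multiplier d f, because f - c (tr X + y_1 + ... + y_m)^d is nonnegative on
    the cone and vanishes there ([kkt_minimizer]). So the first relaxation is
    feasible and its value is at most c. The algorithm works because this value
    equals c from some order on, if c <= 0 (and is nonnegative if c >= 0), and
    because the optimizers of the second relaxation then converge to a minimizer.

    Exactness at a finite order ([relaxation_tight]) rests on two facts.

    First, Putinar's theorem ([positive_in_module]): a polynomial that is positive
    on the slice is nonnegative for all feasible functionals of large order, also
    after multiplication by a square. It is derived from [state_point]: a
    functional L that is nonnegative on an archimedean quadratic module admits,
    for every polynomial g, a point of the corresponding set at which g is at most
    L g. Instead of representing measures one uses that reweighting a functional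
    by 2 + x_i or 2 - x_i preserves nonnegativity; a functional that minimizes g
    and then successively all coordinates must be a point evaluation.

    Second, f takes finitely many values on the complex variety of the equations
    X Theta = 0, p_t y_t = 0 and trace = 1: some nonzero univariate polynomial phi
    satisfies phi (f) = 0 modulo these equations
    ([finitely_many_critical_values]). For if f were transcendental in the residue
    field of a prime ideal containing the equations, the derivation d/df would
    extend to the coordinates ([adjoin_elements]); but differentiating the
    equations shows that every derivation kills f, the matrix part being
    tr (Theta dX) = 0 ([symmetric_trace_zero]). Once phi (f) = 0 is known, the
    factors of phi that are positive on the values of f over the slice cancel and
    the other roots can be made simple, so that f - c is a square modulo the
    equations ([tightness]).

    In the second relaxation the functionals are confined, in the limit, to the
    minimizers of f. For xi outside a null set the polynomial with coefficients xi
    has a unique minimizer s among them: where it has two, they differ in some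
    coordinate, and the set of such xi is a countable union of pieces of Lipschitz
    graphs ([nonunique_minimizers_null]). A limit of optimizers does not exceed the
    value at s, hence it is the evaluation at s ([face_point]), the first moments
    of the optimizers tend to s ([optimizers_converge]), and f is negative at them
    if c < 0. Whatever the order, these first moments lie on the slice, so a
    negative value of f at them is always a correct answer. *)

(** * Limits of linear functionals *)

Section UltraLimit.
Variables (R : realType).

Lemma free_ultrafilter : exists U : set (set nat),
  [/\ forall A B, U A -> U B -> U (A `&` B),
      forall A B, A `<=` B -> U A -> U B,
      forall A, U A \/ U (~` A),
      ~ U set0 & forall K, U [set k | (K <= k)%N]].
Proof.
have [U [UU leU]] := filter.ultraFilterLemma filter.eventually_filter.
have UF := filter.ultra_proper; exists U; split.
- by move=> A B; apply: filter.filterI.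
- by move=> A B; apply: filter.filterS.
- by move=> A; apply: filter.in_ultra_setVsetC.
- exact: filter.filter_not_empty.
- by move=> K; apply: leU; exists K.
Qed.

Section Limit.
Variable U : set (set nat).
Hypothesis UI : forall A B, U A -> U B -> U (A `&` B).
Hypothesis US : forall A B, A `<=` B -> U A -> U B.
Hypothesis UT : forall A, U A \/ U (~` A).
Hypothesis U0 : ~ U set0.

Definition ultra_lim (u : nat -> R) (l : R) :=
  forall e, 0 < e -> U [set k | `|u k - l| < e].

(** The limit is the supremum of the reals that lie below the sequence on a set
    of the ultrafilter; nothing is both eventually above and eventually below a
    number, and an ultrafilter leaves no third possibility. *)
Lemma ultra_lim_bounded u C : U [set k | `|u k| <= C] -> exists l, ultra_lim u l.
Proof.
move=> bdd; pose E := [set r : R | U [set k | r <= u k]].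
have E_C : E (- C).
  by apply: US bdd => k /=; rewrite ler_norml => /andP[].
have ubE : ubound E C.
  move=> r Er; rewrite leNgt; apply/negP => Cr; apply: U0.
  apply: US (UI Er bdd) => k [/= ru]; rewrite ler_norml => /andP[_ uC].
  by have := lt_le_trans Cr (le_trans ru uC); rewrite ltxx.
have hsE : has_sup E by split; [exists (- C) | exists C].
exists (sup E) => e e0.
have [r Er ltr] := sup_adherent e0 hsE.
have nE : ~ E (sup E + e).
  by move=> /(sup_upper_bound hsE); rewrite gerDl leNgt e0.
have [//|cE] := UT [set k | sup E + e <= u k].
apply: US (UI Er cE) => k [/= ru /negP].
rewrite -ltNge => uE; rewrite ltr_norml; apply/andP; split; lra.
Qed.

Lemma ultra_lim_ge u l c : ultra_lim u l -> U [set k | c <= u k] -> c <= l.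
Proof.
move=> ul u0; rewrite leNgt; apply/negP => l0; apply: U0.
have e0 : 0 < c - l by rewrite subr_gt0.
apply: US (UI (ul _ e0) u0) => k [/=]; rewrite ltr_norml => /andP[_ h1] h2.
lra.
Qed.

Lemma ultra_lim_lin u v l m a :
  ultra_lim u l -> ultra_lim v m -> ultra_lim (fun k => a * u k + v k) (a * l + m).
Proof.
move=> ul vm e e0; pose d := e / (2 * (`|a| + 1)).
have a1 : 0 < `|a| + 1 by rewrite ltr_pwDr.
have d0 : 0 < d by rewrite divr_gt0 // mulr_gt0.
have e20 : 0 < e / 2 by rewrite divr_gt0.
apply: US (UI (ul _ d0) (vm _ e20)) => k [/= h1 h2].
have -> : a * u k + v k - (a * l + m) = a * (u k - l) + (v k - m) by ring.
apply: (le_lt_trans (ler_normD _ _)); rewrite normrM.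
have h3 : `|a| * `|u k - l| <= (`|a| + 1) * d.
  by apply: ler_pM => //; [rewrite lerDl | exact: ltW].
have h4 : (`|a| + 1) * d = e / 2 by rewrite /d; field; rewrite gt_eqF.
rewrite h4 in h3; lra.
Qed.

Lemma ultra_lim_unique u l m : ultra_lim u l -> ultra_lim u m -> l = m.
Proof.
move=> ul um; apply/eqP; rewrite -subr_eq0 -normr_le0 leNgt; apply/negP => h.
have e0 : 0 < `|l - m| / 2 by rewrite divr_gt0.
apply: U0; apply: US (UI (ul _ e0) (um _ e0)) => k [/= h1 h2].
have := ler_normB (u k - m) (u k - l).
have -> : u k - m - (u k - l) = l - m by ring.
lra.
Qed.
End Limit.

Definition mkscalar (V : lmodType R) (f : V -> R) (fL : scalar f) : {scalar V} :=
  HB.pack f (GRing.isLinear.Build R V R *%R f fL).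

Lemma mkscalarE (V : lmodType R) (f : V -> R) (fL : scalar f) : mkscalar fL =1 f.
Proof. by []. Qed.

(** Compactness of bounded families of functionals. The limit is described only
    by the inequalities it inherits, as these are all that the arguments below
    use; an ultrafilter makes one limit work for all vectors simultaneously. *)
Lemma functional_limit (V : lmodType R) (F : nat -> {scalar V} -> Prop) :
  (forall k, exists L, F k L) ->
  (forall p, exists C, exists K, forall k L, (K <= k)%N -> F k L -> `|L p| <= C) ->
  exists L0 : {scalar V}, forall q c,
    ((exists K, forall k L, (K <= k)%N -> F k L -> c <= L q) -> c <= L0 q) /\
    ((exists K, forall k L, (K <= k)%N -> F k L -> L q <= c) -> L0 q <= c).
Proof.
move=> Fne Fbd; have [U [UI US UT U0 Uoo]] := free_ultrafilter.
have [L FL] := choice Fne.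
have lim p : exists l, ultra_lim U (fun k => L k p) l.
  have [C [K bd]] := Fbd p.
  apply: (ultra_lim_bounded UI US UT U0 (C := C)).
  by apply: US (Uoo K) => k /= Kk; apply: bd (FL k).
have [l ll] := choice lim.
have lL : scalar l.
  move=> a p q; apply: (ultra_lim_unique UI US U0 (ll _)).
  have -> : (fun k => L k (a *: p + q)) = (fun k => a * L k p + L k q).
    by apply: funext => k; rewrite linearP.
  exact: ultra_lim_lin.
have low q c : (exists K, forall k L, (K <= k)%N -> F k L -> c <= L q) ->
    c <= mkscalar lL q.
  move=> [K h]; apply: (ultra_lim_ge UI US U0 (ll q)).
  by apply: US (Uoo K) => k /= Kk; apply: h (FL k).
exists (mkscalar lL) => q c; split; first exact: low.
move=> [K h]; rewrite -lerN2 -linearN; apply: low.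
by exists K => k M Kk FM; rewrite linearN lerN2 (h k).
Qed.
End UltraLimit.

(** * States of quadratic modules *)

Section QuadraticModule.
Variables (R : realType) (N : nat).
Local Notation P := {mpoly R[N]}.

(** Quadratic modules are kept as sets, without generators, so that a matrix
    constraint can contribute the quadratic forms of all polynomial vectors.
    The last clause makes the module archimedean. *)
Record ball_module (M : set P) : Prop := BallModule {
  bm_add : forall p q, M p -> M q -> M (p + q);
  bm_sqr : forall q h, M q -> M (q * h ^+ 2);
  bm_one : M 1;
  bm_ball : forall i, M (1 - 'X_i ^+ 2)
}.

(** The stand-ins for probability measures on the points where Q is nonnegative. *)
Definition states (Q : set P) (L : {scalar P}) :=
  L 1 = 1 /\ forall q, Q q -> 0 <= L q.

Lemma scalarC (L : {scalar P}) c : L c%:MP = c * L 1.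
Proof. by rewrite -[c%:MP]mulr1 mul_mpolyC linearZ. Qed.

Lemma scalarCM (L : {scalar P}) c p : L (c%:MP * p) = c * L p.
Proof. by rewrite mul_mpolyC linearZ. Qed.

Lemma scalarCB (L : {scalar P}) c p : L (c%:MP - p) = c * L 1 - L p.
Proof. by rewrite linearB; congr (_ - _); exact: scalarC. Qed.

Section Module.
Variables (M : set P) (BM : ball_module M).

Lemma bm_sqr1 h : M (h ^+ 2).
Proof. by rewrite -[h ^+ 2]mul1r; apply: (bm_sqr BM _ (bm_one BM)). Qed.

Lemma bm_scale c q : 0 <= c -> M q -> M (c%:MP * q).
Proof.
move=> c0 Mq; rewrite mulrC -(sqr_sqrtr c0) rmorphXn; exact: bm_sqr.
Qed.

Lemma bm_const c : 0 <= c -> M c%:MP.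
Proof. by move=> c0; rewrite -[_%:MP]mulr1; apply: bm_scale c0 (bm_one BM). Qed.

Lemma bm_zero : M 0.
Proof. by have := bm_const (lexx 0); rewrite mpolyC0. Qed.

(** The polynomials p with 1 - p^2 in M are closed under products because
    1 - p^2 q^2 = (1 - p^2) + p^2 (1 - q^2). *)
Lemma bm_monomial (m : 'X_{1..N}) : M (1 - 'X_[m] ^+ 2).
Proof.
have clM p q : M (1 - p ^+ 2) -> M (1 - q ^+ 2) -> M (1 - (p * q) ^+ 2).
  move=> Mp Mq.
  have -> : 1 - (p * q) ^+ 2 = (1 - p ^+ 2) + (1 - q ^+ 2) * p ^+ 2 by ring.
  by apply: (bm_add BM) => //; apply: (bm_sqr BM).
have cl1 : M (1 - 1 ^+ 2) by rewrite expr1n subrr; exact: bm_zero.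
rewrite mpolyXE_id.
apply: (big_ind (fun p : P => M (1 - p ^+ 2))) => // i _.
elim: (m i) => [|k IH]; first by rewrite expr0.
by rewrite (exprS _ k); apply: clM => //; exact: (bm_ball BM).
Qed.

(** M is archimedean: for s^2 = 1,
    2 (1 - s x^m) = (1 - x^(2m)) + (1 - s x^m)^2, so that M bounds each
    monomial by 1. *)
Lemma bm_bounded p : exists2 C : R, 0 <= C & M (C%:MP - p).
Proof.
have half : 0 <= 2^-1 :> R by rewrite invr_ge0.
elim/mpolyind: p => [|c m p _ _ [C C0 MC]].
  by exists 0 => //; rewrite mpolyC0 subr0; exact: bm_zero.
exists (`|c| + C); first by rewrite addr_ge0.
have -> : (`|c| + C)%:MP - (c *: 'X_[m] + p)
        = (`|c|%:MP - c *: 'X_[m]) + (C%:MP - p) :> P by rewrite mpolyCD; ring.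
apply: (bm_add BM) => //.
have mk (s : R) : s ^+ 2 = 1 -> M (1 - s%:MP * 'X_[m]).
  move=> s2.
  have -> : 1 - s%:MP * 'X_[m] =
    (2^-1)%:MP * ((1 - 'X_[m] ^+ 2) + (1 - s%:MP * 'X_[m]) ^+ 2) :> P.
    have e2 : (s%:MP : P) ^+ 2 = 1 by rewrite -rmorphXn s2.
    have h2 : (2^-1)%:MP * 2 = 1 :> P.
      by rewrite -mpolyC1 -mpolyCMn -mpolyCM mulVf ?pnatr_eq0.
    have -> : (1 - 'X_[m] ^+ 2) + (1 - s%:MP * 'X_[m]) ^+ 2 =
        2 * (1 - s%:MP * 'X_[m]) + (s%:MP ^+ 2 - 1) * 'X_[m] ^+ 2 :> P by ring.
    by rewrite e2 subrr mul0r addr0 mulrA h2 mul1r.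
  by apply: bm_scale => //; apply: (bm_add BM); [exact: bm_monomial | exact: bm_sqr1].
have -> : `|c|%:MP - c *: 'X_[m] = `|c|%:MP * (1 - (Num.sg c)%:MP * 'X_[m]) :> P.
  have -> : c *: 'X_[m] = (Num.sg c)%:MP * `|c|%:MP * 'X_[m] :> P.
    by rewrite -mpolyCM -numEsg mul_mpolyC.
  ring.
have [->|c0] := eqVneq c 0; first by rewrite normr0 mpolyC0 mul0r; exact: bm_zero.
by apply: bm_scale => //; apply: mk; rewrite sqr_sg c0.
Qed.

End Module.

Section States.
Variables (M : set P) (BM : ball_module M).

Lemma states_bounded p : exists C, forall L, states M L -> `|L p| <= C.
Proof.
have [C C0 MC] := bm_bounded BM p; have [C' C'0 MC'] := bm_bounded BM (- p).
exists (C + C') => L [L1 LM].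
have := LM _ MC; have := LM _ MC'.
rewrite (scalarCB L C p) (scalarCB L C' (- p)) (linearN L) L1 !mulr1 => h1 h2.
rewrite ler_norml; apply/andP; split; lra.
Qed.

Lemma states_argmin (Q : set P) g : M `<=` Q -> (exists L, states Q L) ->
  exists2 L, states Q L & forall L', states Q L' -> L g <= L' g.
Proof.
move=> MQ [L1 Q1]; have [C bd] := states_bounded g.
have SQM L : states Q L -> states M L.
  by case=> h1 h2; split => // q /MQ /h2.
pose E := [set L g | L in states Q].
have Elb : has_lbound E.
  exists (- C) => _ [L /SQM /bd + <-]; by rewrite ler_norml => /andP[].
have E0 : E !=set0 by exists (L1 g), L1.
pose F k (L : {scalar P}) := states Q L /\ L g < inf E + k.+1%:R^-1.
have [] := @functional_limit R P F.
- move=> k; have e0 : 0 < k.+1%:R^-1 :> R by rewrite invr_gt0.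
  by have [_ [L QL <-] ltL] := inf_adherent e0 (conj E0 Elb); exists L.
- move=> p; have [D Db] := states_bounded p; exists D, 0%N => k L _ [/SQM h _]; exact: Db.
move=> L0 H; exists L0.
  split.
    apply/eqP; rewrite eq_le; apply/andP.
    by split; [apply: (H _ _).2 | apply: (H _ _).1]; exists 0%N => k L _ [[-> _] _].
  by move=> q Qq; apply: (H q 0).1; exists 0%N => k L _ [[_ h] _]; exact: h.
move=> L' QL'; apply: (@le_trans _ _ (inf E)); last first.
  by apply: (ge_inf Elb); exists L'.
apply/ler_addgt0Pr => e e0; apply: (H g _).2.
have [K Ke] : exists K : nat, e^-1 < K%:R.
  by exists (Num.bound e^-1); apply: archi_boundP; rewrite invr_ge0 ltW.
exists K => k L Kk [_ lt]; rewrite (le_trans (ltW lt)) //.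
rewrite lerD2l invf_ple ?posrE //; apply: (le_trans (ltW Ke)).
by rewrite ler_nat (leq_trans Kk).
Qed.

(** A convex sequence that increases once grows at least linearly ever after. *)
Lemma convex_bounded_le (m : nat -> R) C :
  (forall j, 2 * m j.+1 <= m j + m j.+2) -> (forall j, m j <= C) -> m 1%N <= m 0%N.
Proof.
move=> cvx bd; rewrite leNgt; apply/negP => lt; pose d := m 1%N - m 0%N.
have d0 : 0 < d by rewrite subr_gt0.
have incr j : d <= m j.+1 - m j.
  by elim: j => [|j IH]; [exact: lexx | have := cvx j; lra].
have grow j : m 0%N + j%:R * d <= m j.
  elim: j => [|j IH]; first by rewrite mul0r addr0.
  by rewrite -natr1 mulrDl mul1r; have := incr j; lra.
have [K Ke] : exists K : nat, `|C - m 0%N| / d < K%:R.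
  by exists (Num.bound (`|C - m 0%N| / d)); apply: archi_boundP; rewrite divr_ge0 // ltW.
have := grow K; have := bd K; rewrite ltr_pdivrMr // in Ke.
have := ler_norm (C - m 0%N); lra.
Qed.

(** The product of 1 - x_i^2 with an element q of M need not belong to M, yet no
    state can tell: the sequence of the L (q x_i^(2j)) is bounded because q is,
    and convex because L (q (x_i^j (1 - x_i^2))^2) is nonnegative. *)
Lemma state_ball L i q : states M L -> M q -> 0 <= L ((1 - 'X_i ^+ 2) * q).
Proof.
move=> [L1 LM] Mq; have [C C0 MC] := bm_bounded BM q.
pose m j := L (q * ('X_i ^+ j) ^+ 2).
suff : m 1%N <= m 0%N.
  rewrite /m expr1 expr0 expr1n mulr1 => h.
  have -> : (1 - 'X_i ^+ 2) * q = q - q * 'X_i ^+ 2 by ring.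
  by rewrite linearB subr_ge0.
apply: (@convex_bounded_le m C) => j.
  have := LM _ (bm_sqr BM ('X_i ^+ j * (1 - 'X_i ^+ 2)) Mq).
  have -> : q * ('X_i ^+ j * (1 - 'X_i ^+ 2)) ^+ 2 =
     q * ('X_i ^+ j) ^+ 2 - (q * ('X_i ^+ j.+1) ^+ 2) *+ 2 + q * ('X_i ^+ j.+2) ^+ 2.
    by rewrite !exprS; ring.
  by rewrite linearD linearB linearMn /= -/(m j) -/(m j.+1) -/(m j.+2) mulr2n; lra.
have := LM _ (bm_sqr BM ('X_i ^+ j) MC).
rewrite mulrBl linearB /= -/(m j) scalarCM subr_ge0 => /le_trans; apply.
have := LM _ (bm_monomial BM (U_(i) *+ j)%MM).
rewrite -mpolyXn linearB /= L1 => h.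
rewrite -[leRHS]mulr1 ler_wpM2l //; lra.
Qed.

(** Since s^2 = 1, 2 (1 + s x) = (1 + s x)^2 + (1 - x^2). *)
Lemma state_tilt_ge0 L i q (s : R) : s ^+ 2 = 1 -> states M L -> M q ->
  0 <= L ((1 + s%:MP * 'X_i) * q).
Proof.
move=> s2 SL Mq; have h := state_ball i SL Mq; case: SL => L1 LM.
have e2 : (s%:MP : P) ^+ 2 = 1 by rewrite -rmorphXn s2.
have := LM _ (bm_sqr BM (1 + s%:MP * 'X_i) Mq).
have -> : q * (1 + s%:MP * 'X_i) ^+ 2 = ((1 + s%:MP * 'X_i) * q) *+ 2
    - (1 - s%:MP ^+ 2 * 'X_i ^+ 2) * q by ring.
rewrite e2 mul1r linearB linearMn /= mulr2n; lra.
Qed.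

(** Reweighting by the density 2 + s x_i; the constant 2 keeps the denominator
    positive even if L x_i = 1 or -1. As (2 + x_i) + (2 - x_i) is constant, L is
    a convex combination of its two tilts. *)
Definition tilt_fun (L : {scalar P}) i (s : R) (p : P) : R :=
  L ((2 + s%:MP * 'X_i) * p) / (2 + s * L 'X_i).

Lemma tilt_scalar L i s : scalar (tilt_fun L i s).
Proof.
move=> a p q; rewrite /tilt_fun mulrDr -scalerAr linearP /= mulrDl.
by rewrite mulrA.
Qed.

Definition tilt L i s : {scalar P} := mkscalar (tilt_scalar L i s).

Lemma tilt_den L i (s : R) : s ^+ 2 = 1 -> states M L -> 0 < 2 + s * L 'X_i.
Proof.
move=> s2 SL; have := state_tilt_ge0 i s2 SL (bm_one BM).
case: SL => L1 _; rewrite mulr1 linearD scalarCM /= L1; lra.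
Qed.

Lemma tiltE L i s p : s ^+ 2 = 1 -> states M L ->
  (2 + s * L 'X_i) * tilt L i s p = 2 * L p + s * L ('X_i * p).
Proof.
move=> s2 SL; rewrite mkscalarE /tilt_fun mulrC divfK ?gt_eqF ?tilt_den //.
have -> : (2 + s%:MP * 'X_i) * p = p *+ 2 + s%:MP * ('X_i * p) by ring.
by rewrite linearD linearMn /= scalarCM mulr2n; ring.
Qed.

Lemma tilt_state L i s : s ^+ 2 = 1 -> states M L -> states M (tilt L i s).
Proof.
move=> s2 SL; have d0 := tilt_den i s2 SL; split.
  have := tiltE i 1 s2 SL; rewrite mulr1 (proj1 SL) mulr1 => e.
  by apply: (mulfI (lt0r_neq0 d0)); rewrite e mulr1.
move=> q Mq; rewrite -(pmulr_rge0 _ d0) tiltE //.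
have := state_tilt_ge0 i s2 SL Mq.
rewrite mulrDl mul1r linearD /= -mulrA scalarCM.
have := proj2 SL _ Mq; lra.
Qed.

(** A face of the state space is represented by the set Q of its inequalities.
    Stability under tilts is the only property of faces that matters here. *)
Definition tilt_closed (Q : set P) :=
  forall L i s, s ^+ 2 = 1 -> states Q L -> states Q (tilt L i s).

Lemma states_sub (Q : set P) L : M `<=` Q -> states Q L -> states M L.
Proof. by move=> MQ [h1 h2]; split => // q /MQ /h2. Qed.

Lemma states_set1U (Q : set P) g c L :
  states (Q `|` [set c%:MP - g]) L <-> states Q L /\ L g <= c.
Proof.
split=> [[L1 h]|[[L1 h] gc]].
  split; first by split => // q Qq; apply: h; left.
  by have := h _ (or_intror erefl); rewrite scalarCB L1 mulr1 subr_ge0.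
split=> // q [/h //|->]; by rewrite scalarCB L1 mulr1 subr_ge0.
Qed.

(** Both tilts of L take a value at least c at g, and L, which takes the value c,
    is a convex combination of them. *)
Lemma tilt_closed_min (Q : set P) g c : M `<=` Q -> tilt_closed Q ->
  (forall L, states Q L -> c <= L g) -> tilt_closed (Q `|` [set c%:MP - g]).
Proof.
move=> MQ TQ cmin L i s s2 /states_set1U[SL gc]; apply/states_set1U.
split; first exact: TQ.
have s2' : (- s) ^+ 2 = 1 by rewrite sqrrN.
have SM := states_sub MQ SL.
have h := cmin _ (TQ _ i _ s2' SL).
rewrite -(ler_pM2l (tilt_den i s2' SM)) tiltE // in h.
rewrite -(ler_pM2l (tilt_den i s2 SM)) tiltE //.
have cg := cmin _ SL; have gE : L g = c by apply/eqP; rewrite eq_le gc cg.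
by rewrite gE in h *; lra.
Qed.

(** Cauchy-Schwarz for a vector of length zero. *)
Lemma state_cauchy L a p : states M L -> L (a ^+ 2) = 0 -> L (a * p) = 0.
Proof.
move=> [L1 LM] a0; apply/eqP/negPn/negP => ap0.
(* This t gives (t a + p)^2 the value -1 under L. *)
pose t := - (L (p ^+ 2) + 1) / (2 * L (a * p)).
have := LM _ (bm_sqr1 BM (t%:MP * a + p)).
have -> : (t%:MP * a + p) ^+ 2 = t%:MP * (t%:MP * a ^+ 2) +
  (t%:MP * (a * p) + t%:MP * (a * p)) + p ^+ 2 by ring.
rewrite !linearD /= !scalarCM a0.
have -> : t * L (a * p) = - (L (p ^+ 2) + 1) / 2 by rewrite /t; field.
lra.
Qed.

(** On the face where x_i is least, the two tilts give L (x_i^2) >= a^2 and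
    L (x_i^2) <= a^2, so that x_i has no variance. *)
Lemma face_coordinate (Q : set P) i : M `<=` Q -> tilt_closed Q ->
  (exists L, states Q L) ->
  exists a, [/\ tilt_closed (Q `|` [set a%:MP - 'X_i]),
    exists L, states (Q `|` [set a%:MP - 'X_i]) L &
    forall L, states (Q `|` [set a%:MP - 'X_i]) L -> L (('X_i - a%:MP) ^+ 2) = 0].
Proof.
move=> MQ TQ /(states_argmin 'X_i MQ)[L0 SL0 L0min].
exists (L0 'X_i); set a := L0 'X_i; split; first exact: tilt_closed_min.
  by exists L0; apply/states_set1U.
move=> L /states_set1U[SL La0].
have La : L 'X_i = a by apply/eqP; rewrite eq_le La0 L0min.
have SM := states_sub MQ SL.
have one2 : (1 : R) ^+ 2 = 1 by rewrite expr1n.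
have m12 : (-1 : R) ^+ 2 = 1 by rewrite sqrrN expr1n.
have hp := L0min _ (TQ _ i _ one2 SL).
have hm := L0min _ (TQ _ i _ m12 SL).
rewrite -(ler_pM2l (tilt_den i one2 SM)) tiltE // La -/a in hp.
rewrite -(ler_pM2l (tilt_den i m12 SM)) tiltE // La -/a in hm.
have -> : ('X_i - a%:MP) ^+ 2 = 'X_i * 'X_i - a%:MP * ('X_i *+ 2 - a%:MP) :> P by ring.
rewrite linearB /= scalarCM linearB linearMn /= scalarC (proj1 SL) La.
by apply/eqP; rewrite eq_le; apply/andP; split; lra.
Qed.

(** This replaces the representation of L by a measure. Minimizing first g and
    then the coordinates one after the other leads to a face on which no
    coordinate has variance; the states there are evaluations at a point. *)
Theorem state_point L g : states M L ->
  exists a : 'I_N -> R, g.@[a] <= L g /\ forall q, M q -> 0 <= q.@[a].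
Proof.
move=> SL.
have TM : tilt_closed M by move=> *; exact: tilt_state.
have [L0 SL0 L0min] := states_argmin g (@subset_refl _ M) (ex_intro _ _ SL).
pose Q0 := M `|` [set (L0 g)%:MP - g].
have faces n : (n <= N)%N -> exists (Q : set P) (a : 'I_N -> R),
   [/\ Q0 `<=` Q, tilt_closed Q, exists L, states Q L &
    forall L (i : 'I_N), states Q L -> (i < n)%N -> L (('X_i - (a i)%:MP) ^+ 2) = 0].
  elim: n => [|n IH] nN.
    exists Q0, (fun=> 0); split=> //; first exact: tilt_closed_min.
    by exists L0; apply/states_set1U.
  have [Q [a [Q0Q TQ neQ Qa]]] := IH (ltnW nN).
  have MQ : M `<=` Q by move=> p Mp; apply: Q0Q; left.
  have [b [Tb neb Qb]] := face_coordinate (Ordinal nN) MQ TQ neQ.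
  exists (Q `|` [set b%:MP - 'X_(Ordinal nN)]), (fun i : 'I_N => if i == n :> nat then b else a i).
  split=> // [p /Q0Q|L' i SL']; first by left.
  rewrite ltnS leq_eqVlt => /orP[/eqP iE|ilt].
    have -> : i = Ordinal nN by apply: val_inj.
    by rewrite eqxx; apply: Qb.
  by have [SL1 _] := (states_set1U _ _ _ _).1 SL'; rewrite (ltn_eqF ilt); exact: Qa.
have [Q [a [Q0Q _ [L' SL'] Qa]]] := faces N (leqnn N).
have SM : states M L' by apply: states_sub SL' => p Mp; apply: Q0Q; left.
have ev p : L' p = p.@[a].
  have mul i q : L' ('X_i * q) = a i * L' q.
    have := state_cauchy q SM (Qa _ i SL' (ltn_ord i)).
    by rewrite mulrBl linearB /= scalarCM => /eqP; rewrite subr_eq0 => /eqP.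
  have mon m : L' 'X_[m] = ('X_[m]).@[a].
    rewrite mpolyXE_id; elim/big_rec: _ => [|i q _ IH]; first by rewrite meval1 (proj1 SM).
    rewrite mevalM -IH; elim: (m i) => [|k IHk]; first by rewrite expr0 mul1r meval1 mul1r.
    by rewrite exprS -mulrA mul IHk mevalM mevalXU mulrA.
  elim/mpolyind: p => [|c m p _ _ IH]; first by rewrite linear0 meval0.
  by rewrite linearP /= mevalD mevalZ IH mon.
exists a; split; last by move=> q Mq; rewrite -ev; apply: (proj2 SM).
rewrite -ev; apply: (le_trans _ (L0min _ SL)).
have /states_set1U[] // : states Q0 L' by case: SL' => h1 h2; split=> // q /Q0Q /h2.
Qed.

End States.
End QuadraticModule.

(** * Families of pseudo-moment functionals *)

Section Family.
Variables (R : realType) (N : nat).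
Local Notation P := {mpoly R[N]}.

Definition eventually_on (F : nat -> {scalar P} -> Prop) (A : {scalar P} -> Prop) :=
  exists K, forall k L, (K <= k)%N -> F k L -> A L.

Lemma eventually_and F A B :
  eventually_on F A -> eventually_on F B -> eventually_on F (fun L => A L /\ B L).
Proof.
move=> [K1 h1] [K2 h2]; exists (maxn K1 K2) => k L; rewrite geq_max => /andP[k1 k2] FL.
by split; [exact: h1 FL | exact: h2 FL].
Qed.

Lemma eventually_imp F (A B : {scalar P} -> Prop) :
  (forall L, A L -> B L) -> eventually_on F A -> eventually_on F B.
Proof. by move=> AB [K h]; exists K => k L Kk FL; apply: AB (h _ _ Kk FL). Qed.

(** The order from which an inequality holds may depend on the multiplier h.
    Each relaxation only controls bounded degrees, but in this way all of them
    together define a set that is stable under multiplication by squares. *)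
Definition family_module F : set P :=
  [set q | forall h, eventually_on F (fun L => 0 <= L (q * h ^+ 2))].

Definition family_ideal F : set P :=
  [set q | forall h, eventually_on F (fun L => L (q * h) = 0)].

Record pseudo_family (F : nat -> {scalar P} -> Prop) : Prop := PseudoFamily {
  pf_mass : forall k L, F k L -> L 1 = 1;
  pf_psd : forall k L h, F k L -> (msize h <= k.+1)%N -> 0 <= L (h ^+ 2);
  pf_ball : forall i, family_module F (1 - 'X_i ^+ 2)
}.

Variables (F : nat -> {scalar P} -> Prop) (PF : pseudo_family F).
Local Notation M := (family_module F).
Local Notation Z := (family_ideal F).

Lemma family_ball_module : ball_module M.
Proof.
split.
- move=> p q Mp Mq h; apply: eventually_imp (eventually_and (Mp h) (Mq h)) => L [h1 h2].
  by rewrite mulrDl linearD addr_ge0.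
- by move=> q g Mq h; rewrite -mulrA -exprMn; apply: Mq.
- move=> h; exists (msize h) => k L hk FL; rewrite mul1r.
  by apply: (pf_psd PF FL); rewrite leqW.
- exact: (pf_ball PF).
Qed.
Let BM := family_ball_module.

Lemma family_cauchy a p : eventually_on F (fun L => L (a ^+ 2) = 0 -> L (a * p) = 0).
Proof.
exists (maxn (msize a) (msize p)) => k L; rewrite geq_max => /andP[ak pk] FL a0.
apply/eqP/negPn/negP => ap0.
pose t := - (L (p ^+ 2) + 1) / (2 * L (a * p)).
have : 0 <= L ((t%:MP * a + p) ^+ 2).
  apply: (pf_psd PF FL); apply: leqW.
  apply: (leq_trans (msizeD_le _ _)); rewrite geq_max pk andbT.
  rewrite mul_mpolyC; have [->|t0] := eqVneq t 0; first by rewrite scale0r msize0.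
  by rewrite msizeZ.
have -> : (t%:MP * a + p) ^+ 2 = t%:MP * (t%:MP * a ^+ 2) +
  (t%:MP * (a * p) + t%:MP * (a * p)) + p ^+ 2 by ring.
rewrite !linearD /= !scalarCM a0.
have -> : t * L (a * p) = - (L (p ^+ 2) + 1) / 2 by rewrite /t; field.
lra.
Qed.

Lemma family_psd h : eventually_on F (fun L => 0 <= L (h ^+ 2)).
Proof. by have := bm_one BM h; rewrite mul1r. Qed.

Definition rescale_fun (L : {scalar P}) (h p : P) := L (p * h ^+ 2) / L (h ^+ 2).
Lemma rescale_scalar L h : scalar (rescale_fun L h).
Proof.
by move=> a p q; rewrite /rescale_fun mulrDl -scalerAl linearP /= mulrDl mulrA.
Qed.
Definition rescale L h : {scalar P} := mkscalar (rescale_scalar L h).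

(** The separation step of Putinar's theorem. The functionals that violate
    g h^2 >= 0 are reweighted by h^2 before passing to the limit: otherwise
    L (h^2) could tend to 0 and the violation would disappear. *)
Lemma not_module_state g : ~ M g -> exists2 L, states M L & L g <= 0.
Proof.
move=> /existsNP[h nh].
have freq K : exists k L, [/\ (K <= k)%N, F k L & L (g * h ^+ 2) < 0].
  apply: contrapT => no; apply: nh; exists K => k L Kk FL.
  by rewrite leNgt; apply/negP => lt; apply: no; exists k, L.
pose F' k L' := exists k' L, [/\ (k <= k')%N, F k' L, 0 < L (h ^+ 2),
    L (g * h ^+ 2) < 0 & L' = rescale L h].
have ev' A : eventually_on F A -> exists K, forall k L', (K <= k)%N -> F' k L' ->
    exists L, [/\ A L, 0 < L (h ^+ 2), L (g * h ^+ 2) < 0 & L' = rescale L h].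
  move=> [K hK]; exists K => k L' Kk [k' [L [kk' FL h1 h2 h3]]].
  by exists L; split=> //; apply: hK FL; apply: leq_trans kk'.
have [] := @functional_limit R P F'.
- move=> k; have [K hK] := eventually_and (family_psd h) (family_cauchy h (g * h)).
  have [k' [L [kk' FL lt]]] := freq (maxn k K); rewrite geq_max in kk'.
  have /andP[k1 k2] := kk'; have [p0 cs] := hK _ _ k2 FL.
  exists (rescale L h), k', L; split=> //; rewrite lt_neqAle p0 andbT eq_sym.
  apply/eqP => /cs e; have := lt.
  have -> : g * h ^+ 2 = h * (g * h) by ring.
  by rewrite e ltxx.
- move=> p; have [C C0 MC] := bm_bounded BM p; have [C' C'0 MC'] := bm_bounded BM (- p).
  have [K hK] := ev' _ (eventually_and (MC h) (MC' h)).
  exists (C + C'), K => k L' Kk F'L; have [L [[b1 b2] h2 _ ->]] := hK _ _ Kk F'L.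
  rewrite mkscalarE /rescale_fun normrM normfV (gtr0_norm h2) ler_pdivrMr //.
  move: b1 b2; rewrite !mulrBl !linearB /= !scalarCM mulNr linearN /= => b1 b2.
  rewrite ler_norml mulrDl; have := mulr_ge0 C0 (ltW h2); have := mulr_ge0 C'0 (ltW h2) => c1 c2.
  by apply/andP; split; lra.
move=> L0 H; exists L0.
  split.
    have one k L' : F' k L' -> L' 1 = 1.
      move=> [k' [L [_ _ h0 _ ->]]].
      by rewrite mkscalarE /rescale_fun mul1r divff // gt_eqF.
    apply/eqP; rewrite eq_le; apply/andP.
    by split; [apply: (H _ _).2 | apply: (H _ _).1]; exists 0%N => k L _ /one ->.
  move=> q Mq; apply: (H _ _).1; have [K hK] := ev' _ (Mq h).
  exists K => k L' Kk F'L; have [L [b h2 _ ->]] := hK _ _ Kk F'L.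
  by rewrite mkscalarE /rescale_fun divr_ge0 // ltW.
apply: (H _ _).2; exists 0%N => k L' _ [k' [L [_ _ h0 lt ->]]].
by rewrite mkscalarE /rescale_fun pmulr_lle0 ?invr_gt0 // ltW.
Qed.

(** Putinar's Positivstellensatz for an arbitrary set of generators. The margin e
    comes from compactness of the state space. *)
Theorem positive_in_module g :
  (forall a, (forall q, M q -> 0 <= q.@[a]) -> 0 < g.@[a]) ->
  exists2 e : R, 0 < e & M (g - e%:MP).
Proof.
move=> gpos; apply: contrapT => no.
pose F' k (L : {scalar P}) := states M L /\ L g <= k.+1%:R^-1.
have [] := @functional_limit R P F'.
- move=> k; have [|L SL Lg] := @not_module_state (g - (k.+1%:R^-1)%:MP).
    by move=> MM; apply: no; exists k.+1%:R^-1; rewrite ?invr_gt0.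
  exists L; split=> //; move: Lg; rewrite linearB /= (scalarC L) (proj1 SL) mulr1.
  by rewrite subr_le0.
- move=> p; have [C bd] := states_bounded BM p.
  by exists C, 0%N => k L _ [/bd].
move=> L0 H.
have SL0 : states M L0.
  split.
    apply/eqP; rewrite eq_le; apply/andP.
    by split; [apply: (H _ _).2 | apply: (H _ _).1]; exists 0%N => k L _ [[-> _] _].
  by move=> q Mq; apply: (H _ _).1; exists 0%N => k L _ [[_ h] _]; exact: h.
have L0g : L0 g <= 0.
  apply/ler_addgt0Pr => e e0; rewrite add0r; apply: (H _ _).2.
  have [K Ke] : exists K : nat, e^-1 < K%:R.
    by exists (Num.bound e^-1); apply: archi_boundP; rewrite invr_ge0 ltW.
  exists K => k L Kk [_ le]; apply: (le_trans le).
  rewrite invf_ple ?posrE //; apply: (le_trans (ltW Ke)).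
  by rewrite ler_nat (leq_trans Kk).
have [a [ga Ma]] := state_point BM g SL0.
by have := gpos a Ma; rewrite ltNge (le_trans ga L0g).
Qed.

Lemma ideal_sqrt p : Z (p ^+ 2) -> Z p.
Proof.
move=> Zp h; apply: eventually_imp (eventually_and (Zp 1) (family_cauchy p h)).
by move=> L []; rewrite mulr1 => e /(_ e).
Qed.

Lemma ideal_mul p q : Z p -> Z (p * q).
Proof. by move=> Zp h; rewrite -mulrA. Qed.

(** From (u - e) s^2 >= 0 and u s^2 = 0 one gets e s^2 <= 0. *)
Lemma ideal_cancel u s e : 0 < e -> M (u - e%:MP) -> Z (u * s) -> Z s.
Proof.
move=> e0 Mu Zus h.
have := eventually_and (family_psd s) (family_cauchy s h).
move=> /(eventually_and (eventually_and (Mu s) (Zus s))).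
apply: eventually_imp => L [[h1 h2] [h3]]; apply.
move: h1; rewrite mulrBl linearB /= scalarCM expr2 mulrA h2 sub0r oppr_ge0.
rewrite pmulr_rle0 // => h4; by apply/eqP; rewrite eq_le h3 andbT.
Qed.
End Family.

Section Interpolation.
Variable R : rcfType.

Lemma lagrange_interpolation (y : R -> R) (rs : seq R) : uniq rs ->
  exists s : {poly R}, {in rs, forall r, s.[r] = y r}.
Proof.
elim: rs => [|r rs IH] /=; first by exists 0.
move=> /andP[rrs /IH [s sP]]; pose w := \prod_(a <- rs) ('X - a%:P).
have w0 : w.[r] != 0 by rewrite -/(root w r) root_prod_XsubC.
exists (s + ((y r - s.[r]) / w.[r]) *: w) => a; rewrite inE => /orP[/eqP->|ars].
  by rewrite hornerD hornerZ divfK // addrC subrK.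
have wa : w.[a] = 0 by apply/eqP; rewrite -/(root w a) root_prod_XsubC.
by rewrite hornerD hornerZ wa mulr0 addr0 sP.
Qed.

Lemma repeated_entry (s : seq R) : ~~ uniq s ->
  exists r s', perm_eq s [:: r, r & s'].
Proof.
elim: s => //= a s IH; rewrite negb_and negbK => /orP[ars|/IH [r [s' ss']]].
  by exists a, (rem a s); rewrite perm_cons perm_to_rem.
exists r, (a :: s'); apply: (@perm_trans _ (a :: [:: r, r & s'])).
  by rewrite perm_cons.
by rewrite -[a :: _]cat1s -[[:: r, r & a :: s']](cat1s r) (perm_catCA [:: a] [:: r; r] s').
Qed.

Lemma rootless_sign (p : {poly R}) : (forall x, ~~ root p x) ->
  (forall x, 0 < p.[x]) \/ (forall x, 0 < (- p).[x]).
Proof.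
move=> nr.
have same a b : 0 < p.[a] -> 0 < p.[b].
  move=> pa; rewrite ltNge; apply/negP => pb.
  have [ab|ba] := leP a b.
    have [|x _ rx] := @poly_ivt _ (- p) a b ab; last by have := nr x; rewrite -rootN rx.
    by rewrite !hornerN oppr_le0 oppr_ge0 pb ltW.
  have [|x _ rx] := @poly_ivt _ p b a (ltW ba); last by have := nr x; rewrite rx.
  by rewrite pb ltW.
have [p0|p0] := ltP 0 p.[0]; [left=> x; exact: same p0 | right=> x].
rewrite hornerN oppr_gt0 lt_neqAle leNgt; apply/andP; split; first exact: (nr x).
by apply/negP => px; have := same _ 0 px; rewrite ltNge p0.
Qed.

Lemma split_real_roots (p : {poly R}) : p != 0 -> exists (rs : seq R) (t : {poly R}),
  (forall x, 0 < t.[x]) /\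
  (p = \prod_(a <- rs) ('X - a%:P) * t \/ p = - (\prod_(a <- rs) ('X - a%:P) * t)).
Proof.
have [n] := ubnP (size p); elim: n => // n IH in p *; rewrite ltnS => pn p0.
have [[r rp]|nr] := pselect (exists r, root p r); last first.
  have [] := @rootless_sign p.
  - by move=> x; apply/negP => rx; apply: nr; exists x.
  - by move=> pos; exists [::], p; rewrite big_nil mul1r; split=> //; left.
  by move=> pos; exists [::], (- p); rewrite big_nil mul1r opprK; split=> //; right.
have /factor_theorem[q pE] := rp.
have q0 : q != 0 by apply: contraNneq p0 => q0; rewrite pE q0 mul0r.
have [|rs [t [tpos pe]]] := IH q _ q0.
  by move: pn; rewrite pE size_mul ?polyXsubC_eq0 // size_XsubC addn2.
exists (r :: rs), t; split=> //; rewrite big_cons pE.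
by case: pe => ->; [left | right]; ring.
Qed.
End Interpolation.

Section Tightness.
Variables (R : realType) (N : nat).
Local Notation P := {mpoly R[N]}.
Variables (F : nat -> {scalar P} -> Prop) (PF : pseudo_family F).
Local Notation M := (family_module F).
Local Notation Z := (family_ideal F).
Variables (f : P) (c : R).
Hypothesis f_ge : forall a, (forall q, M q -> 0 <= q.@[a]) -> c <= f.@[a].

Lemma meval_horner_alg p a : (horner_alg f p).@[a] = p.[f.@[a]].
Proof.
elim/poly_ind: p => [|p x IH]; first by rewrite rmorph0 meval0 horner0.
rewrite rmorphD rmorphM /= horner_algX horner_algC mevalD mevalM IH.
by rewrite hornerMXaddC mevalZ meval1 mulr1.
Qed.

(** A factor u (f) with u positive on [c, +oo[ is bounded away from 0 on the
    points of the module. *)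
Lemma ideal_cancel_horner u s : (forall t, c <= t -> 0 < u.[t]) ->
  Z (horner_alg f (u * s)) -> Z (horner_alg f s).
Proof.
move=> upos; rewrite rmorphM /= => Zus.
have [|e e0 Me] := @positive_in_module _ _ _ PF (horner_alg f u).
  by move=> a /f_ge fa; rewrite meval_horner_alg upos.
exact: ideal_cancel e0 Me Zus.
Qed.

(** Consider a shortest product of factors t - r that vanishes at t = f modulo
    the ideal. A root r < c could be cancelled, since f - r is positive on the
    points of the module, and one of two equal roots could be dropped by taking
    a square root. Hence the roots are distinct and at least c, t - c coincides
    at the roots with a square s^2, and f - c is a square plus an element of the
    ideal. Only finitely many products are involved, so the inequality holds
    exactly from some order on, without any error term. *)
Theorem tightness phi : phi != 0 -> Z (horner_alg f phi) ->
  eventually_on F (fun L => c <= L f).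
Proof.
move=> phi0 Zphi; pose w (rs : seq R) := \prod_(a <- rs) ('X - a%:P).
have wZ : exists n, `[< exists rs, size rs = n /\ Z (horner_alg f (w rs)) >].
  have [rs [t [tpos pe]]] := split_real_roots phi0.
  exists (size rs); apply/asboolP; exists rs; split=> //.
  apply: (@ideal_cancel_horner t) => [x _|]; first exact: tpos.
  rewrite mulrC; case: pe Zphi => -> //; rewrite rmorphN /= => Zn h.
  by apply: eventually_imp (Zn (- h)) => L; rewrite mulrNN.
case: (ex_minnP wZ) => n /asboolP[rs [<- Zrs]] nmin.
have {}nmin s : Z (horner_alg f (w s)) -> (size rs <= size s)%N.
  by move=> Zs; apply: nmin; apply/asboolP; exists s.
have wperm s s' : perm_eq s s' -> w s = w s' by move=> ss'; apply: perm_big.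
have rs_ge r : r \in rs -> c <= r.
  move=> rrs; rewrite leNgt; apply/negP => rc.
  have := nmin (rem r rs); rewrite (wperm _ _ (perm_to_rem rrs)) /w big_cons in Zrs.
  rewrite size_rem // => /(_ _) h; have : (size rs <= (size rs).-1)%N.
    apply: h; apply: ideal_cancel_horner Zrs => t ct.
    by rewrite hornerXsubC subr_gt0 (lt_le_trans rc).
  by case: (rs) rrs => //= a l _; rewrite ltnn.
have rs_uniq : uniq rs.
  apply/negPn/negP => /repeated_entry[r [s rss]].
  have := nmin (r :: s); rewrite (perm_size rss) /= ltnn => h; suff: false by [].
  apply: h; apply: (ideal_sqrt PF); rewrite -rmorphXn -[_ ^+ 2]mulr1 => g.
  rewrite (wperm _ _ rss) in Zrs.
  have -> : w (r :: s) ^+ 2 * 1 = w [:: r, r & s] * w s.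
    by rewrite /w !big_cons; ring.
  by rewrite rmorphM /=; apply: ideal_mul.
(* The square root is real because all roots are at least c. *)
have [s sP] := lagrange_interpolation (fun r => Num.sqrt (r - c)) rs_uniq.
have : w rs %| 'X - c%:P - s ^+ 2.
  apply: uniq_roots_dvdp.
    apply/allP => r rrs; rewrite /root !hornerE /= sP // sqr_sqrtr ?subrr //.
    by rewrite subr_ge0 rs_ge.
  by rewrite uniq_rootsE.
move=> /dvdpP[v ve].
have [K hK] := eventually_and (Zrs (horner_alg f v)) (family_psd PF (horner_alg f s)).
exists K => k L Kk FL; have [h1 h2] := hK _ _ Kk FL.
have : horner_alg f ('X - c%:P - s ^+ 2) = horner_alg f (w rs) * horner_alg f v.
  by rewrite ve mulrC rmorphM.
rewrite !rmorphB rmorphXn /= horner_algX horner_algC => /(congr1 L).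
by rewrite h1 !linearB linearZ /= (pf_mass PF FL) mulr1; lra.
Qed.
End Tightness.

(** * Prime ideals and residue fields *)

Section PrimeIdeals.
Variable A : comNzRingType.

Record ring_ideal (J : set A) : Prop := RingIdeal {
  ideal0 : J 0;
  idealD : forall x y, J x -> J y -> J (x + y);
  idealMl : forall a x, J x -> J (a * x)
}.

(** An ideal that is maximal among those disjoint from a multiplicative set is
    prime. *)
Lemma prime_avoiding (Z S : set A) : ring_ideal Z ->
  S 1 -> (forall x y, S x -> S y -> S (x * y)) -> (forall x, Z x -> ~ S x) ->
  exists J : set A, [/\ ring_ideal J, Z `<=` J, forall x, J x -> ~ S x &
    forall x y, J (x * y) -> J x \/ J y].
Proof.
move=> iZ S1 SM ZS.
pose good X := ring_ideal X /\ (forall x, X x -> ~ S x).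
(* Zorn is applied to the sets whose union with Z is admissible, so that the
   empty chain is bounded by the empty set. *)
have [|X [[iX XS] Xmax]] := @Zorn_bigcup A (fun X => good (X `|` Z)).
  move=> C CP Ctot; have [->|/set0P[X0 CX0]] := eqVneq C set0.
    by rewrite bigcup_set0 set0U.
  split; last first.
    by move=> x [[X CX Xx]|/ZS//]; apply: (proj2 (CP _ CX)); left.
  split; first by right; apply: ideal0.
  - move=> x y [[X CX Xx]|Zx] [[Y CY Yy]|Zy].
    + have [XY|YX] := Ctot _ _ CX CY.
        have [] : (Y `|` Z) (x + y).
          by apply: (idealD (proj1 (CP _ CY))); left => //; apply: XY.
        - by move=> h; left; exists Y.
        - by right.
      have [] : (X `|` Z) (x + y).
        by apply: (idealD (proj1 (CP _ CX))); left => //; apply: YX.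
      - by move=> h; left; exists X.
      - by right.
    + have [] : (X `|` Z) (x + y).
        by apply: (idealD (proj1 (CP _ CX))); [left | right].
      - by move=> h; left; exists X.
      - by right.
    + have [] : (Y `|` Z) (x + y).
        by apply: (idealD (proj1 (CP _ CY))); [right | left].
      - by move=> h; left; exists Y.
      - by right.
    + by right; apply: idealD.
  - move=> a x [[X CX Xx]|Zx]; last by right; apply: idealMl.
    have [] : (X `|` Z) (a * x).
      by apply: (idealMl (proj1 (CP _ CX))); left.
    - by move=> h; left; exists X.
    - by right.
set J := X `|` Z in iX XS Xmax *.
have ext x : ~ J x -> exists s j a, [/\ S s, J j & s = j + a * x].
  move=> nJx; apply: contrapT => no.
  pose Y := [set z | exists j a, J j /\ z = j + a * x].
  have JY : J `<=` Y by move=> z Jz; exists z, 0; rewrite mul0r addr0.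
  have YZ : Y `|` Z = Y.
    by apply/setUidPl => z Zz; apply: JY; right.
  have Yx : Y x by exists 0, 1; rewrite add0r mul1r; split=> //; apply: (ideal0 iX).
  have : X `<` Y.
    split; first by move=> z Xz; apply: JY; left.
    by move=> YX; apply: nJx; left; apply: YX.
  move=> /Xmax; rewrite YZ; apply; split.
    split; first by apply: JY; apply: (ideal0 iX).
    - move=> _ _ [j [a [Jj ->]]] [j' [a' [Jj' ->]]]; exists (j + j'), (a + a').
      by split; [apply: (idealD iX) | ring].
    - move=> b _ [j [a [Jj ->]]]; exists (b * j), (b * a).
      by split; [apply: (idealMl iX) | ring].
  by move=> z [j [a [Jj ze]]] Sz; apply: no; exists z, j, a.
exists J; split=> //; first by move=> z; right.
move=> x y Jxy; apply: contrapT => /not_orP[nx ny].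
have [s [j [a [Ss Jj se]]]] := ext _ nx; have [s' [j' [a' [Ss' Jj' se']]]] := ext _ ny.
apply: (XS (s * s')); last exact: SM.
have -> : s * s' = s' * j + (a * x) * j' + (a * a') * (x * y) by rewrite se' se; ring.
by apply: (idealD iX); [apply: (idealD iX) |]; apply: (idealMl iX).
Qed.
End PrimeIdeals.

Section ResidueField.
Variables (A : comNzRingType) (J : set A).
Hypothesis iJ : ring_ideal J.
Hypothesis J1 : ~ J 1.
Hypothesis Jprime : forall x y, J (x * y) -> J x \/ J y.

Definition primeb : {pred A} := fun x => `[< J x >].

Lemma primebE x : (x \in primeb) = `[< J x >]. Proof. by []. Qed.

Lemma primeb_idealr : idealr_closed primeb.
Proof.
split; rewrite ?primebE.
- by apply/asboolP; exact: (ideal0 iJ).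
- by apply/asboolPn.
- move=> a u v; rewrite !primebE => /asboolP Ju /asboolP Jv.
  by apply/asboolP/(idealD iJ) => //; apply: idealMl.
Qed.

Lemma primeb_prime : prime_idealr_closed primeb.
Proof.
by move=> u v /asboolP /Jprime [h|h]; apply/orP; [left | right]; apply/asboolP.
Qed.

HB.instance Definition _ := isIdealr.Build A primeb primeb_idealr.
HB.instance Definition _ := isPrimeIdealrClosed.Build A primeb primeb_prime.

Definition residue := @Quotient.quot A (primeb : idealr A).
HB.instance Definition _ := GRing.ComNzRing.on residue.

Definition residue_unit : {pred residue} := fun x => `[< exists y, y * x = 1 >].
Definition residue_inv (x : residue) : residue :=
  if pselect (exists y, y * x = 1) is left h then projT1 (cid h) else x.

Lemma residue_mulV : {in residue_unit, left_inverse 1 residue_inv *%R}.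
Proof.
move=> x /asboolP h; rewrite /residue_inv; case: pselect => // h'.
by case: cid.
Qed.
Lemma residue_unitP x y : y * x = 1 -> x \in residue_unit.
Proof. by move=> h; apply/asboolP; exists y. Qed.
Lemma residue_inv_out : {in [predC residue_unit], residue_inv =1 id}.
Proof. by move=> x /asboolPn nh; rewrite /residue_inv; case: pselect. Qed.

HB.instance Definition _ := GRing.ComNzRing_hasMulInverse.Build residue
  residue_mulV residue_unitP residue_inv_out.
HB.instance Definition _ := GRing.ComUnitRing_isIntegral.Build residue
  (@Quotient.rquot_IdomainAxiom A primeb).

Local Open Scope quotient_scope.

Lemma residue_field : exists (E : fieldType) (ev : {rmorphism A -> E}),
  forall x, ev x = 0 <-> J x.
Proof.
pose q : {rmorphism A -> residue} := \pi_(@Quotient.quot A (primeb : idealr A)).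
exists {fraction residue}, (@FracField.tofrac residue \o q).
move=> x; have -> : J x <-> q x = 0.
  rewrite -[x in J x]subr0; split.
    move=> Jx; rewrite -(rmorph0 q); apply/eqP.
    by rewrite -(@Quotient.idealrBE A (primeb : idealr A)) primebE; apply/asboolP.
  move=> qx; apply/asboolP; rewrite -primebE.
  by rewrite (@Quotient.idealrBE A (primeb : idealr A)) -[_ == _]/(q x == q 0) rmorph0 qx.
split=> [/eqP|/eqP] h; first by apply/eqP; rewrite /= tofrac_eq0 in h.
by apply/eqP; rewrite /= tofrac_eq0.
Qed.
End ResidueField.

(** * Extension of derivations *)

Section Derivations.

(** Equivalently, x |-> h x + e (D x) is a ring morphism to the dual numbers
    S[e]/(e^2). *)
Record derivation_along (B S : comNzRingType) (h : B -> S) (D : B -> S) : Prop :=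
  DerivationAlong {
    derD : forall x y, D (x + y) = D x + D y;
    derM : forall x y, D (x * y) = h x * D y + D x * h y
  }.

Section Basics.
Variables (B S : comNzRingType) (h : {rmorphism B -> S}) (D : B -> S).
Hypothesis der : derivation_along h D.

Lemma der0 : D 0 = 0.
Proof. by apply: (@addrI _ (D 0)); rewrite -(derD der) !addr0. Qed.

Lemma der1 : D 1 = 0.
Proof.
have := derM der 1 1; rewrite mulr1 rmorph1 mulr1 mul1r => e.
by apply: (@addrI _ (D 1)); rewrite addr0 -e.
Qed.

Lemma derN x : D (- x) = - D x.
Proof. by apply: (@addrI _ (D x)); rewrite -(derD der) !subrr der0. Qed.

Lemma derB x y : D (x - y) = D x - D y.
Proof. by rewrite (derD der) derN. Qed.

Lemma der_sum (I : Type) (r : seq I) (Q : pred I) (G : I -> B) :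
  D (\sum_(i <- r | Q i) G i) = \sum_(i <- r | Q i) D (G i).
Proof. exact: (big_morph D (derD der) der0). Qed.

Section ChainRule.
Variables (R : comNzRingType) (N : nat) (iota : {rmorphism R -> B}).
Hypothesis Diota : forall c, D (iota c) = 0.
Variable b : 'I_N -> B.
Local Notation ev := (mmap iota b).

Lemma chain_rule (f : {mpoly R[N]}) :
  D (ev f) = \sum_i h (ev f^`M(i)) * D (b i).
Proof.
pose good p := D (ev p) = \sum_i h (ev p^`M(i)) * D (b i).
have gC c : good c%:MP.
  rewrite /good mmapC Diota big1 // => i _.
  by rewrite mderivC mmap0 rmorph0 mul0r.
have gX i : good 'X_i.
  rewrite /good mmapX mmap1U (bigD1 i) //= big1 => [|j ji].
    have -> : ('X_i)^`M(i) = 1 :> {mpoly R[N]}.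
      have U0 : (U_(i) - U_(i))%MM = 0%MM :> 'X_{1..N}.
        by apply/mnmP => j; rewrite mnmBE mnm0E subnn.
      by rewrite mderivX mnm1E eqxx scale1r U0 mpolyX0.
    by rewrite !rmorph1 mul1r addr0.
  by rewrite mderivX mnm1E eq_sym (negbTE ji) scale0r mmap0 rmorph0 mul0r.
have gD p q : good p -> good q -> good (p + q).
  rewrite /good => gp gq; rewrite mmapD (derD der) gp gq -big_split /=.
  by apply: eq_bigr => i _; rewrite mderivD mmapD rmorphD mulrDl.
have gM p q : good p -> good q -> good (p * q).
  rewrite /good => gp gq; rewrite rmorphM (derM der) gp gq mulr_sumr mulr_suml -big_split /=.
  by apply: eq_bigr => i _; rewrite mderivM mmapD !rmorphM rmorphD !rmorphM /=; ring.
elim/mpolyind: f => [|c m p _ _ gp]; first by rewrite -mpolyC0; apply: gC.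
apply: (gD _ _) => //; rewrite -mul_mpolyC; apply: (gM _ _) => //.
rewrite mpolyXE_id; apply: (big_ind good) => [|x y|i _]; [by rewrite -mpolyC1 | exact: gM |].
elim: (m i) => [|k IH]; first by rewrite expr0 -mpolyC1.
by rewrite exprS; apply: gM.
Qed.
End ChainRule.
End Basics.

Section Adjoin.
Variables (B : comNzRingType) (E : fieldType) (h : {rmorphism B -> E}) (D : B -> E).
Hypothesis der : derivation_along h D.
Hypothesis Dker : forall x, h x = 0 -> D x = 0.
Hypothesis char0 : forall n, n.+1%:R != 0 :> E.
Variable a : E.

Lemma comm_eval : commr_rmorph h a. Proof. by move=> x; apply: mulrC. Qed.

Let h' : {rmorphism {poly B} -> E} := horner_morph comm_eval.
Let D' w (q : {poly B}) := (map_poly D q).[a] + (map_poly h q)^`().[a] * w.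

Lemma coef_map_der q i : (map_poly D q)`_i = D q`_i.
Proof. by apply: coef_map_id0; apply: (der0 der). Qed.

Lemma adjoin_derivation w : derivation_along h' (D' w).
Proof.
split=> p q; rewrite /D'.
  have -> : map_poly D (p + q) = map_poly D p + map_poly D q.
    by apply/polyP => i; rewrite coefD !coef_map_der coefD (derD der).
  by rewrite rmorphD derivD !hornerD mulrDl; ring.
have -> : map_poly D (p * q) =
    map_poly h p * map_poly D q + map_poly D p * map_poly h q.
  apply/polyP => i; rewrite coefD !coefM coef_map_der coefM (der_sum der) -big_split /=.
  by apply: eq_bigr => j _; rewrite (derM der) !coef_map_der !coef_map.
by rewrite /= /horner_morph rmorphM /= derivM !hornerD !hornerM; ring.
Qed.

(** If no polynomial with nonzero image vanishes at a, any w will do. Otherwise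
    take such a p whose image has least degree: its derivative does not vanish
    at a in characteristic 0, and the requirement D (p (a)) = 0 determines w.
    Every other relation reduces to p by pseudo-division, the remainder having
    image 0 by minimality. *)
Lemma adjoin_kernel : exists w, forall q, h' q = 0 -> D' w q = 0.
Proof.
have [all0|] := pselect (forall q, h' q = 0 -> map_poly h q = 0).
  exists 0 => q /all0 q0; rewrite /D' mulr0 addr0.
  have -> : map_poly D q = 0; last by rewrite horner0.
  apply/polyP => i; rewrite coef_map_der coef0; apply: Dker.
  by have := congr1 (fun r : {poly E} => r`_i) q0; rewrite coef_map coef0.
move=> /existsNP[q0 /not_implyP[q0a q00]].
pose bad n := `[< exists q, [/\ h' q = 0, map_poly h q != 0 & size (map_poly h q) = n] >].
have exn : exists n, bad n.
  by exists (size (map_poly h q0)); apply/asboolP; exists q0; split=> //; apply/eqP.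
case: (ex_minnP exn) => n /asboolP[q1 [q1a q10 sq1]] nmin.
have {}nmin q : h' q = 0 -> (size (map_poly h q) < n)%N -> map_poly h q = 0.
  move=> qa; rewrite ltnNge => qn; apply/eqP/negPn/negP => q0'; move/negP: qn; apply.
  by apply: nmin; apply/asboolP; exists q.
(* Coefficients beyond n have image 0; without them the leading coefficient
   of p is not killed by h and division by p is meaningful. *)
pose p := take_poly n q1.
have hp : map_poly h p = map_poly h q1.
  apply/polyP => i; rewrite !coef_map coef_take_poly; have [ni|ni] := ltnP i n; first by [].
  apply: (etrans (rmorph0 h)).
  by rewrite -coef_map nth_default ?sq1.
have pa : h' p = 0 by rewrite -q1a /= /horner_morph hp.
have n0 : (0 < n)%N by rewrite -sq1 lt0n size_poly_eq0.
have spn : size p = n.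
  apply/eqP; rewrite eqn_leq size_take_poly -sq1 -hp; exact: size_poly.
have lcp : h (lead_coef p) != 0.
  rewrite /lead_coef spn -coef_map hp -sq1.
  by rewrite -[X in X != _]/(lead_coef (map_poly h q1)) lead_coef_eq0.
have p0 : p != 0 by rewrite -size_poly_eq0 spn -lt0n.
set P := map_poly h p; have Pn : size P = n by rewrite /P hp.
have P0 : P != 0 by rewrite /P hp.
have Pa : P.[a] = 0 by exact: pa.
have n1 : (1 < n)%N.
  rewrite -Pn ltnNge; apply/negP => /size1_polyC Pc; move: Pa P0; rewrite Pc hornerC.
  by move=> ->; rewrite eqxx.
have P'a : P^`().[a] != 0.
  apply/negP => /eqP P'a.
  have : map_poly h p^`() = 0.
    apply: nmin; first by rewrite /= /horner_morph -deriv_map.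
    by rewrite -deriv_map -[n]Pn lt_size_deriv.
  rewrite -deriv_map => /(congr1 (fun r : {poly E} => r`_n.-2)) /eqP.
  rewrite coef_deriv coef0 -/P; case: (n) n1 lcp spn => [//|[//|m]] _ lcp spn /=.
  rewrite /lead_coef spn /= -coef_map -/P in lcp.
  by rewrite -mulr_natr mulf_eq0 (negbTE lcp) (negbTE (char0 _)).
exists (- (map_poly D p).[a] / P^`().[a]) => q qa.
set w := _ / _; have dw := adjoin_derivation w.
have Dp : D' w p = 0 by rewrite /D' -/P [_ * w]mulrC /w divfK // subrr.
pose c := lead_coef p ^+ Pdiv.CommonRing.rscalp q p.
pose r := Pdiv.CommonRing.rmodp q p.
have e : c%:P * q = Pdiv.CommonRing.rdivp q p * p + r.
  by rewrite mul_polyC; exact: Pdiv.ComRing.rdivp_eq.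
have hc : h' c%:P != 0.
  by rewrite /h' /= horner_morphC /c rmorphXn expf_eq0 negb_and lcp orbT.
have ra : h' r = 0.
  by have := congr1 h' e; rewrite rmorphM rmorphD rmorphM /= pa mulr0 add0r qa mulr0.
have hr : map_poly h r = 0.
  apply: nmin => //; apply: leq_ltn_trans (size_poly _ _) _.
  by rewrite -[n in (_ < n)%N]spn Pdiv.CommonRing.ltn_rmodpN0.
have Dr : D' w r = 0.
  rewrite /D' hr deriv0 horner0 mul0r addr0.
  have -> : map_poly D r = 0; last by rewrite horner0.
  apply/polyP => i; rewrite coef_map_der coef0; apply: Dker.
  by have := congr1 (fun r : {poly E} => r`_i) hr; rewrite coef_map coef0.
have := congr1 (D' w) e.
rewrite (derM dw) (derD dw) (derM dw) qa mulr0 addr0 Dp Dr pa !mulr0 !addr0.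
by move/eqP; rewrite mulf_eq0 (negbTE hc) => /eqP.
Qed.

Lemma adjoin_element : exists (B' : comNzRingType) (j : {rmorphism B -> B'})
    (h2 : {rmorphism B' -> E}) (D2 : B' -> E) (b : B'),
  [/\ derivation_along h2 D2, forall x, h2 x = 0 -> D2 x = 0,
      forall x, h2 (j x) = h x, forall x, D2 (j x) = D x & h2 b = a].
Proof.
have [w wP] := adjoin_kernel.
exists {poly B}, (polyC : {rmorphism B -> {poly B}}), h', (D' w), 'X; split.
- exact: adjoin_derivation.
- exact: wP.
- by move=> x; rewrite /h' /= horner_morphC.
- move=> x; rewrite /D' map_polyC derivC horner0 mul0r addr0.
  have -> : map_poly D x%:P = (D x)%:P.
    apply/polyP => i; rewrite coef_map_der !coefC; case: eqP => // _; exact: (der0 der).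
  by rewrite hornerC.
- by rewrite /h' /= horner_morphX.
Qed.
End Adjoin.

(** Derivations extend to the field generated by the a_i. The domain grows by one
    polynomial variable for each a_i and maps to the fixed field E, so that no
    intermediate fields are formed. *)
Lemma adjoin_elements (E : fieldType) (N : nat) (a : 'I_N -> E) :
  (forall n, n.+1%:R != 0 :> E) ->
  forall (B : comNzRingType) (h : {rmorphism B -> E}) (D : B -> E),
  derivation_along h D -> (forall x, h x = 0 -> D x = 0) ->
  exists (B' : comNzRingType) (j : {rmorphism B -> B'})
    (h2 : {rmorphism B' -> E}) (D2 : B' -> E) (b : 'I_N -> B'),
  [/\ derivation_along h2 D2, forall x, h2 x = 0 -> D2 x = 0,
      forall x, h2 (j x) = h x, forall x, D2 (j x) = D x & forall i, h2 (b i) = a i].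
Proof.
move=> char0 B h D der Dker.
suff H n : (n <= N)%N -> exists (B' : comNzRingType) (j : {rmorphism B -> B'})
    (h2 : {rmorphism B' -> E}) (D2 : B' -> E) (b : 'I_N -> B'),
  [/\ derivation_along h2 D2, forall x, h2 x = 0 -> D2 x = 0,
      forall x, h2 (j x) = h x, forall x, D2 (j x) = D x &
      forall i : 'I_N, (i < n)%N -> h2 (b i) = a i].
  have [B' [j [h2 [D2 [b [h1 h3 h4 h5 h6]]]]]] := H N (leqnn N).
  by exists B', j, h2, D2, b; split=> // i; apply: h6.
elim: n => [|n IH] nN.
  by exists B, (idfun : {rmorphism B -> B}), h, D, (fun=> 0).
have [B1 [j1 [h1 [D1 [b1 [der1 ker1 e1 d1 a1]]]]]] := IH (ltnW nN).
have [B2 [j2 [h2 [D2 [b2 [der2 ker2 e2 d2 a2]]]]]] :=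
  adjoin_element der1 ker1 char0 (a (Ordinal nN)).
exists B2, (j2 \o j1 : {rmorphism B -> B2}), h2, D2,
  (fun i : 'I_N => if i == n :> nat then b2 else j2 (b1 i)).
split=> // [x|x|i]; rewrite /= ?e2 ?d2 //.
rewrite ltnS leq_eqVlt => /orP[/eqP iE|ilt].
  by have -> : i = Ordinal nN; [exact: val_inj | rewrite eqxx].
by rewrite (ltn_eqF ilt) e2 a1.
Qed.
End Derivations.

(** * Critical values *)

Section SymmetricIndices.
Variable n : nat.

Lemma symidxC (i j : 'I_n) : symidx i j = symidx j i.
Proof. by apply: val_inj; rewrite /= /symrank minnC maxnC. Qed.

Lemma symrank_row (i j : 'I_n) : (i <= j)%N ->
  (\sum_(a < i) (n - a) <= symrank n i j < \sum_(a < i.+1) (n - a))%N.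
Proof.
move=> ij; rewrite /symrank (minn_idPl ij) (maxn_idPr ij) leq_addr big_ord_recr /=.
by rewrite ltn_add2l ltn_sub2r // (leq_ltn_trans ij).
Qed.

Lemma symidx_inj (i j i' j' : 'I_n) : (i <= j)%N -> (i' <= j')%N ->
  symidx i j = symidx i' j' -> i = i' /\ j = j'.
Proof.
pose T a := (\sum_(k < a) (n - k))%N.
have mono (a b : nat) : (a <= b)%N -> (T a <= T b)%N.
  by move=> ab; rewrite /T -(subnKC ab) big_split_ord /= leq_addr.
have neq (p q p' q' : 'I_n) : (p <= q)%N -> (p' <= q')%N -> (p < p')%N ->
    (symrank n p q < symrank n p' q')%N.
  move=> /symrank_row/andP[_ u1] /symrank_row/andP[l2 _] /mono lt.
  exact: leq_trans u1 (leq_trans lt l2).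
move=> ij ij' /(congr1 val) /= e.
have ii' : i = i' :> nat.
  case: (ltngtP i i') => // lt; first by have := neq _ _ _ _ ij ij' lt; rewrite e ltnn.
  by have := neq _ _ _ _ ij' ij lt; rewrite e ltnn.
split; apply: val_inj => //=; move: e.
rewrite /symrank !(minn_idPl _) // !(maxn_idPr _) // -ii' => /addnI e.
by rewrite -(subnK ij) e ii' subnK.
Qed.

(** The index map is injective on the pairs i <= j, and there are sigma n of them. *)
Lemma sum_symidx (V : nmodType) (G : 'I_(sigma n) -> V) :
  \sum_k G k = \sum_(i < n) \sum_(j : 'I_n | (i <= j)%N) G (symidx i j).
Proof.
pose A := [set p : 'I_n * 'I_n | (p.1 <= p.2)%N]%SET.
have injA : {in A &, injective (fun p : 'I_n * 'I_n => symidx p.1 p.2)}.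
  move=> [i j] [i' j']; rewrite !inE /= => ij ij' /(symidx_inj ij ij') [-> ->] //.
have full : [set symidx p.1 p.2 | p in A]%SET = [set: 'I_(sigma n)]%SET.
  apply/eqP; rewrite eqEcard finset.subsetT cardsT card_ord card_in_imset //=.
  rewrite -sum1_card (eq_bigl (fun p : 'I_n * 'I_n => xpredT p.1 && (p.1 <= p.2)%N)); last first.
    by move=> p; rewrite inE.
  rewrite -(pair_big_dep xpredT (fun i j : 'I_n => (i <= j)%N) (fun _ _ => 1%N)) /=.
  rewrite -sum_rows leq_sum // => i _.
  rewrite sum1_card -[X in (X <= _)%N](card_ord (n - i)).
  have ltn (k : 'I_(n - i)) : (i + k < n)%N.
    by rewrite -ltn_subRL.
  pose s (k : 'I_(n - i)) : 'I_n := Ordinal (ltn k).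
  have sinj : injective s by move=> k k' /(congr1 val) /= /addnI /val_inj.
  rewrite -(card_image sinj); apply: subset_leq_card; apply/fintype.subsetP => _ /mapP[k _ ->].
  by rewrite unfold_in; exact: leq_addr.
rewrite (eq_bigl (fun k => k \in [set: 'I_(sigma n)]%SET)); last by move=> k; rewrite inE.
rewrite -full big_imset //= pair_big_dep /=.
by apply: eq_bigl => p; rewrite inE.
Qed.
End SymmetricIndices.

Section Gradient.
Variables (R : realType) (n m d : nat).
Local Notation N := (sigma n + m)%N.
Variables (f : {mpoly R[N]}).

Lemma Xmx_sym i j : Xmx R n m i j = Xmx R n m j i.
Proof. by rewrite !mxE symidxC. Qed.

Lemma Theta_sym i j : Theta f d i j = Theta f d j i.
Proof.
rewrite !mxE eq_sym /xvar symidxC; case: eqP => // ->; by [].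
Qed.

Section Identity.
Variables (B S : comNzRingType) (h : {rmorphism B -> S}) (D : B -> S).
Hypothesis der : derivation_along h D.
Variables (iota : {rmorphism R -> B}).
Hypothesis Diota : forall c, D (iota c) = 0.
Variable b : 'I_N -> B.
Local Notation ev := (mmap iota b).

(** The differential of f in terms of Theta and p. The factor 1/2 in Theta
    compensates for x_ij occurring at two places of the symmetric matrix X, and
    the terms d f collect into a multiple of the differential of the trace
    condition. It is used for an abstract derivation of a residue field, where
    it shows that f is constant, and for the derivative along a curve. *)
Lemma theta_identity : D (ev f) =
  \sum_i \sum_j h (ev (Theta f d i j)) * D (ev (Xmx R n m i j)) +
  \sum_t h (ev (pmul f d t)) * D (ev 'X_(yvar n t)) +
  h (ev f) *+ d * D (ev (trace1 R n m)).
Proof.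
have evX i : ev 'X_i = b i by rewrite mmapX mmap1U.
have evd g : h (ev (g - d%:R *: f)) = h (ev g) - h (ev f) *+ d.
  by rewrite mmapB rmorphB mmapZ rmorphM !rmorph_nat mulr_natl.
have DT : D (ev (trace1 R n m)) =
    \sum_i D (b (xvar m i i)) + \sum_t D (b (yvar n t)).
  rewrite /trace1 rmorphB rmorph1 (derB der) (der1 der) subr0 rmorphD (derD der) !rmorph_sum.
  rewrite !(der_sum der) /=; congr (_ + _); apply: eq_bigr => i _; first by rewrite mxE evX.
  by rewrite evX.
rewrite (chain_rule der Diota) big_split_ord /= DT mulrDr.
have -> : \sum_(t < m) h (ev (pmul f d t)) * D (ev 'X_(yvar n t)) =
   \sum_(t < m) h (ev f^`M(rshift (sigma n) t)) * D (b (rshift (sigma n) t))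
   - h (ev f) *+ d * \sum_t D (b (yvar n t)).
  rewrite mulr_sumr -sumrB; apply: eq_bigr => t _.
  by rewrite evd evX mulrBl.
pose g i j := h (ev f^`M(xvar m i j)) * D (b (xvar m i j)).
have gC i j : g i j = g j i by rewrite /g /xvar symidxC.
have -> : \sum_(i < sigma n) h (ev f^`M(lshift m i)) * D (b (lshift m i)) =
    \sum_i g i i + \sum_(i < n) \sum_(j : 'I_n | (i < j)%N) g i j.
  rewrite sum_symidx -big_split /=; apply: eq_bigr => i _.
  rewrite (bigD1 i) //=; congr (_ + _); apply: eq_bigl => j.
  by rewrite ltn_neqAle andbC eq_sym.
have -> : \sum_i \sum_j h (ev (Theta f d i j)) * D (ev (Xmx R n m i j)) =
    \sum_i g i i - h (ev f) *+ d * (\sum_i D (b (xvar m i i)))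
    + \sum_(i < n) \sum_(j : 'I_n | (i < j)%N) g i j.
  pose half := h (iota 2^-1).
  have halfE : half + half = 1.
    have e2 : 2^-1 + 2^-1 = 1 :> R by field.
    by rewrite /half -rmorphD -rmorphD e2 !rmorph1.
  have -> : \sum_(i < n) \sum_(j : 'I_n | (i < j)%N) g i j =
      \sum_i \sum_(j : 'I_n | j != i) half * g i j.
    transitivity (\sum_(i < n) \sum_(j : 'I_n | (i < j)%N) half * g i j +
                  \sum_(i < n) \sum_(j : 'I_n | (j < i)%N) half * g i j).
      rewrite [X in _ + X](exchange_big_dep xpredT) //= -big_split /=.
      apply: eq_bigr => i _; rewrite -big_split /=; apply: eq_bigr => j _.
      by rewrite (gC j i) -mulrDl halfE mul1r.
    rewrite -big_split /=; apply: eq_bigr => i _.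
    rewrite [RHS](bigID (fun j : 'I_n => (i < j)%N)) /=; congr (_ + _).
      by apply: eq_bigl => j; rewrite -val_eqE neq_ltn; case: ltngtP.
    by apply: eq_bigl => j; rewrite -val_eqE neq_ltn; case: ltngtP.
  rewrite mulr_sumr -sumrB -big_split /=; apply: eq_bigr => i _.
  rewrite (bigD1 i) //=; congr (_ + _).
    by rewrite !mxE eqxx evd evX mulrBl.
  apply: eq_bigr => j ji; rewrite !mxE eq_sym (negbTE ji) evX mmapZ rmorphM /=.
  by rewrite mulrA.
ring.
Qed.
End Identity.
End Gradient.

Section CriticalValues.
Variables (R : realType) (n m d : nat).
Local Notation N := (sigma n + m)%N.
Local Notation P := {mpoly R[N]}.
Variables (f : P) (Z : set P).
Hypothesis iZ : ring_ideal Z.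
Hypothesis Ztrace : Z (trace1 R n m).
Hypothesis ZX : forall i j, Z ((Xmx R n m *m Theta f d) i j).
Hypothesis Zy : forall t, Z (pmul f d t * 'X_(yvar n t)).

(** Let G be a generalized inverse of T. Then
    tr (T DX) = tr (T G T DX) = tr (G T DX T), and T DX T = - T X DT = 0. The
    argument involves no diagonalization and works over every field. *)
Lemma symmetric_trace_zero (E : fieldType) (X T DX DT : 'M[E]_n) :
  X^T = X -> T^T = T -> DX^T = DX -> X *m T = 0 -> X *m DT + DX *m T = 0 ->
  \sum_i \sum_j T i j * DX i j = 0.
Proof.
move=> Xs Ts DXs XT0 e.
have TX0 : T *m X = 0 by rewrite -Ts -Xs -trmx_mul XT0 trmx0.
have -> : \sum_i \sum_j T i j * DX i j = \tr (T *m DX).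
  rewrite /mxtrace; apply: eq_bigr => i _; rewrite mxE; apply: eq_bigr => j _.
  by congr (_ * _); rewrite -[in LHS]DXs mxE.
have TDT : T *m (DX *m T) = 0.
  have -> : DX *m T = - (X *m DT) by apply/eqP; rewrite -addr_eq0 addrC e.
  by rewrite mulmxN mulmxA TX0 mul0mx oppr0.
rewrite -{1}(mulmxKpV (submx_refl T)) -!mulmxA mxtrace_mulC -!mulmxA.
by rewrite TDT !mulmx0 linear0.
Qed.

Lemma rmorph_mpoly_eq (S : comNzRingType) (g1 g2 : {rmorphism P -> S}) :
  (forall c, g1 c%:MP = g2 c%:MP) -> (forall i, g1 'X_i = g2 'X_i) -> g1 =1 g2.
Proof.
move=> eC eX p; elim/mpolyind: p => [|c k p _ _ IH]; first by rewrite !rmorph0.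
rewrite !rmorphD IH -mul_mpolyC !rmorphM /= eC; congr (_ * _ + _).
rewrite mpolyXE_id !rmorph_prod; apply: eq_bigr => i _.
by rewrite !rmorphXn /= eX.
Qed.

(** Otherwise some prime ideal contains Z and leaves f transcendental in the
    residue field E. Then d/df extends to a derivation that is defined on the
    coordinates and takes values in E, and by the equations X Theta = 0,
    p_t y_t = 0 and trace = 1 it vanishes at f, where its value is 1. *)
Theorem finitely_many_critical_values :
  exists2 phi : {poly R}, phi != 0 & Z (horner_alg f phi).
Proof.
apply: contrapT => no.
pose S := [set horner_alg f phi | phi in [set phi : {poly R} | phi != 0]].
have [|_ _ [p p0 <-] [q q0 <-]|x Zx [p p0 px]|J [iJ ZJ JS Jprime]] :=
  @prime_avoiding P Z S iZ.
- by exists 1; [rewrite /= oner_neq0 | rewrite rmorph1].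
- by exists (p * q); [rewrite /= mulf_neq0 | rewrite rmorphM].
- by apply: no; exists p => //; rewrite px.
have JC c : c != 0 -> ~ J c%:MP.
  move=> c0 /JS; apply; exists c%:P; first by rewrite /= polyC_eq0.
  by rewrite horner_algC -mul_mpolyC mulr1.
have J1 : ~ J 1 by rewrite -mpolyC1; apply: JC; rewrite oner_neq0.
have [E [ev0 ev0J]] := residue_field iJ J1 Jprime.
have char0 k : k.+1%:R != 0 :> E.
  apply/eqP => e; apply: (@JC k.+1%:R); first by rewrite pnatr_eq0.
  by apply/ev0J; rewrite !rmorph_nat.
pose iotaE : {rmorphism R -> E} := ev0 \o (@mpolyC N R).
have commE : commr_rmorph iotaE (ev0 f) by move=> x; apply: mulrC.
pose h0 : {rmorphism {poly R} -> E} := horner_morph commE.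
have h0E p : h0 p = ev0 (horner_alg f p).
  elim/poly_ind: p => [|p c IH]; first by rewrite !rmorph0.
  rewrite !rmorphD !rmorphM {}IH /= horner_morphX horner_morphC horner_algX horner_algC.
  by rewrite -mul_mpolyC mulr1.
pose D0 p := h0 p^`().
have der0' : derivation_along h0 D0.
  split=> p q; rewrite /D0; first by rewrite derivD rmorphD.
  by rewrite derivM rmorphD !rmorphM /= addrC mulrC [h0 p^`() * _]mulrC; ring.
have ker0 p : h0 p = 0 -> D0 p = 0.
  rewrite h0E => /ev0J /JS nS; have -> : p = 0.
    by apply/eqP/negPn/negP => p0; apply: nS; exists p.
  by rewrite /D0 deriv0 rmorph0.
have [B [j [h [D [b [der ker hj Dj hb]]]]]] :=
  adjoin_elements (fun i => ev0 'X_i) char0 der0' ker0.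
pose iota : {rmorphism R -> B} := j \o polyC.
have Diota c : D (iota c) = 0 by rewrite /= Dj /D0 derivC rmorph0.
pose ev : {rmorphism P -> B} := mmap iota b.
have hev p : h (ev p) = ev0 p.
  apply: (@rmorph_mpoly_eq E (h \o ev) ev0) => [c|i] /=.
    by rewrite /ev mmapC /= hj /h0 /= horner_morphC.
  by rewrite /ev mmapX mmap1U hb.
have kerZ p : Z p -> D (ev p) = 0.
  by move=> Zp; apply: ker; rewrite hev; apply/ev0J/ZJ.
have Df : D (ev f) = 1.
  have : D (ev f - j 'X) = 0.
    by apply: ker; rewrite rmorphB hev hj /h0 /= horner_morphX subrr.
  by rewrite (derB der) Dj /D0 derivX rmorph1 => /eqP; rewrite subr_eq0 => /eqP.
have := theta_identity d f der Diota b; rewrite -/ev Df.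
rewrite (kerZ _ Ztrace) mulr0 addr0 [X in _ + X]big1 => [|t _]; last first.
  have := kerZ _ (Zy t); rewrite rmorphM (derM der).
  have : ev0 (pmul f d t * 'X_(yvar n t)) = 0 by apply/ev0J/ZJ.
  rewrite rmorphM -!hev => /eqP; rewrite mulf_eq0 => /orP[] /eqP -> //.
    by rewrite mul0r.
  by rewrite mulr0 addr0.
rewrite addr0 => e.
pose Xh : 'M[E]_n := \matrix_(i, k) h (ev (Xmx R n m i k)).
pose Th : 'M[E]_n := \matrix_(i, k) h (ev (Theta f d i k)).
pose DX : 'M[E]_n := \matrix_(i, k) D (ev (Xmx R n m i k)).
pose DT : 'M[E]_n := \matrix_(i, k) D (ev (Theta f d i k)).
have : \sum_i \sum_k Th i k * DX i k = 0.
  apply: (@symmetric_trace_zero E Xh Th DX DT).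
  - by apply/matrixP => i k; rewrite mxE [LHS]mxE [RHS]mxE Xmx_sym.
  - by apply/matrixP => i k; rewrite mxE [LHS]mxE [RHS]mxE Theta_sym.
  - by apply/matrixP => i k; rewrite mxE [LHS]mxE [RHS]mxE Xmx_sym.
  - apply/matrixP => i k.
    have e0 : ev0 ((Xmx R n m *m Theta f d) i k) = 0 by apply/ev0J/ZJ.
    rewrite [RHS]mxE -[RHS]e0 [LHS]mxE [in RHS]mxE rmorph_sum; apply: eq_bigr => l _.
    by rewrite [Xh _ _]mxE [Th _ _]mxE [RHS]rmorphM -!hev.
  - apply/matrixP => i k; rewrite [LHS]mxE [RHS]mxE -[RHS](kerZ _ (ZX i k)).
    rewrite [in RHS]mxE rmorph_sum (der_sum der) [(Xh *m DT) i k]mxE [(DX *m Th) i k]mxE.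
    rewrite -big_split /=; apply: eq_bigr => l _.
    by rewrite [Xh _ _]mxE [Th _ _]mxE [DX _ _]mxE [DT _ _]mxE rmorphM (derM der).
under eq_bigr do under eq_bigr do rewrite [Th _ _]mxE [DX _ _]mxE.
by rewrite -e => /eqP; rewrite oner_eq0.
Qed.
End CriticalValues.

(** * Lebesgue-null sets *)

Section NullSets.
Variables (R : realType) (I : finType).
Local Notation box_volume a b := (\prod_(i : I) (b i - a i)).

Lemma ler_sum_subseq (T : eqType) (F : T -> R) (s s' : seq T) :
  (forall t, 0 <= F t) -> uniq s -> uniq s' -> {subset s <= s'} ->
  \sum_(t <- s) F t <= \sum_(t <- s') F t.
Proof.
move=> F0 us us' ss'.
rewrite [leRHS](bigID (mem s)) /= -[leLHS]addr0 lerD //; last by rewrite sumr_ge0.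
rewrite -[leRHS]big_filter le_eqVlt; apply/orP; left; apply/eqP; apply: perm_big.
apply: uniq_perm => //; first exact: filter_uniq.
by move=> t; rewrite mem_filter; case: (boolP (t \in s)) => // /ss' ->.
Qed.

(** Covers may be indexed by any countable type: the unused natural numbers get
    the box reduced to a point, whose volume is 0 because I is inhabited. *)
Lemma null_of_covers (i0 : I) (A : set {ffun I -> R}) :
  (forall e : R, 0 < e -> exists (T : countType) (a b : T -> I -> R),
    [/\ forall t i, a t i <= b t i,
        forall x, A x -> exists t, forall i, a t i <= x i <= b t i &
        forall s, uniq s -> \sum_(t <- s) box_volume (a t) (b t) <= e]) ->
  lebesgue_null A.
Proof.
move=> cov e /cov[T [a [b [ab cA vol]]]].
pose ext (c : T -> I -> R) j := if @pickle_inv T j is Some t then c t else fun=> 0.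
exists (ext a), (ext b); split.
- by move=> j i; rewrite /ext; case: pickle_inv => [t|].
- move=> x /cA[t tx]; exists (pickle t) => i; rewrite /ext pickleK_inv; exact: tx.
move=> l; apply: le_trans (vol (pmap (@pickle_inv T) (iota 0 l)) _); last first.
  by rewrite (pmap_uniq (@pickle_invK T)) // iota_uniq.
rewrite -(big_mkord xpredT (fun j => box_volume (ext a j) (ext b j))).
rewrite /index_iota subn0; elim: (iota 0 l) => [|j s IH]; first by rewrite !big_nil.
rewrite big_cons /= /ext; case E: pickle_inv => [t|] /=.
  by rewrite big_cons lerD2l; apply: IH.
by rewrite (bigD1 i0) //= subrr mul0r add0r; apply: IH.
Qed.

Lemma null_set0 (i0 : I) : lebesgue_null (set0 : set {ffun I -> R}).
Proof.
apply: (null_of_covers i0) => e e0; exists void, (fun _ _ => 0), (fun _ _ => 0).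
by split=> // s _; rewrite big1 ?ltW // => -[].
Qed.

Lemma sum_halves l : \sum_(k < l) (2 ^+ k.+1)^-1 <= 1 :> R.
Proof.
suff -> : \sum_(k < l) (2 ^+ k.+1)^-1 = 1 - (2 ^+ l)^-1 :> R.
  by rewrite gerBl invr_ge0 exprn_ge0.
elim: l => [|l IH]; first by rewrite big_ord0 expr0 invr1 subrr.
by rewrite big_ord_recr /= IH exprS; field; rewrite expf_neq0 // pnatr_eq0.
Qed.

Lemma null_bigcup (i0 : I) (A : nat -> set {ffun I -> R}) :
  (forall k, lebesgue_null (A k)) -> lebesgue_null (\bigcup_k A k).
Proof.
move=> nullA; apply: (null_of_covers i0) => e e0.
pose d k : R := e * (2 ^+ k.+1)^-1.
have d0 k : 0 < d k by rewrite mulr_gt0 // invr_gt0 exprn_gt0.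
have [a aP] := choice (fun k => nullA k _ (d0 k)).
have [b abP] := choice aP.
exists (nat * nat)%type, (fun t => a t.1 t.2), (fun t => b t.1 t.2); split.
- by move=> [k j] i; have [h _ _] := abP k; apply: h.
- move=> x [k _ Akx]; have [_ h _] := abP k; have [j hj] := h x Akx.
  by exists (k, j).
move=> s us; pose F (t : nat * nat) := box_volume (a t.1 t.2) (b t.1 t.2).
have F0 t : 0 <= F t.
  apply: prodr_ge0 => i _; rewrite subr_ge0; by have [h _ _] := abP t.1; apply: h.
pose l := \max_(t <- s) (maxn t.1 t.2).+1.
have ls t : t \in s -> (t.1 < l)%N && (t.2 < l)%N.
  move=> ts; have := @leq_bigmax_seq _ s xpredT (fun t => (maxn t.1 t.2).+1) t ts isT.
  by rewrite -/l gtn_max.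
pose s' := [seq (k, j) | k <- iota 0 l, j <- iota 0 l].
apply: (@le_trans _ _ (\sum_(t <- s') F t)).
  apply: ler_sum_subseq => //; first by apply: allpairs_uniq; rewrite ?iota_uniq // => -[? ?] [? ?].
  move=> [k j] /ls /andP[/= kl jl]; apply/allpairsP; exists (k, j).
  by split; rewrite // mem_iota add0n.
rewrite big_allpairs /=.
have iotaE (G : nat -> R) : \sum_(k <- iota 0 l) G k = \sum_(k < l) G k.
  by rewrite -(big_mkord xpredT) /index_iota subn0.
apply: (@le_trans _ _ (\sum_(k <- iota 0 l) d k)).
  by apply: ler_sum => k _; have [_ _ h] := abP k; rewrite iotaE; apply: h.
rewrite iotaE -mulr_sumr -[leRHS]mulr1 ler_pM2l //; exact: sum_halves.
Qed.

Lemma grid_cell (T : nat) (w y : R) : (0 < T)%N -> 0 <= y <= T%:R * w ->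
  exists2 k : nat, (k < T)%N & k%:R * w <= y <= k.+1%:R * w.
Proof.
elim: T => // T IH _ /andP[y0 yT]; have [T0|] := posnP T.
  by exists 0%N; rewrite ?T0 // mul0r y0 -T0.
move=> T0; have [yT'|yT'] := leP y (T%:R * w).
  by have [|k kT ky] := IH T0; [rewrite y0 | exists k; rewrite // ltnW].
by exists T => //; rewrite ltW.
Qed.

(** Above a cell of a grid of mesh w = 2M/T in the coordinates other than i0 the
    set has height at most 2Cw. The T^n boxes thus needed have total volume
    (2M)^n (4CM)/T, which tends to 0. *)
Lemma null_lipschitz_graph (i0 : I) (A : set {ffun I -> R}) (C M : R) :
  0 <= C -> 0 < M ->
  (forall x i, A x -> - M <= x i <= M) ->
  (forall x y w, 0 <= w -> A x -> A y -> (forall j, j != i0 -> `|x j - y j| <= w) ->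
     `|x i0 - y i0| <= C * w) ->
  lebesgue_null A.
Proof.
move=> C0 M0 Abd Alip; apply: (null_of_covers i0) => e e0.
pose J := {j : I | j != i0}; pose n := #|{: J}|.
pose V := (2 * M) ^+ n * (4 * C * M).
have V0 : 0 <= V by rewrite mulr_ge0 ?exprn_ge0 ?mulr_ge0 // ltW // mulr_gt0.
have [T VT] : exists T : nat, V / e < T%:R.
  by exists (Num.bound (V / e)); apply: archi_boundP; rewrite divr_ge0 // ltW.
have T0 : (0 < T)%N by rewrite -(ltr0n R); apply: le_lt_trans VT; rewrite divr_ge0 // ltW.
have TR0 : 0 < T%:R :> R by rewrite ltr0n.
pose w := 2 * M / T%:R; have w0 : 0 < w by rewrite divr_gt0 // mulr_gt0.
pose cell (c : {ffun J -> 'I_T}) (x : {ffun I -> R}) :=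
  forall j : J, - M + (c j)%:R * w <= x (val j) <= - M + (c j).+1%:R * w.
pose hit c := pselect (exists x, A x /\ cell c x).
pose lo c := if hit c is left h then projT1 (cid h) i0 - C * w else 0.
pose hi c := if hit c is left h then projT1 (cid h) i0 + C * w else 0.
have lohi c : lo c <= hi c <= lo c + 2 * C * w.
  have Cw : 0 <= C * w by rewrite mulr_ge0 // ltW.
  rewrite /lo /hi; case: (hit c) => [h|_]; first by apply/andP; split; lra.
  by rewrite lexx add0r -mulrA mulr_ge0.
pose a (c : {ffun J -> 'I_T}) (i : I) := if (insub i : option J) is Some j then - M + (c j)%:R * w else lo c.
pose b (c : {ffun J -> 'I_T}) (i : I) := if (insub i : option J) is Some j then - M + (c j).+1%:R * w else hi c.
exists {ffun J -> 'I_T}, a, b; split.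
- move=> c i; rewrite /a /b; case: insub => [j|]; last by case/andP: (lohi c).
  by rewrite lerD2l ler_wpM2r ?ler_nat // ltW.
- move=> x Ax.
  have cx (j : J) : exists k : 'I_T, - M + k%:R * w <= x (val j) <= - M + k.+1%:R * w.
    have /andP[x1 x2] := Abd x (val j) Ax.
    have [|k kT /andP[k1 k2]] := @grid_cell T w (x (val j) + M) T0.
      by rewrite /w mulrCA divff ?gt_eqF // mulr1; apply/andP; split; lra.
    by exists (Ordinal kT) => /=; apply/andP; split; lra.
  have [c cP] := choice cx; pose c' := [ffun j => c j].
  have cc' : cell c' x by move=> j; rewrite ffunE.
  exists c' => i; rewrite /a /b; case: insubP => [j _ <-|]; first exact: cc'.
  rewrite negbK => /eqP->; rewrite /lo /hi; case: (hit c') => [h|[]]; last by exists x.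
  case: (cid h) => y [Ay cy] /=.
  have : `|x i0 - y i0| <= C * w.
    apply: Alip => //; [exact: ltW | move=> j jn]; have := cc' (Sub j jn); have := cy (Sub j jn).
    rewrite /= -natr1 mulrDl mul1r => /andP[h1 h2] /andP[h3 h4].
    by rewrite ler_norml; apply/andP; split; lra.
  by rewrite ler_norml => /andP[h1 h2]; apply/andP; split; lra.
move=> s us.
have vol c : box_volume (a c) (b c) <= w ^+ n * (2 * C * w).
  rewrite (bigD1 i0) //= mulrC; apply: ler_pM.
  - apply: prodr_ge0 => i _; rewrite /a /b; case: insub => [j|].
      by rewrite -natr1; nra.
    by have := lohi c; lra.
  - by rewrite /a /b insubF ?eqxx //; have := lohi c; lra.
  - rewrite le_eqVlt; apply/orP; left; apply/eqP.
    rewrite (eq_bigr (fun=> w)) => [|i i0n]; last first.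
      by rewrite /a /b insubT /= -natr1; ring.
    rewrite prodr_const; congr (_ ^+ _).
    by rewrite /n card_sig; apply: eq_card => i; rewrite !inE.
  - by rewrite /a /b insubF ?eqxx //; have := lohi c; lra.
apply: (@le_trans _ _ (\sum_(c <- s) (w ^+ n * (2 * C * w)))).
  by apply: ler_sum => c _; apply: vol.
rewrite big_const_seq count_predT iter_addr_0.
apply: (@le_trans _ _ ((w ^+ n * (2 * C * w)) *+ (T ^ n))).
  apply: ler_wpMn2l; first by rewrite !mulr_ge0 ?exprn_ge0 // ltW.
  by have := max_card (mem s); rewrite (card_uniqP us) card_ffun card_ord.
rewrite -mulr_natl natrX.
have -> : T%:R ^+ n * (w ^+ n * (2 * C * w)) = V / T%:R.
  rewrite mulrA -exprMn.
  have -> : T%:R * w = 2 * M by rewrite /w mulrC divfK // gt_eqF.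
  by rewrite /V /w; field; rewrite gt_eqF.
by rewrite ler_pdivrMr // mulrC -ler_pdivrMr // ltW.
Qed.

Definition pairing (x : {ffun I -> R}) (s : I -> R) : R := \sum_i x i * s i.

Definition minimizes (S : set (I -> R)) (x : {ffun I -> R}) (s : I -> R) :=
  S s /\ forall s', S s' -> pairing x s <= pairing x s'.

(** The linear forms of size at most M+1 with minimizers on both sides of the
    gap from z/(l+1) to (z+1)/(l+1) in coordinate i; coordinates are shifted by
    1 to be nonnegative. *)
Definition separated (S : set (I -> R)) (i : I) (l z M : nat) : set {ffun I -> R} :=
  [set x : {ffun I -> R} | (forall j, `|x j| <= M.+1%:R) /\ exists s s' : I -> R,
     [/\ minimizes S x s, minimizes S x s', (s i + 1) * l.+1%:R <= z%:R &
         z.+1%:R <= (s' i + 1) * l.+1%:R]].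

(** If s minimizes x and r' minimizes y then (y - x).(r' - s) <= 0. As
    r'_i - s_i is at least 1/(l+1), the difference y_i - x_i is bounded by a
    multiple of the other differences: the set is part of a Lipschitz graph. *)
Lemma separated_null (S : set (I -> R)) i l z M :
  (forall s j, S s -> `|s j| <= 1) -> lebesgue_null (separated S i l z M).
Proof.
move=> Sbd; pose D := #|I|; pose C : R := 2 * D%:R * l.+1%:R.
have C0 : 0 <= C by rewrite !mulr_ge0 ?ler0n.
have l0 : 0 < l.+1%:R :> R by rewrite ltr0n.
have M0 : 0 < M.+1%:R :> R by rewrite ltr0n.
apply: (@null_lipschitz_graph i _ C M.+1%:R) => //.
  by move=> x j [h _]; rewrite -ler_norml.
have half x y w : 0 <= w -> separated S i l z M x -> separated S i l z M y ->
    (forall j, j != i -> `|x j - y j| <= w) -> y i - x i <= C * w.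
  move=> w0 [_ [s [_ [[Ss smin] _ sz _]]]] [_ [_ [r' [_ [Sr' rmin] _ zr']]]] xy.
  have h1 := smin _ Sr'; have h2 := rmin _ Ss.
  have gap : (1 : R) <= (r' i - s i) * l.+1%:R.
    by move: sz zr'; rewrite -[z.+1]addn1 natrD => ? ?; lra.
  have key : (y i - x i) * (r' i - s i) <= 2 * D%:R * w.
    have : (y i - x i) * (r' i - s i) <= \sum_(j | j != i) (x j - y j) * (r' j - s j).
      have : \sum_j (x j - y j) * (r' j - s j) >= 0.
        have -> : \sum_j (x j - y j) * (r' j - s j) =
          (pairing x r' - pairing x s) + (pairing y s - pairing y r').
          by rewrite /pairing -!sumrB -big_split /=; apply: eq_bigr => j _; ring.
        by rewrite addr_ge0 ?subr_ge0.
      rewrite (bigD1 i) //=; lra.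
    move=> /le_trans; apply.
    apply: (@le_trans _ _ (\sum_(j | j != i) 2 * w)).
      apply: ler_sum => j ji; apply: (le_trans (ler_norm _)).
      rewrite normrM mulrC; apply: ler_pM => //; last exact: xy.
      apply: (le_trans (ler_normB _ _)).
      by have := Sbd _ j Ss; have := Sbd _ j Sr'; lra.
    rewrite sumr_const -[leLHS]mulr_natl mulrCA -mulrA ler_wpM2l //.
    by rewrite ler_wpM2r // ler_nat max_card.
  have [yx|yx] := leP (y i - x i) 0.
    by apply: (le_trans yx); rewrite mulr_ge0.
  apply: le_trans (_ : (y i - x i) * ((r' i - s i) * l.+1%:R) <= _).
    by rewrite -[leLHS]mulr1 ler_wpM2l // ltW.
  by rewrite mulrA /C [leRHS]mulrAC ler_wpM2r // ltW.
move=> x y w w0 Ax Ay xy; rewrite ler_norml; apply/andP; split.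
  have := half x y w w0 Ax Ay xy; lra.
by apply: half => // j /xy; rewrite distrC.
Qed.

(** A generic linear form has at most one minimizer on a bounded set, whatever
    that set is. *)
Theorem nonunique_minimizers_null (i0 : I) (S : set (I -> R)) :
  (forall s j, S s -> `|s j| <= 1) ->
  lebesgue_null [set x | exists s s' i,
    [/\ minimizes S x s, minimizes S x s' & s i != s' i]].
Proof.
move=> Sbd.
pose A k := if (unpickle k : option (I * nat * nat * nat)%type) is Some (i, l, z, M)
  then separated S i l z M else set0.
have -> : [set x : {ffun I -> R} | exists s s' i,
    [/\ minimizes S x s, minimizes S x s' & s i != s' i]] = \bigcup_k A k.
  apply/seteqP; split=> [x|x [k _]]; last first.
    rewrite /A; case: unpickle => // -[[[i l] z] M] [_ [s [s' [m1 m2 h1 h2]]]].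
    exists s, s', i; split=> //; apply/eqP => e.
    have := le_trans h2 (_ : _ <= z%:R); rewrite -e => /(_ h1).
    by rewrite ler_nat ltnn.
  move=> [s [s' [i [m1 m2 ne]]]].
  wlog lt : s s' m1 m2 ne / s i < s' i.
    move=> h; case: (ltgtP (s i) (s' i)) (ne) => // lt _; first exact: (h s s').
    by apply: (h s' s); rewrite // eq_sym.
  pose g := s' i - s i; have g0 : 0 < g by rewrite subr_gt0.
  (* The gap is wider than two steps of length 1/(l+1), so it contains a full one. *)
  pose l := Num.truncn (2 / g); pose y := (s i + 1) * l.+1%:R.
  have lg : 2 < g * l.+1%:R.
    by rewrite mulrC -ltr_pdivrMr // /l; apply: truncnS_gt.
  have y0 : 0 <= y.
    by rewrite mulr_ge0 //; have := Sbd s i (proj1 m1); rewrite ler_norml => /andP[? _]; lra.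
  pose z := (Num.truncn y).+1.
  have /andP[z1 z2] := truncn_itv y0.
  pose M := Num.truncn (\sum_j `|x j|).
  exists (pickle (i, l, z, M)) => //; rewrite /A pickleK; split.
    move=> j; apply: (@le_trans _ _ (\sum_j `|x j|)); last exact/ltW/truncnS_gt.
    by rewrite (bigD1 j) //= lerDl sumr_ge0.
  exists s, s'; split=> //; first exact: ltW.
  rewrite -[z.+1]addn1 natrD /z -[(Num.truncn y).+1]addn1 natrD.
  have -> : (s' i + 1) * l.+1%:R = y + g * l.+1%:R by rewrite /y /g; ring.
  lra.
apply: (null_bigcup i0) => k; rewrite /A; case: unpickle => [[[[i l] z] M]|].
  exact: separated_null.
exact: null_set0.
Qed.

End NullSets.

(** * Localizing matrices *)

Section Degrees.
Variables (R : realType) (N : nat).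
Local Notation P := {mpoly R[N]}.
Implicit Types p q : P.

Definition degle k p := (msize p <= k.+1)%N.

Lemma degleW k l p : (k <= l)%N -> degle k p -> degle l p.
Proof. by move=> kl /leq_trans; apply. Qed.

Lemma degle_pdeg p : degle (pdeg p) p.
Proof. exact: leqSpred. Qed.

Lemma pdeg_le k p : degle k p -> (pdeg p <= k)%N.
Proof. by rewrite /degle /pdeg; case: (msize p). Qed.

Lemma degleD k p q : degle k p -> degle k q -> degle k (p + q).
Proof. by move=> hp hq; apply: (leq_trans (msizeD_le _ _)); rewrite geq_max; apply/andP. Qed.

Lemma degleN k p : degle k p -> degle k (- p).
Proof. by rewrite /degle msizeN. Qed.

Lemma degleB k p q : degle k p -> degle k q -> degle k (p - q).
Proof. by move=> hp hq; apply: degleD => //; apply: degleN. Qed.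

Lemma degle0 k : degle k 0. Proof. by rewrite /degle msize0. Qed.

Lemma degleC k c : degle k c%:MP.
Proof. by rewrite /degle msizeC; case: eqP. Qed.

Lemma degle1 k : degle k 1. Proof. by rewrite -mpolyC1; apply: degleC. Qed.

Lemma degleZ k c p : degle k p -> degle k (c *: p).
Proof.
have [->|c0] := eqVneq c 0; first by rewrite scale0r => _; apply: degle0.
by rewrite /degle msizeZ.
Qed.

Lemma degleM k l p q : degle k p -> degle l q -> degle (k + l) (p * q).
Proof.
move=> hp hq.
have [->|p0] := eqVneq p 0; first by rewrite mul0r; apply: degle0.
have [->|q0] := eqVneq q 0; first by rewrite mulr0; apply: degle0.
rewrite /degle msizeM // -subn1 leq_subLR add1n -addnS -addSn.
exact: leq_add.
Qed.

Lemma degle_sqr k p : degle k p -> degle (2 * k) (p ^+ 2).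
Proof. by move=> h; rewrite mul2n -addnn expr2; apply: degleM. Qed.

Lemma degle_sum k (I : Type) (r : seq I) (Q : pred I) (G : I -> P) :
  (forall i, Q i -> degle k (G i)) -> degle k (\sum_(i <- r | Q i) G i).
Proof.
by move=> h; apply: (big_ind (degle k)) => //; [exact: degle0 | exact: degleD].
Qed.

Lemma degleX k (m : 'X_{1..N}) : (mdeg m <= k)%N -> degle k 'X_[m].
Proof. by rewrite /degle msizeX ltnS. Qed.

Lemma degleU k i : (0 < k)%N -> degle k 'X_i.
Proof. by move=> k0; apply: degleX; rewrite mdeg1. Qed.

Lemma degle_deriv k p i : degle k p -> degle k.-1 p^`M(i).
Proof.
move=> hp; rewrite /degle msizeE; apply/bigmax_leqP_seq => m mp _.
rewrite mcoeff_msupp mcoeff_deriv in mp.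
have : (m + U_(i))%MM \in msupp p.
  by rewrite mcoeff_msupp; apply: contraNneq mp => ->; rewrite mul0rn.
move=> /msize_mdeg_lt; rewrite mdegD mdeg1 addn1 => h.
by have := leq_trans h hp; case: (k).
Qed.

Lemma degle_expand k p : degle k p ->
  p = \sum_(m : 'X_{1..N < k.+1}) p@_m *: 'X_[m].
Proof. exact: mpolywE. Qed.

Lemma degle_monomial k (m : 'X_{1..N < k.+1}) : degle k 'X_[m].
Proof. by apply: degleX; rewrite -ltnS bmdeg. Qed.

End Degrees.

Section Riesz.
Variables (R : realType) (N : nat).
Local Notation P := {mpoly R[N]}.

(** The sum may run over a fixed range of monomials, which makes linearity
    visible. *)
Lemma riesz_wide r (z : tms R N r) k (p : P) : (msize p <= k)%N ->
  riesz p z = \sum_(m : 'X_{1..N < k}) p@_m * tms_entry z m.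
Proof.
move=> pk; rewrite /riesz (big_mksub ('X_{1..N < k} : subFinType _)) //=; first last.
- by move=> x /msize_mdeg_lt /leq_trans; apply.
- by rewrite msupp_uniq.
by rewrite big_rmcond //= => i; move/memN_msupp_eq0 ->; rewrite mul0r.
Qed.

Lemma riesz_scalar r (z : tms R N r) : scalar (fun p : P => riesz p z).
Proof.
move=> a p q; pose k := maxn (msize (a *: p + q)) (maxn (msize p) (msize q)).
rewrite !(@riesz_wide _ _ k) ?leq_max ?leqnn ?orbT //.
rewrite mulr_sumr -big_split /=; apply: eq_bigr => m _.
by rewrite mcoeffD mcoeffZ mulrDl mulrA.
Qed.

Definition rieszL r (z : tms R N r) : {scalar P} := mkscalar (riesz_scalar z).

Lemma riesz_monomial r (z : tms R N r) m : rieszL z 'X_[m] = tms_entry z m.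
Proof. by rewrite mkscalarE /riesz msuppX big_seq1 mcoeffX eqxx mul1r. Qed.

Definition moments (L : {scalar P}) r : tms R N r :=
  [ffun m : 'X_{1..N < r.+1} => L 'X_[m]].

Lemma riesz_moments (L : {scalar P}) r p : degle r p ->
  rieszL (moments L r) p = L p.
Proof.
move=> pr; rewrite (degle_expand pr) !linear_sum; apply: eq_bigr => m _.
rewrite !linearZ riesz_monomial /tms_entry; congr (_ * _).
by case: insubP => [m' _ e|/negP[]]; [rewrite ffunE e | rewrite bmdeg].
Qed.
End Riesz.

Section QuadraticForms.
Variables (R : realType) (T : finType) (c : T -> T -> R).
Let A : 'M[R]_#|T| := \matrix_(a, b) c (enum_val a) (enum_val b).

Lemma psd_enum : psdmx A <-> (forall s t, c s t = c t s) /\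
  forall v : T -> R, 0 <= \sum_s \sum_t v s * c s t * v t.
Proof.
have qf (v : 'cV[R]_#|T|) : (v^T *m A *m v) 0 0 =
    \sum_s \sum_t v (enum_rank s) 0 * c s t * v (enum_rank t) 0.
  rewrite exchange_big mxE (reindex enum_rank) /=; last by apply: onW_bij; apply: enum_rank_bij.
  apply: eq_bigr => t _; rewrite mxE mulr_suml (reindex enum_rank) /=; last first.
    by apply: onW_bij; apply: enum_rank_bij.
  by apply: eq_bigr => s _; rewrite !mxE !enum_rankK.
split=> [[As Apsd]|[cs cpsd]]; split.
- move=> s t; have := congr1 (fun B : 'M[R]_#|T| => B (enum_rank t) (enum_rank s)) As.
  by rewrite !mxE !enum_rankK.
- move=> v; suff <- : ((\col_a v (enum_val a))^T *m A *m (\col_a v (enum_val a))) 0 0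
      = \sum_s \sum_t v s * c s t * v t by exact: Apsd.
  by rewrite qf; apply: eq_bigr => s _; apply: eq_bigr => t _; rewrite !mxE !enum_rankK.
- by apply/matrixP => a b; rewrite !mxE.
- by move=> v; rewrite qf; apply: (cpsd (fun s => v (enum_rank s) 0)).
Qed.
End QuadraticForms.

Section Localizing.
Variables (R : realType) (N : nat).
Local Notation P := {mpoly R[N]}.

Definition loc_order k (q : P) := (k - uphalf (pdeg q))%N.
Definition locblock_order k r (T : 'M[P]_r) := (k - uphalf (mxdeg T))%N.

Lemma bilinear_expand (L : {scalar P}) q (I J : finType) (v : I -> R) (w : J -> R)
    (X : I -> P) (Y : J -> P) :
  L (q * ((\sum_a v a *: X a) * (\sum_b w b *: Y b))) =
  \sum_a \sum_b v a * L (q * (X a * Y b)) * w b.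
Proof.
rewrite mulr_suml mulr_sumr linear_sum; apply: eq_bigr => a _.
rewrite !mulr_sumr linear_sum; apply: eq_bigr => b _.
by rewrite -scalerAl -scalerAr -!scalerAr !linearZ /= mulrA mulrAC.
Qed.

(** The quadratic form of a localizing matrix at the coefficients of h is
    L (q h^2). *)
Lemma locmx_psd k q (z : tms R N (2 * k)) : psdmx (locmx q z) <->
  forall h, degle (loc_order k q) h -> 0 <= rieszL z (q * h ^+ 2).
Proof.
have E := psd_enum (fun a b : 'X_{1..N < (loc_order k q).+1} =>
   rieszL z (q * ('X_[a] * 'X_[b]))).
split=> [/(proj1 E) [_ H] h hdeg|H].
  have := H (fun a => h@_a); rewrite -bilinear_expand.
  by rewrite -(degle_expand hdeg) expr2.
apply/E; split=> [a b|v]; first by rewrite [X in q * X]mulrC.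
rewrite -bilinear_expand -expr2; apply: H.
by apply: degle_sum => a _; apply: degleZ; apply: degle_monomial.
Qed.

Lemma locmx_eq0 k q (z : tms R N (2 * k)) : locmx q z = 0 <->
  forall h g, degle (loc_order k q) h -> degle (loc_order k q) g ->
    rieszL z (q * (h * g)) = 0.
Proof.
split=> [H h g hh hg|H].
  rewrite (degle_expand hh) (degle_expand hg) bilinear_expand big1 // => a _.
  rewrite big1 // => b _.
  have := congr1 (fun A : 'M_#|_| => A (enum_rank a) (enum_rank b)) H.
  by rewrite !mxE !enum_rankK => e; rewrite mkscalarE e mulr0 mul0r.
apply/matrixP => a b; rewrite !mxE; apply: H; exact: degle_monomial.
Qed.

Lemma locblockmx_psd k r (T : 'M[P]_r) (z : tms R N (2 * k)) :
  (forall i j, T i j = T j i) ->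
  psdmx (locblockmx T z) <->
  forall h, (forall i, degle (locblock_order k T) (h i)) ->
    0 <= rieszL z (\sum_i \sum_j T i j * (h i * h j)).
Proof.
move=> Ts; pose X : finType := 'X_{1..N < (locblock_order k T).+1}.
have E := psd_enum (fun a b : ('I_r * X)%type => rieszL z (T a.1 b.1 * ('X_[a.2] * 'X_[b.2]))).
have Q (v : 'I_r * X -> R) :
    \sum_(s : 'I_r * X) \sum_(t : 'I_r * X) v s * rieszL z (T s.1 t.1 * ('X_[s.2] * 'X_[t.2])) * v t =
    rieszL z (\sum_i \sum_j T i j *
       ((\sum_(a : X) v (i, a) *: 'X_[a]) * (\sum_(b : X) v (j, b) *: 'X_[b]))).
  transitivity (\sum_i \sum_(a : X) \sum_j \sum_(b : X)
      v (i, a) * rieszL z (T i j * ('X_[a] * 'X_[b])) * v (j, b)).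
    by rewrite [RHS]pair_big /=; apply: eq_bigr => -[i a] _; rewrite [RHS]pair_big; apply: eq_bigr => -[j b].
  rewrite linear_sum; apply: eq_bigr => i _; rewrite exchange_big linear_sum.
  by apply: eq_bigr => j _; rewrite bilinear_expand.
split=> [/(proj1 E) [_ H] h hdeg|H].
  have := H (fun s => (h s.1)@_s.2); rewrite Q /=.
  under eq_bigr => i _ do under eq_bigr => j _ do
    rewrite -(degle_expand (hdeg i)) -(degle_expand (hdeg j)).
  by [].
apply/E; split=> [a b|v]; first by rewrite Ts [X in _ * X]mulrC.
rewrite Q; apply: H => i.
by apply: degle_sum => a _; apply: degleZ; apply: degle_monomial.
Qed.

Lemma locblockmx_eq0 k r (T : 'M[P]_r) (z : tms R N (2 * k)) :
  locblockmx T z = 0 <->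
  forall i j h g, degle (locblock_order k T) h -> degle (locblock_order k T) g ->
    rieszL z (T i j * (h * g)) = 0.
Proof.
split=> [H i j h g hh hg|H].
  rewrite (degle_expand hh) (degle_expand hg) bilinear_expand big1 // => a _.
  rewrite big1 // => b _.
  have := congr1 (fun A : 'M_#|_| => A (enum_rank (i, a)) (enum_rank (j, b))) H.
  rewrite !mxE !enum_rankK /= => e.
  by rewrite e mulr0 mul0r.
apply/matrixP => a b; rewrite !mxE; apply: H; exact: degle_monomial.
Qed.

Lemma loc_order_degree k q h g : (uphalf (pdeg q) <= k)%N ->
  degle (loc_order k q) h -> degle (loc_order k q) g -> degle (2 * k) (q * (h * g)).
Proof.
move=> qk hh hg; apply: degleW (degleM (degle_pdeg q) (degleM hh hg)).
rewrite /loc_order addnn -mul2n mulnBr.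
have := odd_double_half (pdeg q); move: qk; rewrite uphalf_half; case: odd => /=; lia.
Qed.

Lemma leq_mxdeg r (T : 'M[P]_r) i j : (pdeg (T i j) <= mxdeg T)%N.
Proof.
have h1 := @leq_bigmax 'I_r (fun j => pdeg (T i j)) j.
have h2 := @leq_bigmax 'I_r (fun i => (\max_(j < r) pdeg (T i j))%N) i.
exact: (leq_trans h1 h2).
Qed.

Lemma locblock_order_degree k r (T : 'M[P]_r) i j h g : (uphalf (mxdeg T) <= k)%N ->
  degle (locblock_order k T) h -> degle (locblock_order k T) g ->
  degle (2 * k) (T i j * (h * g)).
Proof.
move=> qk hh hg; have hT := degleW (leq_mxdeg T i j) (degle_pdeg (T i j)).
apply: degleW (degleM hT (degleM hh hg)).
rewrite /locblock_order addnn -mul2n mulnBr.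
have := odd_double_half (mxdeg T); move: qk; rewrite uphalf_half; case: odd => /=; lia.
Qed.

End Localizing.

(** * The trace-one slice of the cone *)

Section PsdMatrices.
Variables (R : realType) (n : nat).
Implicit Types A : 'M[R]_n.

Lemma quadratic_formE A (v : 'cV[R]_n) :
  (v^T *m A *m v) 0 0 = \sum_i \sum_j A i j * (v i 0 * v j 0).
Proof.
rewrite exchange_big mxE; apply: eq_bigr => j _; rewrite mxE mulr_suml.
by apply: eq_bigr => i _; rewrite mxE; ring.
Qed.

Lemma psdmxP A : psdmx A <-> (forall i j, A i j = A j i) /\
  forall v : 'I_n -> R, 0 <= \sum_i \sum_j A i j * (v i * v j).
Proof.
split=> [[As Ap]|[As Ap]]; split.
- by move=> i j; rewrite -[in LHS]As mxE.
- move=> v; have := Ap (\col_i v i); rewrite quadratic_formE.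
  by under eq_bigr => i _ do under eq_bigr => j _ do rewrite !mxE.
- by apply/matrixP => i j; rewrite mxE.
- by move=> v; rewrite quadratic_formE; apply: (Ap (fun i => v i 0)).
Qed.

Lemma psdmx_two A i j (s t : R) : psdmx A ->
  0 <= A i i * s ^+ 2 + A i j * (s * t) *+ 2 + A j j * t ^+ 2.
Proof.
move=> /psdmxP[As /(_ (fun k => s *+ (k == i) + t *+ (k == j)))].
congr (0 <= _).
have pick (G : 'I_n -> R) (c : R) l : \sum_k G k * (c *+ (k == l)) = G l * c.
  rewrite (bigD1 l) //= eqxx mulr1n big1 ?addr0 // => k /negbTE->.
  by rewrite mulr0n mulr0.
transitivity (\sum_k (s *+ (k == i) + t *+ (k == j)) * (A k i * s + A k j * t)).
  apply: eq_bigr => k _; rewrite mulrDr -(pick (A k) s i) -(pick (A k) t j) !mulr_sumr -big_split /=.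
  by apply: eq_bigr => l _; ring.
under eq_bigr => k _ do rewrite mulrDl mulrC [_ *+ (k == j) * _]mulrC.
by rewrite big_split /= !pick (As j i); ring.
Qed.

Lemma psdmx_diag_ge0 A i : psdmx A -> 0 <= A i i.
Proof. by move=> /(psdmx_two i i 1 0); rewrite !mulr0 mul0rn expr0n !mulr0 !addr0 expr1n mulr1. Qed.

Lemma psdmx_offdiag A i j : psdmx A -> A i j ^+ 2 <= A i i * A j j.
Proof.
move=> Ap; have h := psdmx_two i j _ _ Ap.
have ii := psdmx_diag_ge0 i Ap; have jj := psdmx_diag_ge0 j Ap.
have [jj0|jj0] := eqVneq (A j j) 0.
  have [-> |ij0] := eqVneq (A i j) 0; first by rewrite expr0n mulr_ge0.
  have := h 1 (- (A i i + 1) / (2 * A i j)); rewrite jj0.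
  have -> : A i j * (1 * (- (A i i + 1) / (2 * A i j))) = - (A i i + 1) / 2 by field.
  rewrite mulr2n expr1n mulr1 mul0r; lra.
have jj1 : 0 < A j j by rewrite lt_neqAle eq_sym jj0.
have := h (A j j) (- A i j).
have -> : A i i * A j j ^+ 2 + A i j * (A j j * - A i j) *+ 2 + A j j * (- A i j) ^+ 2 =
   A j j * (A i i * A j j - A i j ^+ 2) by ring.
by rewrite pmulr_rge0 // subr_ge0.
Qed.

Lemma psdmx_frobenius A : psdmx A -> \sum_i \sum_j A i j ^+ 2 <= (\tr A) ^+ 2.
Proof.
move=> Ap; rewrite expr2 /mxtrace mulr_suml; apply: ler_sum => i _.
by rewrite mulr_sumr; apply: ler_sum => j _; apply: psdmx_offdiag.
Qed.
End PsdMatrices.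

Lemma symidx_surj (n : nat) (k : 'I_(sigma n)) : exists i j : 'I_n, k = symidx i j.
Proof.
have := sum_symidx (fun l => (l == k) : nat).
rewrite (bigD1 k) //= eqxx => h; apply: contrapT => no.
move: h; rewrite [in RHS]big1 // => i _; rewrite big1 // => j _.
by case: eqP => // e; case: no; exists i, j.
Qed.

Section Problem.
Variables (R : realType) (n m : nat).
Local Notation N := (sigma n + m)%N.
Local Notation P := {mpoly R[N]}.
Local Notation X := (Xmx R n m).
Implicit Types (a : 'I_N -> R) (L : {scalar P}).

Lemma XmxE i j : X i j = 'X_(xvar m i j). Proof. by rewrite mxE. Qed.

Definition simplex a :=
  [/\ psdmx (\matrix_(i, j) a (xvar m i j)), forall t, 0 <= a (yvar n t) &
      (trace1 R n m).@[a] = 0].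

Lemma meval_trace1 a : (trace1 R n m).@[a] =
  \sum_i a (xvar m i i) + \sum_t a (yvar n t) - 1.
Proof.
rewrite /trace1 mevalB meval1 mevalD !raddf_sum /=; congr (_ + _ - _).
  by apply: eq_bigr => i _; rewrite XmxE mevalXU.
by apply: eq_bigr => i _; rewrite mevalXU.
Qed.

Lemma meval_sqnorm a : (sqnorm R n m).@[a] =
  \sum_i \sum_j a (xvar m i j) ^+ 2 + \sum_t a (yvar n t) ^+ 2.
Proof.
rewrite /sqnorm mevalD !raddf_sum /=; congr (_ + _).
  apply: eq_bigr => i _; rewrite raddf_sum /=; apply: eq_bigr => j _.
  by rewrite XmxE rmorphXn /= mevalXU.
by apply: eq_bigr => i _; rewrite rmorphXn /= mevalXU.
Qed.

Lemma simplex_outer a : simplex a -> 0 <= (outer_ball R n m).@[a].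
Proof.
move=> [Xp yp tr]; rewrite /outer_ball mevalB meval1 meval_sqnorm subr_ge0.
move: tr; rewrite meval_trace1 => /eqP; rewrite subr_eq0 => /eqP tr.
set A := \matrix_(i, j) _ in Xp.
have trA : \tr A = \sum_i a (xvar m i i) by apply: eq_bigr => i _; rewrite mxE.
have h1 : \sum_i \sum_j a (xvar m i j) ^+ 2 <= (\tr A) ^+ 2.
  apply: le_trans (psdmx_frobenius Xp); rewrite le_eqVlt; apply/orP; left; apply/eqP.
  by apply: eq_bigr => i _; apply: eq_bigr => j _; rewrite mxE.
have h2 : \sum_t a (yvar n t) ^+ 2 <= (\sum_t a (yvar n t)) ^+ 2.
  rewrite [leRHS]expr2 mulr_suml; apply: ler_sum => t _.
  by rewrite expr2 ler_wpM2l // (bigD1 t) //= lerDl sumr_ge0.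
have h3 : 0 <= \tr A by apply: sumr_ge0 => i _; apply: psdmx_diag_ge0.
have h4 : 0 <= \sum_t a (yvar n t) by apply: sumr_ge0.
rewrite -trA in tr; apply: (le_trans (lerD h1 h2)).
have h5 := mulr_ge0 h3 h4.
by rewrite -[1](expr1n R 2) -tr sqrrD mulr2n; lra.
Qed.

Lemma simplex_inner a : (0 < n + m)%N -> simplex a -> 0 <= (inner_ball R n m).@[a].
Proof.
move=> nm0 [_ _ tr]; rewrite /inner_ball mevalB mevalC meval_sqnorm subr_ge0.
move: tr; rewrite meval_trace1 => /eqP; rewrite subr_eq0 => /eqP tr.
set K : R := (n + m)%:R; have K0 : 0 < K by rewrite ltr0n.
apply: (@le_trans _ _ (\sum_i a (xvar m i i) ^+ 2 + \sum_t a (yvar n t) ^+ 2)); last first.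
  rewrite lerD2r; apply: ler_sum => i _; rewrite (bigD1 i) //= lerDl.
  by apply: sumr_ge0 => j _; apply: sqr_ge0.
have : 0 <= \sum_i (a (xvar m i i) - K^-1) ^+ 2 + \sum_t (a (yvar n t) - K^-1) ^+ 2.
  by apply: addr_ge0; apply: sumr_ge0 => *; apply: sqr_ge0.
have sq (I : finType) (g : I -> R) :
    \sum_i (g i - K^-1) ^+ 2 =
    \sum_i g i ^+ 2 - 2 * K^-1 * (\sum_i g i) + #|I|%:R * K^-1 ^+ 2.
  have -> : #|I|%:R * K^-1 ^+ 2 = \sum_(i : I) K^-1 ^+ 2 by rewrite sumr_const mulr_natl.
  rewrite mulr_sumr -sumrB -big_split /=.
  by apply: eq_bigr => i _; ring.
rewrite !sq !card_ord => h.
have e : n%:R * K^-1 ^+ 2 + m%:R * K^-1 ^+ 2 = K^-1.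
  by rewrite -mulrDl -natrD -/K expr2 mulrA divff ?mul1r // gt_eqF.
have : 2 * K^-1 * (\sum_i a (xvar m i i) + \sum_t a (yvar n t)) = 2 * K^-1.
  by rewrite tr mulr1.
rewrite mulrDr; lra.
Qed.

(** What the two relaxations of order k have in common, read on the functional.
    The polynomials involved have degree at most 2, so that multipliers of degree
    k-1 are admissible in each localizing condition. *)
Record base_spec k L : Prop := BaseSpec {
  bs_trace : forall h g, degle k.-1 h -> degle k.-1 g -> L (trace1 R n m * (h * g)) = 0;
  bs_X : forall h, (forall i, degle k.-1 (h i)) ->
    0 <= L (\sum_i \sum_j X i j * (h i * h j));
  bs_y : forall t h, degle k.-1 h -> 0 <= L ('X_(yvar n t) * h ^+ 2);
  bs_outer : forall h, degle k.-1 h -> 0 <= L (outer_ball R n m * h ^+ 2);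
  bs_mass : L 1 = 1;
  bs_psd : forall h, degle k h -> 0 <= L (h ^+ 2)
}.

(** The Frobenius norm counts each off-diagonal variable twice, so that 1 - x_i^2
    is the ball constraint plus a sum of squares. *)
Lemma bs_ball k L i h : (0 < k)%N -> base_spec k L -> degle k.-1 h ->
  0 <= L ((1 - 'X_i ^+ 2) * h ^+ 2).
Proof.
move=> k0 bs hh.
have sq j : 0 <= L ('X_j ^+ 2 * h ^+ 2).
  rewrite -exprMn; apply: (bs_psd bs); rewrite -(prednK k0) -add1n.
  by apply: degleM => //; apply: degleU.
have ob := bs_outer bs hh; rewrite /outer_ball in ob.
have -> : (1 - 'X_i ^+ 2) * h ^+ 2 =
   (1 - sqnorm R n m) * h ^+ 2 + (sqnorm R n m * h ^+ 2 - 'X_i ^+ 2 * h ^+ 2) by ring.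
rewrite linearD; apply: addr_ge0 => //; rewrite linearB /= subr_ge0.
rewrite /sqnorm mulrDl linearD /= !mulr_suml !linear_sum /=.
have s1 : forall l : 'I_n, 0 <= L ((\sum_j X l j ^+ 2) * h ^+ 2).
  move=> l; rewrite mulr_suml linear_sum; apply: sumr_ge0 => j _.
  by rewrite XmxE; apply: sq.
case: (split_ordP i) => [k'|t] ->.
  have [p [q ->]] := symidx_surj k'; rewrite -[lshift _ _]/(xvar m p q).
  apply: ler_wpDr; first by apply: sumr_ge0 => j _; apply: sq.
  rewrite (bigD1 p) //=; apply: ler_wpDr; first by apply: sumr_ge0 => j _; apply: s1.
  rewrite mulr_suml linear_sum (bigD1 q) //= XmxE; apply: ler_wpDr => //.
  by apply: sumr_ge0 => j _; rewrite XmxE; apply: sq.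
apply: ler_wpDl; first by apply: sumr_ge0 => j _; apply: s1.
by rewrite (bigD1 t) //=; apply: ler_wpDr => //; apply: sumr_ge0 => j _; apply: sq.
Qed.

Lemma mnm_split (mm : 'X_{1..N}) k : (mdeg mm <= k.+1)%N -> mm <> 0%MM ->
  exists i mm', mm = (U_(i) + mm')%MM /\ (mdeg mm' <= k)%N.
Proof.
move=> mk m0; have [i mi] : exists i, mm i != 0%N.
  apply: contrapT => no; apply: m0; apply/mnmP => i; rewrite mnm0E.
  by apply/eqP/negPn/negP => mi; apply: no; exists i.
exists i, (mm - U_(i))%MM; have e : (mm - U_(i) + U_(i))%MM = mm by rewrite submK // lep1mP.
rewrite addmC e; split=> //; move: mk; rewrite -{1}e mdegD mdeg1 addn1 ltnS; exact.
Qed.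

Lemma bs_even_moment k L mm : base_spec k L -> (mdeg mm <= k)%N ->
  0 <= L ('X_[mm] ^+ 2) <= 1.
Proof.
move=> bs mk; rewrite (bs_psd bs) ?degleX //=.
have [l lk] : exists l, (mdeg mm <= l <= k)%N by exists (mdeg mm); rewrite leqnn.
elim: l mm {mk} lk => [|l IH] mm /andP[ml lk].
  move: ml; rewrite leqn0 mdeg_eq0 => /eqP ->; rewrite mpolyX0 expr1n (bs_mass bs) //.
have [->|/eqP m0] := eqVneq mm 0%MM; first by rewrite mpolyX0 expr1n (bs_mass bs).
have [i [mm' [-> ml']]] := mnm_split ml m0.
have k0 : (0 < k)%N by apply: leq_trans lk.
have := bs_ball i k0 bs (_ : degle k.-1 'X_[mm']).
rewrite mulrBl mul1r linearB /= subr_ge0 -exprMn -mpolyXD => h.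
apply: (le_trans (h _)); last by apply: IH; rewrite ml' (ltnW lk).
by apply: degleX; apply: (leq_trans ml'); rewrite -ltnS prednK.
Qed.

Lemma mnm_halve (mm : 'X_{1..N}) k : (mdeg mm <= 2 * k)%N ->
  exists m1 m2, [/\ mm = (m1 + m2)%MM, (mdeg m1 <= k)%N & (mdeg m2 <= k)%N].
Proof.
suff H l : (l <= mdeg mm)%N -> exists m1 m2 : 'X_{1..N}, mm = (m1 + m2)%MM /\ mdeg m1 = l.
  move=> mk; have [|m1 [m2 [e d1]]] := H (minn k (mdeg mm)); first by rewrite geq_minr.
  exists m1, m2; split=> //; first by rewrite d1 geq_minl.
  by move: mk d1; rewrite e mdegD; lia.
elim: l => [|l IH] lm; first by exists 0%MM, mm; rewrite add0m mdeg0.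
have [m1 [m2 [e d1]]] := IH (ltnW lm).
have m20 : m2 <> 0%MM by move=> m20; move: lm; rewrite e m20 addm0 d1 ltnn.
have [i [m3 [e3 _]]] := mnm_split (leqnSn (mdeg m2)) m20.
exists (m1 + U_(i))%MM, m3; rewrite e e3 addmA mdegD mdeg1 d1 addn1; split=> //.
Qed.

(** Even moments are bounded by induction on the degree, thanks to the ball
    constraint, and 2 |L x^(a+b)| <= L x^(2a) + L x^(2b). *)
Lemma bs_moment k L mm : base_spec k L -> (mdeg mm <= 2 * k)%N -> `|L 'X_[mm]| <= 1.
Proof.
move=> bs /mnm_halve[m1 [m2 [-> h1 h2]]].
have /andP[_ l1] := bs_even_moment bs h1; have /andP[_ l2] := bs_even_moment bs h2.
have p1 := bs_psd bs (degleD (degleX R h1) (degleX R h2)).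
have p2 := bs_psd bs (degleB (degleX R h1) (degleX R h2)).
have e1 (p q : P) : (p + q) ^+ 2 = p ^+ 2 + (p * q + p * q) + q ^+ 2 by ring.
have e2 (p q : P) : (p - q) ^+ 2 = p ^+ 2 - (p * q + p * q) + q ^+ 2 by ring.
rewrite e1 !linearD /= -mpolyXD in p1; rewrite e2 linearD linearB linearD /= -mpolyXD in p2.
by rewrite ler_norml; apply/andP; split; lra.
Qed.

Lemma bs_riesz_bounded k p : exists C, forall z : tms R N (2 * k),
  base_spec k (rieszL z) -> `|rieszL z p| <= C.
Proof.
exists (\sum_(mm <- msupp p) `|p@_mm|) => z bs; rewrite {1}[p]mpolyE linear_sum.
apply: (le_trans (ler_norm_sum _ _ _)); apply: ler_sum => mm _.
rewrite linearZ normrM -[leRHS]mulr1 ler_wpM2l //.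
have [mk|mk] := leqP (mdeg mm) (2 * k); first exact: (bs_moment bs mk).
rewrite riesz_monomial /tms_entry; case: insubP => [b bk _|_]; last by rewrite normr0 ler01.
by move: bk; rewrite ltnS leqNgt mk.
Qed.

Section BaseFamily.
Variable F : nat -> {scalar P} -> Prop.
Hypothesis Fbase : forall k L, F k L -> base_spec k L.

Lemma eventually_degle (A : {scalar P} -> Prop) (h : P) :
  (forall k L, F k L -> degle k.-1 h -> A L) -> eventually_on F A.
Proof.
move=> H; exists (msize h).+1 => k L hk FL; apply: (H k L) => //.
by apply: leqW; rewrite -ltnS; apply: (leq_trans hk); rewrite leqSpred.
Qed.

Lemma base_pseudo_family : pseudo_family F.
Proof.
split.
- by move=> k L /Fbase/bs_mass.
- by move=> k L h /Fbase bs hk; apply: (bs_psd bs).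
move=> i h; exists (msize h).+1 => k L hk FL; have k0 : (0 < k)%N by apply: leq_trans hk.
apply: (bs_ball i k0 (Fbase FL)).
by apply: leqW; rewrite -ltnS prednK.
Qed.

Lemma base_ideal_trace : family_ideal F (trace1 R n m).
Proof.
move=> h; apply: (@eventually_degle _ h) => k L FL hk.
by have := bs_trace (Fbase FL) hk (degle1 _ _ _); rewrite mulr1.
Qed.

(** The matrix constraint at a constant vector v is the polynomial v^T X v. *)
Lemma base_family_simplex a :
  (forall q, family_module F q -> 0 <= q.@[a]) -> simplex a.
Proof.
move=> Ma; split.
- apply/psdmxP; split=> [i j|v]; first by rewrite !mxE /xvar symidxC.
  (* The form v^T X v times h^2 is the matrix condition at the vector h v. *)
  pose q : P := \sum_i \sum_j X i j * ((v i)%:MP * (v j)%:MP).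
  have : family_module F q.
    move=> h; apply: (@eventually_degle _ h) => k L FL hk.
    have := @bs_X _ _ (Fbase FL) (fun i => (v i)%:MP * h) (fun i => _).
    have -> : q * h ^+ 2 = \sum_i \sum_j X i j * ((v i)%:MP * h * ((v j)%:MP * h)).
      rewrite mulr_suml; apply: eq_bigr => i _; rewrite mulr_suml.
      by apply: eq_bigr => j _; ring.
    by apply=> i; rewrite mul_mpolyC; apply: degleZ.
  move=> /Ma; congr (0 <= _); rewrite raddf_sum /=; apply: eq_bigr => i _.
  rewrite raddf_sum /=; apply: eq_bigr => j _.
  by rewrite !mevalM !mevalC XmxE mevalXU mxE.
- move=> t; have : family_module F 'X_(yvar n t).
    by move=> h; apply: (@eventually_degle _ h) => k L FL hk; apply: (bs_y (Fbase FL)).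
  by move=> /Ma; rewrite mevalXU.
have M1 : family_module F (trace1 R n m).
  by move=> h; apply: eventually_imp (base_ideal_trace (h ^+ 2)) => L ->.
have M2 : family_module F (- trace1 R n m).
  move=> h; apply: eventually_imp (base_ideal_trace (h ^+ 2)) => L.
  by rewrite mulNr linearN /= => ->; rewrite oppr0.
have := Ma _ M1; have := Ma _ M2; rewrite mevalN oppr_ge0 => h1 h2.
by apply/eqP; rewrite eq_le h1 h2.
Qed.
End BaseFamily.
End Problem.

(** * Optimality conditions *)

Section PolynomialCalculus.
Variable R : realType.
Implicit Types p q : {poly R}.

Lemma horner_bounded p t : 0 <= t <= 1 -> `|p.[t]| <= \sum_(i < size p) `|p`_i|.
Proof.
move=> /andP[t0 t1]; rewrite horner_coef; apply: (le_trans (ler_norm_sum _ _ _)).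
apply: ler_sum => i _; rewrite normrM normrX (ger0_norm t0) -[leRHS]mulr1.
by rewrite ler_wpM2l // exprn_ile1.
Qed.

Lemma derivative_at_minimum p : p.[0] = 0 -> (forall t, 0 <= t -> 0 <= p.[t]) ->
  0 <= p^`().[0].
Proof.
move=> p0 ppos.
have /factor_theorem[q pE] : root p 0 by apply/eqP.
have -> : p^`().[0] = q.[0].
  by rewrite pE derivM derivXsubC !hornerE /=; ring.
rewrite leNgt; apply/negP => q0.
have /factor_theorem[r rE] : root (q - q.[0]%:P) 0 by rewrite /root !hornerE subrr.
pose C := \sum_(i < size r) `|r`_i|; have C0 : 0 <= C by apply: sumr_ge0.
(* At this t the remainder C t cannot compensate q.[0] < 0. *)
pose D := C + 1 - q.[0]; have D0 : 0 < D by rewrite /D; lra.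
pose t := - q.[0] / D.
have t0 : 0 < t by rewrite divr_gt0 // oppr_gt0.
have t1 : t <= 1 by rewrite ler_pdivrMr // mul1r /D; lra.
have qt : 0 <= q.[t].
  have := ppos t (ltW t0); rewrite pE hornerM hornerXsubC subr0.
  by rewrite pmulr_lge0.
have rt : r.[t] <= C.
  by apply: le_trans (ler_norm _) _; apply: horner_bounded; rewrite (ltW t0).
have : q.[t] = q.[0] + r.[t] * t.
  have := congr1 (fun s => s.[t]) rE.
  by rewrite hornerM hornerXsubC subr0 hornerD hornerN hornerC => <-; ring.
have : r.[t] * t <= C * t by rewrite ler_wpM2r // ltW.
have : t * D = - q.[0] by rewrite /t divfK // gt_eqF.
rewrite /D; nra.
Qed.
End PolynomialCalculus.

(** A symmetric array is given by its upper triangle. *)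
Lemma pack_symmetric (n : nat) (T : Type) (W : 'I_n -> 'I_n -> T) :
  (forall i j, W i j = W j i) ->
  exists w : 'I_(sigma n) -> T, forall i j, w (symidx i j) = W i j.
Proof.
move=> Ws; have [r rP] := choice (fun k : 'I_(sigma n) => symidx_surj k).
have [s sP] := choice rP; exists (fun k => W (r k) (s k)) => i j.
have wlg (p q p' q' : 'I_n) : (p <= q)%N -> symidx p q = symidx p' q' -> W p q = W p' q'.
  move=> pq; have [pq'|/ltnW pq'] := leqP p' q'.
    by move=> /(symidx_inj pq pq') [-> ->].
  by rewrite (symidxC p' q') => /(symidx_inj pq pq') [-> ->].
have e := sP (symidx i j); have [ij|/ltnW ij] := leqP i j; first exact/esym/wlg.
by rewrite [RHS]Ws; apply/esym/wlg => //; rewrite symidxC.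
Qed.

Section Cone.
Variables (R : realType) (n m d : nat).
Local Notation N := (sigma n + m)%N.
Local Notation P := {mpoly R[N]}.
Local Notation X := (Xmx R n m).
Variables (f : P) (f_homog : f \is d.-homog).
Implicit Types (a b : 'I_N -> R).

Definition cone a :=
  psdmx (\matrix_(i, j) a (xvar m i j)) /\ forall t, 0 <= a (yvar n t).

Definition mass a : R := \sum_i a (xvar m i i) + \sum_t a (yvar n t).

Lemma meval_homog a s : f.@[fun i => s * a i] = s ^+ d * f.@[a].
Proof.
rewrite !mevalE mulr_sumr; apply: eq_big_seq => k kf.
have kd : mdeg k = d := dhomog_mf f_homog kf.
under eq_bigr do rewrite exprMn.
rewrite big_split /= prodrXr -mdegE kd; ring.
Qed.

Lemma split_xvar i j : fintype.split (xvar m i j) = inl (symidx i j) :> 'I_(sigma n) + 'I_m.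
Proof. exact: (unsplitK (inl _)). Qed.

Lemma split_yvar t : fintype.split (yvar n t) = inr t :> 'I_(sigma n) + 'I_m.
Proof. exact: (unsplitK (inr _)). Qed.

Lemma index_cases (Q : 'I_N -> Prop) :
  (forall i j, Q (xvar m i j)) -> (forall t, Q (yvar n t)) -> forall i, Q i.
Proof.
move=> Qx Qy i; case: (split_ordP i) => [k|t] -> //; last exact: Qy.
by have [p [q ->]] := symidx_surj k; apply: Qx.
Qed.

Lemma cone_mass_ge0 a : cone a -> 0 <= mass a.
Proof.
move=> [Xp yp]; apply: addr_ge0; apply: sumr_ge0 => // i _.
by have := psdmx_diag_ge0 i Xp; rewrite mxE.
Qed.

Lemma cone_mass0 a : cone a -> mass a = 0 -> a = fun=> 0.
Proof.
move=> [Xp yp] a0.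
have x0 i : 0 <= a (xvar m i i) by have := psdmx_diag_ge0 i Xp; rewrite mxE.
have sx : 0 <= \sum_i a (xvar m i i) by apply: sumr_ge0.
have sy : 0 <= \sum_t a (yvar n t) by apply: sumr_ge0.
have /eqP := a0; rewrite /mass paddr_eq0 // => /andP[/eqP sx0 /eqP sy0].
have xi i : a (xvar m i i) = 0.
  by have /eqP := sx0; rewrite psumr_eq0 // => /allP/(_ i); rewrite mem_index_enum => /(_ isT)/eqP.
apply: funext; apply: index_cases => [i j|t].
  have := psdmx_offdiag i j Xp; rewrite !mxE xi mul0r => h.
  by apply/eqP; rewrite -sqrf_eq0 eq_le h sqr_ge0.
by have /eqP := sy0; rewrite psumr_eq0 // => /allP/(_ t); rewrite mem_index_enum => /(_ isT)/eqP.
Qed.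

Lemma psdmx_scale k (A : 'M[R]_k) s : 0 <= s -> psdmx A -> psdmx (s *: A).
Proof.
move=> s0 /psdmxP[As Ap]; apply/psdmxP; split=> [i j|v]; first by rewrite !mxE As.
have -> : \sum_i \sum_j (s *: A) i j * (v i * v j) = s * \sum_i \sum_j A i j * (v i * v j).
  rewrite mulr_sumr; apply: eq_bigr => i _; rewrite mulr_sumr; apply: eq_bigr => j _.
  by rewrite mxE -mulrA.
by rewrite mulr_ge0.
Qed.

Lemma simplexE a : simplex a <-> cone a /\ mass a = 1.
Proof.
split=> [[h1 h2]|[[h1 h2] h3]]; last by split=> //; rewrite meval_trace1 -/(mass a) h3 subrr.
by rewrite meval_trace1 -/(mass a) => /eqP; rewrite subr_eq0 => /eqP.
Qed.

(** Scaling to mass 1; the power of the mass makes both sides homogeneous of the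
    same degree, including degree 0 at the apex of the cone. *)
Lemma cone_lower a b : simplex a -> (forall b, simplex b -> f.@[a] <= f.@[b]) ->
  cone b -> f.@[a] * mass b ^+ d <= f.@[b].
Proof.
move=> sa amin cb; have m0 := cone_mass_ge0 cb.
have [mb|mb] := eqVneq (mass b) 0.
  have e : b = fun i => 0 * a i.
    by rewrite (cone_mass0 cb mb); apply: funext => i; rewrite mul0r.
  by rewrite mb [in leRHS]e meval_homog mulrC.
have mb0 : 0 < mass b by rewrite lt_neqAle eq_sym mb.
pose b' i := (mass b)^-1 * b i.
have sb' : simplex b'.
  apply/simplexE; split; last by rewrite /mass -!mulr_sumr -mulrDr mulVf.
  case: cb => Xp yp; split; last by move=> t; rewrite mulr_ge0 // invr_ge0.
  have -> : \matrix_(i, j) b' (xvar m i j) = (mass b)^-1 *: \matrix_(i, j) b (xvar m i j).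
    by apply/matrixP => i j; rewrite !mxE.
  by apply: psdmx_scale; rewrite ?invr_ge0.
have -> : b = fun i => mass b * b' i.
  by apply: funext => i; rewrite /b' mulrA divff // mul1r.
rewrite meval_homog mulrC.
have -> : mass (fun i => mass b * b' i) = mass b.
  by congr mass; apply: funext => i; rewrite /b' mulrA divff // mul1r.
by rewrite ler_wpM2l ?exprn_ge0 // amin.
Qed.

Record kkt a : Prop := Kkt {
  kkt_Theta : psdmx (\matrix_(i, j) (Theta f d i j).@[a]);
  kkt_XTheta : forall i j, ((X *m Theta f d) i j).@[a] = 0;
  kkt_p : forall t, 0 <= (pmul f d t).@[a];
  kkt_py : forall t, (pmul f d t).@[a] * a (yvar n t) = 0
}.

Let horner_rules :=
  (@hornerD R, @hornerN R, @hornerC R, @hornerX R, @hornerM R, @horner_exp R).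

Section Stationarity.
Variables (a : 'I_N -> R) (sa : simplex a).
Hypothesis amin : forall b, simplex b -> f.@[a] <= f.@[b].

Definition value0 : {rmorphism {poly R} -> R} := horner_eval 0.
Definition slope0 (p : {poly R}) : R := p^`().[0].

Lemma slope0_derivation : derivation_along value0 slope0.
Proof.
split=> p q; rewrite /slope0 /value0 /= /horner_eval; first by rewrite derivD hornerD.
by rewrite derivM hornerD !hornerM addrC.
Qed.

Lemma mmap_horner (g : P) (b : 'I_N -> {poly R}) t :
  (mmap (@polyC R) b g).[t] = g.@[fun i => (b i).[t]].
Proof.
have := @rmorph_mpoly_eq R n m _ (horner_eval t \o mmap (@polyC R) b) (meval (fun i => (b i).[t])).
apply=> [c|i] /=; rewrite /horner_eval ?mmapC ?mevalC ?hornerC //.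
by rewrite mmapX mmap1U mevalXU.
Qed.

(** The function f - f (a) mass^d is nonnegative on the cone and vanishes at a, so
    that its slope at a along a curve in the cone is nonnegative. In the formula
    for this slope the multiples of the slope of the mass cancel. *)
Lemma curve_slope (b : 'I_N -> {poly R}) : (forall i, (b i).[0] = a i) ->
  (forall t, 0 <= t -> cone (fun i => (b i).[t])) ->
  0 <= \sum_i \sum_j (Theta f d i j).@[a] * slope0 (b (xvar m i j)) +
       \sum_t (pmul f d t).@[a] * slope0 (b (yvar n t)).
Proof.
move=> b0 bc; pose ev : {rmorphism P -> {poly R}} := mmap (@polyC R) b.
have slopeC c : slope0 c%:P = 0 by rewrite /slope0 derivC horner0.
have evX i : ev 'X_i = b i by rewrite /ev /= mmapX mmap1U.
have v0 g : value0 (ev g) = g.@[a].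
  rewrite /value0 /= /horner_eval mmap_horner; congr (g.@[_]); exact: funext.
have := theta_identity d f slope0_derivation slopeC b; rewrite -/ev v0.
set T1 := \sum_(i < n) _; set T2 := \sum_(t < m) _ => e.
have -> : \sum_i \sum_j (Theta f d i j).@[a] * slope0 (b (xvar m i j)) = T1.
  by apply: eq_bigr => i _; apply: eq_bigr => j _; rewrite v0 XmxE evX.
have -> : \sum_t (pmul f d t).@[a] * slope0 (b (yvar n t)) = T2.
  by apply: eq_bigr => t _; rewrite v0 evX.
pose c := f.@[a]; pose l := ev (trace1 R n m + 1).
have lt t : l.[t] = mass (fun i => (b i).[t]).
  by rewrite /l mmap_horner mevalD meval1 meval_trace1 subrK.
have l0 : l.[0] = 1.
  rewrite lt; have /simplexE[_ <-] := sa; congr mass; exact: funext.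
pose G := ev f - c%:P * l ^+ d.
have : 0 <= slope0 G.
  apply: derivative_at_minimum => [|t t0].
    rewrite /G !horner_rules l0 expr1n mulr1 -[(ev f).[0]]/(value0 (ev f)) v0 subrr //.
  rewrite /G !horner_rules mmap_horner lt subr_ge0.
  by apply: cone_lower => //; apply: bc.
have -> : slope0 G = slope0 (ev f) - c * (slope0 l *+ d).
  rewrite /slope0 /G derivB derivM derivC mul0r add0r deriv_exp.
  by rewrite hornerD hornerN hornerM hornerC hornerMn hornerM horner_exp l0 expr1n mulr1.
have -> : slope0 l = slope0 (ev (trace1 R n m)).
  rewrite /l rmorphD rmorph1 /slope0 derivD hornerD -[1]/(1%:P) derivC horner0 addr0 //.
rewrite e -/c mulrnAr mulrnAl; lra.
Qed.

(** The segments a + t w with w in the cone give the sign conditions. The curves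
    (1 + tS) X (1 + tS)^T and y_t (1 + et)^2 also stay in the cone; they can be
    run through in both directions, by changing S and e into their opposites,
    and this yields the complementarity conditions. *)
Lemma kkt_minimizer : kkt a.
Proof.
have [[Xp yp] am] := (simplexE a).1 sa.
have Xs i j : a (xvar m i j) = a (xvar m j i) by rewrite /xvar symidxC.
have line (w : 'I_N -> R) : cone w ->
    0 <= \sum_i \sum_j (Theta f d i j).@[a] * w (xvar m i j) +
         \sum_t (pmul f d t).@[a] * w (yvar n t).
  move=> [Wp wp].
  have := @curve_slope (fun i => (a i)%:P + (w i)%:P * 'X).
  have sl i : slope0 ((a i)%:P + (w i)%:P * 'X) = w i.
    by rewrite /slope0 derivD derivM derivX !derivC !horner_rules //=; ring.
  under eq_bigr => i _ do under eq_bigr => j _ do rewrite sl.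
  under [X in _ + X]eq_bigr => t _ do rewrite sl.
  apply=> [i|t t0]; first by rewrite !horner_rules ?mulr0 ?addr0.
  split; last by move=> s; rewrite !horner_rules addr_ge0 // mulr_ge0.
  apply/psdmxP; split=> [i j|v]; first by rewrite !mxE /xvar symidxC.
  have /psdmxP[_ /(_ v) h1] := Xp; have /psdmxP[_ /(_ v) h2] := Wp.
  have := addr_ge0 h1 (mulr_ge0 t0 h2); congr (0 <= _).
  rewrite mulr_sumr -big_split /=; apply: eq_bigr => i _.
  rewrite mulr_sumr -big_split /=; apply: eq_bigr => j _.
  by rewrite !mxE !horner_rules; ring.
split.
- apply/psdmxP; split=> [i j|v]; first by rewrite [LHS]mxE [RHS]mxE Theta_sym.
  have [w wE] := @pack_symmetric n R (fun i j => v i * v j) (fun i j => mulrC _ _).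
  pose W (i : 'I_N) := match fintype.split i with inl k => w k | inr _ => 0 end.
  have Wx i j : W (xvar m i j) = v i * v j by rewrite /W split_xvar.
  have Wy t : W (yvar n t) = 0 by rewrite /W split_yvar.
  have := line W; under eq_bigr => i _ do under eq_bigr => j _ do rewrite Wx.
  rewrite [X in _ + X]big1 ?addr0 => [h|t _]; last by rewrite Wy mulr0.
  under eq_bigr => i _ do under eq_bigr => j _ do rewrite mxE.
  apply: h; split; last by move=> t; rewrite Wy.
  apply/psdmxP; split=> [i j|u]; first by rewrite !mxE !Wx mulrC.
  have -> : \sum_i \sum_j (\matrix_(i, j) W (xvar m i j)) i j * (u i * u j) =
      (\sum_i v i * u i) ^+ 2.
    rewrite expr2 mulr_suml; apply: eq_bigr => i _; rewrite mulr_sumr.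
    by apply: eq_bigr => j _; rewrite mxE Wx; ring.
  exact: sqr_ge0.
(* By invariance of the trace the slope along the curve of S is
   2 tr (X Theta S), so it suffices to let S run through the unit matrices. *)
- pose A : 'M[R]_n := \matrix_(i, j) a (xvar m i j).
  pose T : 'M[R]_n := \matrix_(i, j) (Theta f d i j).@[a].
  have As : A^T = A by apply/matrixP => i j; rewrite !mxE Xs.
  have Ts : T^T = T by apply/matrixP => i j; rewrite mxE [LHS]mxE [RHS]mxE Theta_sym.
  have conj (S : 'M[R]_n) : 0 <= \tr (T *m (S *m A + A *m S^T)).
    pose Q := S *m A + A *m S^T; pose Q2 := S *m A *m S^T.
    have Qs i j : Q i j = Q j i.
      by rewrite -[in LHS](trmxK Q) mxE linearD /= !trmx_mul trmxK As addrC.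
    have Q2s i j : Q2 i j = Q2 j i.
      by rewrite -[in LHS](trmxK Q2) mxE /Q2 !trmx_mul trmxK As mulmxA.
    pose W i j : {poly R} := (A i j)%:P + (Q i j)%:P * 'X + (Q2 i j)%:P * 'X ^+ 2.
    have [|w wE] := @pack_symmetric n _ W.
      by move=> i j; rewrite /W Qs Q2s -[in LHS]As mxE.
    pose b (i : 'I_N) := match fintype.split i with inl k => w k | inr t => (a (yvar n t))%:P end.
    have bx i j : b (xvar m i j) = W i j by rewrite /b split_xvar.
    have bY t : b (yvar n t) = (a (yvar n t))%:P by rewrite /b split_yvar.
    have := @curve_slope b.
    rewrite [X in _ + X]big1 ?addr0 => [|t _]; last first.
      by rewrite bY /slope0 derivC horner0 mulr0.
    have -> : \sum_i \sum_j (Theta f d i j).@[a] * slope0 (b (xvar m i j)) = \tr (T *m Q).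
      apply: eq_bigr => i _; rewrite mxE; apply: eq_bigr => j _.
      rewrite bx [T i j]mxE Qs; congr (_ * _).
      rewrite /slope0 /W !derivD !derivM derivX !derivC !horner_rules //=; ring.
    apply=> [|t t0].
      apply: index_cases => [i j|t]; last by rewrite bY hornerC.
      by rewrite bx /W !horner_rules /= ?expr2 ?mulr0 ?addr0 mxE.
    split; last by move=> s; rewrite bY hornerC.
    have -> : \matrix_(i, j) (b (xvar m i j)).[t] =
        (1%:M + t *: S) *m A *m (1%:M + t *: S)^T.
      transitivity (A + t *: Q + t ^+ 2 *: Q2).
        have entry (B C E : 'M[R]_n) i j :
          (B + t *: C + t ^+ 2 *: E) i j = B i j + t * C i j + t ^+ 2 * E i j by rewrite !mxE.
        by apply/matrixP => i j; rewrite entry [LHS]mxE bx /W !horner_rules; ring.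
      have -> : (1%:M + t *: S)^T = 1%:M + t *: S^T.
        by apply/matrixP => i j; rewrite !mxE eq_sym.
      rewrite mulmxDl mul1mx !mulmxDr !mulmx1 !mulmxDl.
      rewrite -!scalemxAl -!scalemxAr scalerDr scalerA -expr2.
      by rewrite !addrA.
    split; first by rewrite !trmx_mul trmxK As mulmxA.
    move=> v; have := (proj2 Xp) ((1%:M + t *: S)^T *m v).
    by rewrite trmx_mul trmxK !mulmxA.
  have tr0 S : \tr ((A *m T) *m S) = 0.
    have e : \tr (T *m (S *m A + A *m S^T)) = \tr (A *m T *m S) *+ 2.
      have e1 : \tr (T *m (S *m A)) = \tr (A *m T *m S).
        by rewrite mulmxA mxtrace_mulC mulmxA.
      have e2 : \tr (T *m (A *m S^T)) = \tr (A *m T *m S).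
        by rewrite -[LHS]mxtrace_tr !trmx_mul trmxK As Ts -mulmxA mxtrace_mulC.
      by rewrite mulmxDr [LHS]linearD /= e1 e2 mulr2n.
    have := conj S; rewrite e; have := conj (- S).
    have -> : - S *m A + A *m (- S)^T = - (S *m A + A *m S^T).
      by rewrite linearN /= mulNmx mulmxN opprD.
    rewrite mulmxN linearN /= e mulr2n => h1 h2.
    by apply/eqP; rewrite eq_le; apply/andP; split; lra.
  move=> k l; have := tr0 (delta_mx l k).
  have -> : \tr (A *m T *m delta_mx l k) = (A *m T) k l.
    rewrite /mxtrace (bigD1 k) //= big1 => [|i ik].
      rewrite addr0 mxE (bigD1 l) //= big1 => [|j jl].
        by rewrite [delta_mx _ _ _ _]mxE !eqxx mulr1 addr0.
      by rewrite [delta_mx _ _ _ _]mxE (negbTE jl) mulr0.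
    rewrite mxE big1 // => j _.
    by rewrite [delta_mx _ _ _ _]mxE (negbTE ik) andbF mulr0.
  move=> <-; rewrite mxE raddf_sum [RHS]mxE; apply: eq_bigr => j _ /=.
  by rewrite mevalM XmxE mevalXU [A _ _]mxE [T _ _]mxE.
- move=> t; pose W (i : 'I_N) : R := (i == yvar n t)%:R.
  have Wx i j : W (xvar m i j) = 0 by rewrite /W eq_lrshift.
  have Wy s : W (yvar n s) = (s == t)%:R by rewrite /W /yvar eq_rshift.
  have := line W; rewrite big1 => [|i _]; last first.
    by rewrite big1 // => j _; rewrite Wx mulr0.
  rewrite add0r (bigD1 t) //= Wy eqxx mulr1 big1 ?addr0 => [|s st]; last first.
    by rewrite Wy (negbTE st) mulr0.
  apply; split; last by move=> s; rewrite Wy ler0n.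
  apply/psdmxP; split=> [i j|u]; first by rewrite !mxE !Wx.
  by rewrite big1 // => i _; rewrite big1 // => j _; rewrite mxE Wx mul0r.
move=> t.
have scale (e : R) : 0 <= (pmul f d t).@[a] * (2 * e * a (yvar n t)).
  pose b (i : 'I_N) : {poly R} :=
    if i == yvar n t then (a i)%:P * (1 + e%:P * 'X) ^+ 2 else (a i)%:P.
  have slC i : i != yvar n t -> slope0 (b i) = 0.
    by move=> h; rewrite /b (negbTE h) /slope0 derivC horner0.
  have := @curve_slope b.
  rewrite [X in X + _]big1 => [|i _]; last first.
    by rewrite big1 // => j _; rewrite slC ?mulr0 // /xvar eq_lrshift.
  rewrite add0r (bigD1 t) //= big1 ?addr0 => [|s st]; last first.
    by rewrite slC ?mulr0 // /yvar eq_rshift.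
  have -> : slope0 (b (yvar n t)) = 2 * e * a (yvar n t).
    rewrite /b eqxx /slope0 derivM derivC expr2 derivM derivD derivM !derivC derivX !horner_rules /=.
    ring.
  apply=> [i|s s0].
    by rewrite /b; case: eqP => _; rewrite !horner_rules ?mulr0 ?addr0 ?expr1n ?mulr1.
  split.
    have -> : \matrix_(i, j) (b (xvar m i j)).[s] = \matrix_(i, j) a (xvar m i j).
      by apply/matrixP => i j; rewrite !mxE /b /xvar eq_lrshift hornerC.
    exact: Xp.
  move=> r; rewrite /b; case: eqP => _; rewrite !horner_rules //.
  by rewrite mulr_ge0 ?yp // sqr_ge0.
have := scale 1; have := scale (-1) => h1 h2.
by apply/eqP; rewrite eq_le; apply/andP; split; lra.
Qed.
End Stationarity.
End Cone.

(** * Faces of the state space, continuity of polynomials *)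

Section FacePoint.
Variables (R : realType) (N : nat).
Local Notation P := {mpoly R[N]}.
Variables (M : set P) (BM : ball_module M).

(** A state with L g <= c = min g lives on the set of minimizers. Indeed
    u = g - c is nonnegative under all reweightings of L, which are states too,
    and L u = 0; by Cauchy-Schwarz for the form L (u p q), L vanishes on the
    multiples of u, and -u may be added to the module. *)
Lemma face_point (L : {scalar P}) g c p : states M L ->
  (forall a, (forall q, M q -> 0 <= q.@[a]) -> c <= g.@[a]) -> L g <= c ->
  exists a, [/\ forall q, M q -> 0 <= q.@[a], g.@[a] <= c & p.@[a] <= L p].
Proof.
move=> SL gmin Lg; have [L1 LM] := SL.
have state_min L' : states M L' -> c <= L' g.
  by move=> SL'; have [a [ga Ma]] := state_point BM g SL'; apply: le_trans (gmin _ Ma) ga.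
pose u := g - c%:MP.
(* If L (h^2) = 0, Cauchy-Schwarz applies; otherwise L is reweighted by h^2. *)
have upos h : 0 <= L (u * h ^+ 2).
  have [h0|h0] := eqVneq (L (h ^+ 2)) 0.
    have -> : u * h ^+ 2 = h * (u * h) by ring.
    by rewrite (state_cauchy BM _ SL h0).
  have hp : 0 < L (h ^+ 2) by rewrite lt_neqAle eq_sym h0 (LM _ (bm_sqr1 BM h)).
  have /state_min : states M (rescale L h).
    split; first by rewrite mkscalarE /rescale_fun mul1r divff.
    move=> q Mq; rewrite mkscalarE /rescale_fun divr_ge0 ?(ltW hp) //.
    exact/LM/(bm_sqr BM).
  rewrite mkscalarE /rescale_fun ler_pdivlMr // /u mulrBl linearB /= scalarCM; lra.
have u0 : L u = 0.
  apply/eqP; rewrite eq_le; apply/andP; split.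
    by rewrite /u linearB /= scalarC L1 mulr1 subr_le0.
  by have := upos 1; rewrite expr1n mulr1.
have uh h : L (u * h) = 0.
  apply/eqP/negPn/negP => uh0.
  pose t := - (L (u * h ^+ 2) + 1) / (2 * L (u * h)).
  have := upos (t%:MP + h).
  have -> : u * (t%:MP + h) ^+ 2 = t%:MP * (t%:MP * u) +
    (t%:MP * (u * h) + t%:MP * (u * h)) + u * h ^+ 2 by ring.
  rewrite !linearD /= !scalarCM u0.
  have -> : t * L (u * h) = - (L (u * h ^+ 2) + 1) / 2 by rewrite /t; field.
  lra.
pose ML := [set q | forall h, 0 <= L (q * h ^+ 2)].
have MML : M `<=` ML by move=> q Mq h; apply/LM/(bm_sqr BM).
have BML : ball_module ML.
  split.
  - by move=> q r Mq Mr h; rewrite mulrDl linearD addr_ge0.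
  - by move=> q h Mq h'; rewrite -mulrA -exprMn.
  - exact/MML/(bm_one BM).
  - by move=> i; apply/MML/(bm_ball BM).
have SML : states ML L by split=> // q /(_ 1); rewrite expr1n mulr1.
have [a [pa Ma]] := state_point BML p SML; exists a; split=> //.
  by move=> q /MML /Ma.
have /Ma : ML (- u) by move=> h; rewrite mulNr linearN /= uh oppr0.
by rewrite mevalN /u mevalB mevalC oppr_ge0 subr_le0.
Qed.

Lemma mpoly_continuous (p : P) (s : 'I_N -> R) (e : R) : 0 < e ->
  exists2 h : R, 0 < h & forall b, (forall i, `|b i - s i| < h) -> `|p.@[b] - p.@[s]| < e.
Proof.
pose good (p : P) := forall e, 0 < e -> exists2 h : R, 0 < h &
  forall b, (forall i, `|b i - s i| < h) -> `|p.@[b] - p.@[s]| < e.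
have gC c : good c%:MP.
  by move=> e' e0; exists 1 => // b _; rewrite !mevalC subrr normr0.
have gX i : good 'X_i by move=> e' e0; exists e' => // b bs; rewrite !mevalXU.
have gD p1 p2 : good p1 -> good p2 -> good (p1 + p2).
  move=> g1 g2 e' e0; have e2 : 0 < e' / 2 by rewrite divr_gt0.
  have [h1 h10 H1] := g1 _ e2; have [h2 h20 H2] := g2 _ e2.
  exists (Num.min h1 h2); first by rewrite lt_min h10.
  move=> b bs; rewrite !mevalD.
  have A : `|p1.@[b] - p1.@[s]| < e' / 2.
    by apply: H1 => i; have := bs i; rewrite lt_min => /andP[].
  have B : `|p2.@[b] - p2.@[s]| < e' / 2.
    by apply: H2 => i; have := bs i; rewrite lt_min => /andP[].
  have -> : p1.@[b] + p2.@[b] - (p1.@[s] + p2.@[s]) =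
    (p1.@[b] - p1.@[s]) + (p2.@[b] - p2.@[s]) by ring.

  by have := ler_normD (p1.@[b] - p1.@[s]) (p2.@[b] - p2.@[s]); lra.
have gM p1 p2 : good p1 -> good p2 -> good (p1 * p2).
  move=> g1 g2 e' e0.
  pose B1 := `|p1.@[s]| + 1; pose B2 := `|p2.@[s]| + 1.
  have B10 : 0 < B1 by rewrite ltr_pwDr. have B20 : 0 < B2 by rewrite ltr_pwDr.
  have e1 : 0 < e' / (2 * B2) by rewrite divr_gt0 // mulr_gt0.
  have e2 : 0 < Num.min 1 (e' / (2 * B1)) by rewrite lt_min ltr01 divr_gt0 // mulr_gt0.
  have [h1 h10 H1] := g1 _ e1; have [h2 h20 H2] := g2 _ e2.
  exists (Num.min h1 h2); first by rewrite lt_min h10.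
  move=> b bs; have A1 : `|p1.@[b] - p1.@[s]| < e' / (2 * B2).
    by apply: H1 => i; have := bs i; rewrite lt_min => /andP[].
  have : `|p2.@[b] - p2.@[s]| < Num.min 1 (e' / (2 * B1)).
    by apply: H2 => i; have := bs i; rewrite lt_min => /andP[].
  rewrite lt_min => /andP[A2 A3]; rewrite !mevalM.
  have -> : p1.@[b] * p2.@[b] - p1.@[s] * p2.@[s] =
    (p1.@[b] - p1.@[s]) * p2.@[b] + p1.@[s] * (p2.@[b] - p2.@[s]) by ring.
  apply: (le_lt_trans (ler_normD _ _)); rewrite !normrM.
  have pb : `|p2.@[b]| <= B2.
    have := ler_normD (p2.@[b] - p2.@[s]) p2.@[s]; rewrite subrK /B2; lra.
  have T1 : `|p1.@[b] - p1.@[s]| * `|p2.@[b]| <= e' / (2 * B2) * B2.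
    by apply: ler_pM => //; apply: ltW.
  have T2 : `|p1.@[s]| * `|p2.@[b] - p2.@[s]| <= `|p1.@[s]| * (e' / (2 * B1)).
    by rewrite ler_wpM2l // ltW.
  have T3 : `|p1.@[s]| * (e' / (2 * B1)) < B1 * (e' / (2 * B1)).
    by rewrite ltr_pM2r ?divr_gt0 ?mulr_gt0 // ltrDl.
  have E1 : e' / (2 * B2) * B2 = e' / 2 by field; rewrite gt_eqF.
  have E2 : B1 * (e' / (2 * B1)) = e' / 2 by field; rewrite gt_eqF.
  lra.
suff : good p by apply.
elim/mpolyind: p => [|c k p _ _ gp]; first by rewrite -mpolyC0; apply: (gC _).
apply: (gD _ _) => //; rewrite -mul_mpolyC; apply: (gM _ _) => //.
rewrite mpolyXE_id; apply: (big_ind good) => [|x y|i _]; [by rewrite -mpolyC1 | exact: gM |].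
elim: (k i) => [|j IH]; first by rewrite expr0 -mpolyC1.
by rewrite exprS; apply: gM.
Qed.
End FacePoint.

(** * Feasibility and exactness of the relaxations *)

Section Feasibility.
Variables (R : realType) (n m d : nat).
Local Notation N := (sigma n + m)%N.
Local Notation P := {mpoly R[N]}.
Local Notation X := (Xmx R n m).
Variables (f : P) (f_homog : f \is d.-homog).
Implicit Types (a b : 'I_N -> R) (L : {scalar P}).

Definition evL a : {scalar P} := meval a.

Lemma degle_X i j : degle 1 (X i j).
Proof. by rewrite XmxE; apply: degleU. Qed.

Lemma degle_trace1 : degle 1 (trace1 R n m).
Proof.
apply: degleB; last exact: degle1.
apply: degleD; apply: degle_sum => i _; [exact: degle_X | exact: degleU].
Qed.

Lemma degle_sqnorm : degle 2 (sqnorm R n m).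
Proof.
apply: degleD; apply: degle_sum => i _; last by rewrite -[2%N]/(2 * 1)%N; apply/degle_sqr/degleU.
by apply: degle_sum => j _; rewrite -[2%N]/(2 * 1)%N; apply/degle_sqr/degle_X.
Qed.

Lemma degle_outer : degle 2 (outer_ball R n m).
Proof. by apply: degleB; [exact: degle1 | exact: degle_sqnorm]. Qed.

Lemma degle_inner : degle 2 (inner_ball R n m).
Proof. by apply: degleB; [exact: degle_sqnorm | exact: degleC]. Qed.

Lemma degle_f : degle d f.
Proof.
rewrite /degle msizeE; apply/bigmax_leqP_seq => k kf _.
by rewrite (dhomog_mf f_homog kf).
Qed.

Lemma degle_partial i : degle d f^`M(i).
Proof. exact: degleW (leq_pred d) (degle_deriv i degle_f). Qed.

Lemma degle_Theta i j : degle d (Theta f d i j).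
Proof.
rewrite mxE; case: eqP => _; last exact/degleZ/degle_partial.
by apply: degleB; [exact: degle_partial | exact/degleZ/degle_f].
Qed.

Lemma degle_pmul t : degle d (pmul f d t).
Proof. by apply: degleB; [exact: degle_partial | exact/degleZ/degle_f]. Qed.

Lemma degle_py t : degle d.+1 (pmul f d t * 'X_(yvar n t)).
Proof. by rewrite -addn1; apply: degleM; [exact: degle_pmul | exact: degleU]. Qed.

Lemma degle_XTheta i j : degle d.+1 ((X *m Theta f d) i j).
Proof.
rewrite mxE; apply: degle_sum => k _; rewrite -add1n.
by apply: degleM; [exact: degle_X | exact: degle_Theta].
Qed.

Lemma mxdeg_le r (T : 'M[P]_r) e : (forall i j, degle e (T i j)) -> (mxdeg T <= e)%N.
Proof.
move=> h; apply/bigmax_leqP => i _; apply/bigmax_leqP => j _; exact: pdeg_le.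
Qed.

Section Order.
Variable k : nat.
Hypothesis kd : (uphalf d.+1 <= k)%N.

Lemma order_pos : (0 < k)%N. Proof. by apply: leq_trans kd. Qed.

Lemma order_le e : (e <= d.+1)%N || (e <= 2)%N -> (uphalf e <= k)%N.
Proof.
case/orP => h; first exact: leq_trans (uphalf_leq h) kd.
exact: leq_trans (uphalf_leq h) order_pos.
Qed.

Lemma order_pdeg e q : degle e q -> (e <= d.+1)%N || (e <= 2)%N ->
  (uphalf (@pdeg R N q) <= k)%N.
Proof. by move=> /pdeg_le /uphalf_leq qe /order_le; apply: leq_trans. Qed.

Lemma order_mxdeg e r (T : 'M[P]_r) : (forall i j, degle e (T i j)) ->
  (e <= d.+1)%N || (e <= 2)%N -> (uphalf (mxdeg T) <= k)%N.
Proof. by move=> /mxdeg_le /uphalf_leq qe /order_le; apply: leq_trans. Qed.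

Lemma order_degree : (d <= 2 * k)%N.
Proof. by move: kd; rewrite leq_uphalf_double mul2n; apply: leq_trans. Qed.

(** Truncating a functional at degree 2k loses nothing of the conditions of order
    k, as soon as the degree e of q fits. *)
Lemma locmx_psd_moments L q e : degle e q -> (e <= d.+1)%N || (e <= 2)%N ->
  (forall h, degle (loc_order k q) h -> 0 <= L (q * h ^+ 2)) ->
  psdmx (locmx q (moments L (2 * k))).
Proof.
move=> qe el H; apply/locmx_psd => h hh; rewrite riesz_moments; first exact: H.
rewrite expr2; apply: loc_order_degree => //; exact: order_pdeg qe el.
Qed.

Lemma locmx_eq0_moments L q e : degle e q -> (e <= d.+1)%N || (e <= 2)%N ->
  (forall h g, degle (loc_order k q) h -> degle (loc_order k q) g -> L (q * (h * g)) = 0) ->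
  locmx q (moments L (2 * k)) = 0.
Proof.
move=> qe el H; apply/locmx_eq0 => h g hh hg; rewrite riesz_moments; first exact: H.
apply: loc_order_degree => //; exact: order_pdeg qe el.
Qed.

Lemma locblockmx_psd_moments L r (T : 'M[P]_r) e : (forall i j, degle e (T i j)) ->
  (e <= d.+1)%N || (e <= 2)%N -> (forall i j, T i j = T j i) ->
  (forall h, (forall i, degle (locblock_order k T) (h i)) ->
     0 <= L (\sum_i \sum_j T i j * (h i * h j))) ->
  psdmx (locblockmx T (moments L (2 * k))).
Proof.
move=> qe el Ts H; apply/locblockmx_psd => // h hh; rewrite riesz_moments; first exact: H.
apply: degle_sum => i _; apply: degle_sum => j _.
by apply: locblock_order_degree => //; exact: order_mxdeg qe el.
Qed.

Lemma locblockmx_eq0_moments L r (T : 'M[P]_r) e : (forall i j, degle e (T i j)) ->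
  (e <= d.+1)%N || (e <= 2)%N ->
  (forall i j h g, degle (locblock_order k T) h -> degle (locblock_order k T) g ->
     L (T i j * (h * g)) = 0) ->
  locblockmx T (moments L (2 * k)) = 0.
Proof.
move=> qe el H; apply/locblockmx_eq0 => i j h g hh hg; rewrite riesz_moments; first exact: H.
by apply: locblock_order_degree => //; exact: order_mxdeg qe el.
Qed.

Lemma evL_psd q a h : 0 <= q.@[a] -> 0 <= evL a (q * h ^+ 2).
Proof. by move=> qa; rewrite /evL /= mevalM rmorphXn /= mulr_ge0 // sqr_ge0. Qed.

Lemma evL_eq0 q a g : q.@[a] = 0 -> evL a (q * g) = 0.
Proof. by move=> qa; rewrite /evL /= mevalM qa mul0r. Qed.

Lemma evL_block r (T : 'M[P]_r) a h : psdmx (\matrix_(i, j) (T i j).@[a]) ->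
  0 <= evL a (\sum_i \sum_j T i j * (h i * h j)).
Proof.
move=> /psdmxP[_ /(_ (fun i => (h i).@[a]))]; congr (0 <= _).
rewrite linear_sum; apply: eq_bigr => i _; rewrite linear_sum; apply: eq_bigr => j _.
by rewrite /evL /= !mevalM mxE.
Qed.

Lemma simplex_X a : simplex a -> psdmx (\matrix_(i, j) (X i j).@[a]).
Proof.
move=> [h _ _]; have -> // : \matrix_(i, j) (X i j).@[a] = \matrix_(i, j) a (xvar m i j).
by apply/matrixP => i j; rewrite [LHS]mxE XmxE mevalXU [RHS]mxE.
Qed.

Hypothesis nm_gt0 : (0 < n + m)%N.

Lemma riesz1_moments L : L 1 = 1 -> riesz 1 (moments L (2 * k)) = 1.
Proof. by move=> L1; rewrite -[LHS]/(rieszL _ 1) riesz_moments //; apply: degle1. Qed.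

Lemma mom_feasible_point a : simplex a -> kkt d f a ->
  mom_feasible f d (moments (evL a) (2 * k)).
Proof.
move=> sa [kT kXT kp kpy]; have [_ yp tr] := sa.
split.
- by apply: (locmx_eq0_moments degle_trace1) => [|h g _ _]; [rewrite orbT | apply: evL_eq0].
- apply: (locblockmx_psd_moments degle_X) => [||h _]; [by rewrite orbT | exact: Xmx_sym |].
  exact/evL_block/simplex_X.
- apply: (locblockmx_psd_moments degle_Theta) => [||h _]; [by rewrite leqnSn | exact: Theta_sym |].
  exact: evL_block.
- by apply: (locblockmx_eq0_moments degle_XTheta) => [|i j h g _ _]; [rewrite leqnn | apply: evL_eq0].
- move=> t; apply: (locmx_psd_moments (degleU R (yvar n t) (ltn0Sn 0))) => [|h _]; first by rewrite orbT.
  by apply: evL_psd; rewrite mevalXU.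
- by move=> t; apply: (locmx_psd_moments (degle_pmul t)) => [|h _]; [rewrite leqnSn | apply: evL_psd].
- move=> t; apply: (locmx_eq0_moments (degle_py t)) => [|h g _ _]; first by rewrite leqnn.
  by apply: evL_eq0; rewrite mevalM mevalXU.
- apply: (locmx_psd_moments degle_outer) => [|h _]; first by rewrite orbT.
  exact/evL_psd/simplex_outer.
- apply: (locmx_psd_moments degle_inner) => [|h _]; first by rewrite orbT.
  exact/evL_psd/simplex_inner.
- by apply: riesz1_moments; rewrite /evL /= meval1.
- apply: (locmx_psd_moments (degle1 R N 0)) => // h _.
  by apply: evL_psd; rewrite meval1.
Qed.

Lemma min_feasible_point a c : simplex a -> f.@[a] <= c ->
  min_feasible f c (moments (evL a) (2 * k)).
Proof.
move=> sa fc; have [_ yp tr] := sa; split.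
- by apply: (locmx_eq0_moments degle_trace1) => [|h g _ _]; [rewrite orbT | apply: evL_eq0].
- apply: (locblockmx_psd_moments degle_X) => [||h _]; [by rewrite orbT | exact: Xmx_sym |].
  exact/evL_block/simplex_X.
- apply: (locmx_psd_moments (degleB (degleC N d c) degle_f)) => [|h _]; first by rewrite leqnSn.
  by apply: evL_psd; rewrite mevalB mevalC subr_ge0.
- move=> t; apply: (locmx_psd_moments (degleU R (yvar n t) (ltn0Sn 0))) => [|h _]; first by rewrite orbT.
  by apply: evL_psd; rewrite mevalXU.
- apply: (locmx_psd_moments degle_outer) => [|h _]; first by rewrite orbT.
  exact/evL_psd/simplex_outer.
- apply: (locmx_psd_moments degle_inner) => [|h _]; first by rewrite orbT.
  exact/evL_psd/simplex_inner.
- by apply: riesz1_moments; rewrite /evL /= meval1.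
- apply: (locmx_psd_moments (degle1 R N 0)) => // h _.
  by apply: evL_psd; rewrite meval1.
Qed.

End Order.

Lemma loc_order_ge k e q : degle e q -> (k - uphalf e <= @loc_order R N k q)%N.
Proof. by move=> /pdeg_le /uphalf_leq; apply: leq_sub2l. Qed.

Lemma locblock_order_ge k e r (T : 'M[P]_r) : (forall i j, degle e (T i j)) ->
  (k - uphalf e <= locblock_order k T)%N.
Proof. by move=> /mxdeg_le /uphalf_leq; apply: leq_sub2l. Qed.

(** Every localizing matrix here has order at least k-1. *)
Lemma feasible_base k (z : tms R N (2 * k)) :
  locmx (trace1 R n m) z = 0 -> psdmx (locblockmx X z) ->
  (forall t, psdmx (locmx 'X_(yvar n t) z)) -> psdmx (locmx (outer_ball R n m) z) ->
  riesz 1 z = 1 -> psdmx (momentmx z) -> base_spec k (rieszL z).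
Proof.
move=> /locmx_eq0 htr /(locblockmx_psd _ (@Xmx_sym R n m)) hX hy /locmx_psd ho h1 /locmx_psd hp.
have pr e q h : degle e q -> (uphalf e <= 1)%N -> degle k.-1 h -> degle (@loc_order R N k q) h.
  move=> qe e1; apply: degleW; apply: leq_trans (loc_order_ge k qe).
  by rewrite -subn1 leq_sub2l.
split=> //.
- by move=> h g hh hg; apply: htr; apply: pr degle_trace1 _ _.
- move=> h hh; apply: hX => i; apply: degleW (hh i).
  by rewrite -subn1; apply: (@locblock_order_ge k 1); apply: degle_X.
- by move=> t h hh; apply: ((locmx_psd _ _).1 (hy t)); apply: pr (degleU R (yvar n t) (ltn0Sn 0)) _ _.
- by move=> h hh; apply: ho; apply: pr degle_outer _ _.
- move=> h hh; rewrite -[h ^+ 2]mul1r; apply: hp; apply: degleW hh.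
  by rewrite -[leqLHS]subn0; apply: (@loc_order_ge k 0); apply: degle1.
Qed.

Lemma mom_base k (z : tms R N (2 * k)) : mom_feasible f d z -> base_spec k (rieszL z).
Proof. by case=> *; apply: feasible_base. Qed.

Lemma min_base c k (w : tms R N (2 * k)) : min_feasible f c w -> base_spec k (rieszL w).
Proof. by case=> *; apply: feasible_base. Qed.

Definition mom_family k L := exists2 z : tms R N (2 * k), mom_feasible f d z & L = rieszL z.

Definition min_family c k L := exists2 w : tms R N (2 * k), min_feasible f c w & L = rieszL w.

Lemma mom_family_base k L : mom_family k L -> base_spec k L.
Proof. by case=> z /mom_base bs ->. Qed.

Lemma min_family_base c k L : min_family c k L -> base_spec k L.
Proof. by case=> z /min_base bs ->. Qed.

(** The multiplier h is admissible once k is at least its degree plus half the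
    degree of f. *)
Lemma min_family_level c : family_module (min_family c) (c%:MP - f).
Proof.
move=> h; exists (msize h + uphalf d)%N => k _ hk [w /min_level /locmx_psd H ->]; apply: H.
apply: degleW (_ : degle (msize h) h); last exact: leqnSn.
apply: leq_trans (loc_order_ge k (degleB (degleC N d c) degle_f)).
by rewrite leq_subRL ?(leq_trans _ hk) ?leq_addl // addnC.
Qed.

Lemma mom_family_ideal_XTheta i j : family_ideal mom_family ((X *m Theta f d) i j).
Proof.
move=> h; exists (msize h + uphalf d.+1)%N => k _ hk [z /mom_XTheta /locblockmx_eq0 H ->].
rewrite -[h]mulr1; apply: H; last exact: degle1.
apply: degleW (_ : degle (msize h) h); last exact: leqnSn.
apply: leq_trans (locblock_order_ge k degle_XTheta).
by rewrite leq_subRL ?(leq_trans _ hk) ?leq_addl // addnC.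
Qed.

Lemma mom_family_ideal_py t : family_ideal mom_family (pmul f d t * 'X_(yvar n t)).
Proof.
move=> h; exists (msize h + uphalf d.+1)%N => k _ hk [z /mom_py /(_ t) /locmx_eq0 H ->].
rewrite -[h]mulr1; apply: H; last exact: degle1.
apply: degleW (_ : degle (msize h) h); last exact: leqnSn.
apply: leq_trans (loc_order_ge k (degle_py t)).
by rewrite leq_subRL ?(leq_trans _ hk) ?leq_addl // addnC.
Qed.

Lemma family_ring_ideal (F : nat -> {scalar P} -> Prop) : ring_ideal (family_ideal F).
Proof.
split.
- by move=> h; exists 0%N => k L _ _; rewrite mul0r linear0.
- move=> p q Zp Zq h; apply: eventually_imp (eventually_and (Zp h) (Zq h)) => L [h1 h2].
  by rewrite mulrDl linearD /= h1 h2 addr0.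
- by move=> b p Zp h; rewrite [b * p]mulrC -mulrA; apply: Zp.
Qed.

(** The complementarity conditions confine f to finitely many values, which is
    what makes the relaxation exact at a finite order. *)
Theorem relaxation_tight c : (forall a, simplex a -> c <= f.@[a]) ->
  exists K, forall k (z : tms R N (2 * k)), (K <= k)%N -> mom_feasible f d z -> c <= riesz f z.
Proof.
move=> fc.
have [phi phi0 Zphi] := finitely_many_critical_values (family_ring_ideal mom_family)
  (base_ideal_trace mom_family_base) mom_family_ideal_XTheta mom_family_ideal_py.
have [K hK] := tightness (base_pseudo_family mom_family_base)
  (fun a Ma => fc a (base_family_simplex mom_family_base Ma)) phi0 Zphi.
by exists K => k z Kk mz; apply: (hK k (rieszL z) Kk); exists z.
Qed.

Lemma evL_base a k : simplex a -> base_spec k (evL a).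
Proof.
move=> sa; have [_ yp tr] := sa; split.
- by move=> h g _ _; apply: evL_eq0.
- by move=> h _; apply/evL_block/simplex_X.
- by move=> t h _; apply: evL_psd; rewrite mevalXU.
- by move=> h _; apply/evL_psd/simplex_outer.
- by rewrite /evL /= meval1.
- by move=> h _; rewrite -[h ^+ 2]mul1r; apply: evL_psd; rewrite meval1.
Qed.

(** The functional of least value on the module generated by the constraints
    exists by compactness, and it dominates the value at some feasible point. *)
Lemma argmin_exists (q p : P) : (exists2 a, simplex a & 0 <= q.@[a]) ->
  exists a, [/\ simplex a, 0 <= q.@[a] &
    forall b, simplex b -> 0 <= q.@[b] -> p.@[a] <= p.@[b]].
Proof.
move=> [a0 sa0 qa0].
pose F (k : nat) L := exists a, [/\ simplex a, 0 <= q.@[a] & L = evL a].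
have FB k L : F k L -> base_spec k L by move=> [a [sa _ ->]]; apply: evL_base.
have PF := base_pseudo_family FB; have BM := family_ball_module PF.
have Mq : family_module F q.
  by move=> h; exists 0%N => k L _ [a [_ qa ->]]; apply: evL_psd.
have st a : simplex a -> 0 <= q.@[a] -> states (family_module F) (evL a).
  move=> sa qa; split; first by rewrite /evL /= meval1.
  move=> r /(_ 1)[K /(_ K (evL a) (leqnn K))]; rewrite expr1n mulr1; apply.
  by exists a.
have [L SL Lmin] := states_argmin BM p (@subset_refl _ _) (ex_intro _ _ (st _ sa0 qa0)).
have [a [pa Ma]] := state_point BM p SL; exists a; split.
- exact: base_family_simplex FB _ Ma.
- exact: Ma.
- by move=> b sb qb; apply: le_trans pa (Lmin _ (st _ sb qb)).
Qed.

Lemma simplex_nonempty : (0 < n + m)%N -> exists a, @simplex R n m a.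
Proof.
move=> nm0; set K : R := (n + m)%:R; have K0 : 0 < K by rewrite ltr0n.
have [w wE] := @pack_symmetric n R (fun i j => if i == j then K^-1 else 0)
  (fun i j => congr1 (fun b : bool => if b then _ else _) (eq_sym i j)).
(* The barycentre: X is a multiple of the identity. *)
pose a (i : 'I_N) := match fintype.split i with inl k => w k | inr _ => K^-1 end.
have ax i j : a (xvar m i j) = if i == j then K^-1 else 0 by rewrite /a split_xvar.
have ay t : a (yvar n t) = K^-1 by rewrite /a split_yvar.
exists a; apply/simplexE; split.
  split; last by move=> t; rewrite ay invr_ge0 ltW.
  apply/psdmxP; split=> [i j|v]; first by rewrite !mxE !ax eq_sym.
  apply: sumr_ge0 => i _; rewrite (bigD1 i) //= big1 => [|j ji].
    by rewrite addr0 mxE ax eqxx -expr2 mulr_ge0 ?sqr_ge0 // invr_ge0 ltW.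
  by rewrite mxE ax eq_sym (negbTE ji) mul0r.
rewrite /mass (eq_bigr (fun=> K^-1)) => [|i _]; last by rewrite ax eqxx.
rewrite [X in _ + X](eq_bigr (fun=> K^-1)) => [|t _]; last by rewrite ay.
by rewrite !sumr_const !card_ord -mulrnDr -mulr_natl mulfV // gt_eqF.
Qed.

(** A limit of the functionals of a minimizing sequence, truncated at degree 2k,
    is feasible and optimal. *)
Lemma min_optimizer_exists k c (xi : tms R N d) : (uphalf d.+1 <= k)%N ->
  (exists w : tms R N (2 * k), min_feasible f c w) ->
  exists w : tms R N (2 * k), min_optimizer f xi c w.
Proof.
move=> kd [w0 fw0]; pose g : P := genpoly xi.
have gd : degle d g.
  by apply: degle_sum => b _; apply: degleZ; apply: degle_monomial.
have [C Cb] := bs_riesz_bounded k g.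
pose E := [set rieszL w g | w in [set w : tms R N (2 * k) | min_feasible f c w]].
have Elb : has_lbound E.
  by exists (- C) => _ [w fw <-]; have := Cb w (min_base fw); rewrite ler_norml => /andP[].
have E0 : E !=set0 by exists (rieszL w0 g), w0.
pose F (j : nat) L := exists w : tms R N (2 * k),
  [/\ min_feasible f c w, L = rieszL w & rieszL w g < inf E + j.+1%:R^-1].
have [||L0 H] := @functional_limit R P F.
- move=> j; have e0 : 0 < j.+1%:R^-1 :> R by rewrite invr_gt0.
  by have [_ [w fw <-] lt] := inf_adherent e0 (conj E0 Elb); exists (rieszL w), w.
- move=> p; have [D Db] := bs_riesz_bounded k p; exists D, 0%N => j L _ [w [fw -> _]].
  exact: (Db w (min_base fw)).
have ge0 q : (forall w : tms R N (2 * k), min_feasible f c w -> 0 <= rieszL w q) -> 0 <= L0 q.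
  by move=> hq; apply: (H _ _).1; exists 0%N => j L _ [w [fw -> _]]; apply: hq.
have eq c' q : (forall w : tms R N (2 * k), min_feasible f c w -> rieszL w q = c') -> L0 q = c'.
  move=> hq; apply/eqP; rewrite eq_le; apply/andP.
  by split; [apply: (H _ _).2 | apply: (H _ _).1]; exists 0%N => j L _ [w [fw -> _]]; rewrite hq.
exists (moments L0 (2 * k)); split.
  split.
  - apply: (locmx_eq0_moments kd degle_trace1) => [|h h' hh hh']; first by rewrite orbT.
    by apply: eq => w /min_trace/locmx_eq0; apply.
  - apply: (locblockmx_psd_moments kd degle_X) => [||h hh]; [by rewrite orbT | exact: Xmx_sym |].
    by apply: ge0 => w /min_X/(locblockmx_psd _ (@Xmx_sym R n m)); apply.
  - apply: (locmx_psd_moments kd (degleB (degleC N d c) degle_f)) => [|h hh]; first by rewrite leqnSn.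
    by apply: ge0 => w /min_level/locmx_psd; apply.
  - move=> t; apply: (locmx_psd_moments kd (degleU R (yvar n t) (ltn0Sn 0))) => [|h hh].
      by rewrite orbT.
    by apply: ge0 => w /min_y/(_ t)/locmx_psd; apply.
  - apply: (locmx_psd_moments kd degle_outer) => [|h hh]; first by rewrite orbT.
    by apply: ge0 => w /min_outer/locmx_psd; apply.
  - apply: (locmx_psd_moments kd degle_inner) => [|h hh]; first by rewrite orbT.
    by apply: ge0 => w /min_inner/locmx_psd; apply.
  - by apply: riesz1_moments; apply: eq => w /min_mass.
  - apply: (locmx_psd_moments kd (degle1 R N 0)) => // h hh.
    by apply: ge0 => w /min_psd/locmx_psd; apply.
move=> w' fw'; rewrite -[leLHS]/(rieszL _ g) riesz_moments; last exact: degleW (order_degree kd) gd.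
apply: (@le_trans _ _ (inf E)); last by apply: (ge_inf Elb); exists w'.
apply/ler_addgt0Pr => e e0; apply: (H _ _).2.
have [K Ke] : exists K : nat, e^-1 < K%:R.
  by exists (Num.bound e^-1); apply: archi_boundP; rewrite invr_ge0 ltW.
exists K => j L Kj [w [_ -> lt]]; rewrite (le_trans (ltW lt)) //.
rewrite lerD2l invf_ple ?posrE //; apply: (le_trans (ltW Ke)).
by rewrite ler_nat (leq_trans Kj).
Qed.
End Feasibility.

(** * Convergence of the optimizers and the algorithm *)

Section Convergence.
Variables (R : realType) (n m d : nat).
Local Notation N := (sigma n + m)%N.
Local Notation P := {mpoly R[N]}.
Variables (f : P) (f_homog : f \is d.-homog) (nm_gt0 : (0 < n + m)%N).
Implicit Types (a b : 'I_N -> R) (L : {scalar P}).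

Definition simplex_minimizer a := simplex a /\ forall b, simplex b -> f.@[a] <= f.@[b].

Definition minimizer_monomials : set ('X_{1..N < d.+1} -> R) :=
  [set (fun k : 'X_{1..N < d.+1} => ('X_[k] : P).@[a]) | a in simplex_minimizer].

(** The exceptional set: the xi for which two minimizers of f on the slice, told
    apart by a monomial of degree at most d, minimize the generic polynomial
    among the minimizers of f. *)
Definition ambiguous : set {ffun 'X_{1..N < d.+1} -> R} :=
  [set xi | exists s s' i, [/\ minimizes minimizer_monomials xi s,
     minimizes minimizer_monomials xi s' & s i != s' i]].

Lemma ambiguous_null : lebesgue_null ambiguous.
Proof.
apply: (@nonunique_minimizers_null R _ (mpoly.bm0 : 'X_{1..N < d.+1}) minimizer_monomials).
move=> _ k [a [sa _] <-].
have k0 : (mdeg k <= 2 * d)%N.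
  by apply: (@leq_trans d); [rewrite -ltnS bmdeg | rewrite leq_pmull].
exact: bs_moment (evL_base d sa) k0.
Qed.

Lemma pairing_genpoly (xi : tms R N d) a :
  pairing xi (fun k : 'X_{1..N < d.+1} => ('X_[k] : P).@[a]) = (genpoly xi : P).@[a].
Proof. by rewrite /genpoly raddf_sum; apply: eq_bigr => k _; rewrite /= mevalZ. Qed.

Section Generic.
Variables (xi : tms R N d) (xi_generic : ~ ambiguous xi) (d_gt0 : (0 < d)%N).
Variables (s : 'I_N -> R) (smin : simplex_minimizer s).
Hypothesis s_opt : forall b, simplex_minimizer b -> (genpoly xi : P).@[s] <= (genpoly xi : P).@[b].

Lemma generic_unique a : simplex_minimizer a ->
  (genpoly xi : P).@[a] <= (genpoly xi : P).@[s] -> a = s.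
Proof.
move=> amin le_as; apply: contrapT => ne; apply: xi_generic.
pose v b (k : 'X_{1..N < d.+1}) := ('X_[k] : P).@[b].
have [i si] : exists i, a i != s i.
  apply: contrapT => no; apply: ne; apply: funext => i.
  by apply/eqP/negPn/negP => h; apply: no; exists i.
have Ui : (mdeg U_(i) < d.+1)%N by rewrite mdeg1.
exists (v a), (v s), (BMultinom Ui); split.
- split; first by exists a.
  by move=> _ [b bmin <-]; rewrite !pairing_genpoly (le_trans le_as) ?s_opt.
- split; first by exists s.
  by move=> _ [b bmin <-]; rewrite !pairing_genpoly s_opt.
- by rewrite /v /= !mevalXU.
Qed.

Let c := f.@[s].
Let F := min_family f c.
Let FB : forall k L, F k L -> base_spec k L := @min_family_base R n m f c.

Lemma level_minimizer a : (forall q, family_module F q -> 0 <= q.@[a]) -> simplex_minimizer a.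
Proof.
move=> Ma; have sa := base_family_simplex FB Ma.
split=> // b sb; apply: le_trans (proj2 smin b sb).
by have := Ma _ (min_family_level f_homog c); rewrite mevalB mevalC subr_ge0.
Qed.

(** If optimizers of arbitrarily large order stayed away from s in some
    coordinate, they would have a limit L that is a state of the level set, with
    value at most that of s at the generic polynomial. Such an L lives on the
    minimizers of that polynomial, that is, on s alone. *)
Lemma optimizer_coordinate i (e t : R) : 0 < e -> t ^+ 2 = 1 ->
  exists K, forall k (w : tms R N (2 * k)), (K <= k)%N -> min_optimizer f xi c w ->
    t * (rieszL w 'X_i - s i) < e.
Proof.
move=> e0 t2; apply: contrapT => no.
have freq K : exists k (w : tms R N (2 * k)), [/\ (K <= k)%N, min_optimizer f xi c w &
    e <= t * (rieszL w 'X_i - s i)].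
  apply: contrapT => no'; apply: no; exists K => k w Kk ow.
  by rewrite ltNge; apply/negP => h; apply: no'; exists k, w.
have PF := base_pseudo_family FB; have BM := family_ball_module PF.
pose F' j L := exists k (w : tms R N (2 * k)), [/\ (j <= k)%N, min_optimizer f xi c w,
    e <= t * (rieszL w 'X_i - s i) & L = rieszL w].
have F'F (A : {scalar P} -> Prop) : eventually_on F A -> eventually_on F' A.
  move=> [K hK]; exists K => j _ Kj [k [w [jk [fw _] _ ->]]].
  by apply: (hK k); [exact: leq_trans jk | exists w].
have M1 q : family_module F q -> eventually_on F' (fun L => 0 <= L q).
  by move=> /(_ 1); rewrite expr1n mulr1 => /F'F.
have mass1 : eventually_on F' (fun L => L 1 = 1).
  by apply: F'F; exists 0%N => k L _ /FB/bs_mass.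
have [||L H] := @functional_limit R P F'.
- by move=> j; have [k [w [jk ow ew]]] := freq j; exists (rieszL w), k, w.
- move=> p; have [C C0 MC] := bm_bounded BM p; have [C' C'0 MC'] := bm_bounded BM (- p).
  have [K hK] := eventually_and mass1 (eventually_and (M1 _ MC) (M1 _ MC')).
  exists (C + C'), K => k L Kk FL; have [L1 [h1 h2]] := hK _ _ Kk FL.
  move: h1 h2; rewrite (scalarCB L C p) (scalarCB L C' (- p)) (linearN L) L1 !mulr1 => h1 h2.
  by rewrite ler_norml; apply/andP; split; lra.
have SL : states (family_module F) L.
  split; last by move=> q /M1 [K hK]; apply: (H _ _).1; exists K => k L' Kk /(hK _ _ Kk).
  have [K hK] := mass1; apply/eqP; rewrite eq_le; apply/andP.
  by split; [apply: (H _ _).2 | apply: (H _ _).1]; exists K => k L' Kk /(hK _ _ Kk) ->.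
pose g : P := genpoly xi.
have gd : degle d g.
  by apply: degle_sum => b _; apply: degleZ; apply: degle_monomial.
have Lg : L g <= g.@[s].
  apply: (H _ _).2; exists (uphalf d.+1) => j _ Kj [k [w [jk [fw ow] _ ->]]].
  have kd := leq_trans Kj jk.
  have := ow _ (min_feasible_point f_homog kd nm_gt0 (proj1 smin) (lexx c)).
  rewrite -[leRHS]/(rieszL _ g) riesz_moments //.
  exact: degleW (order_degree kd) gd.
have Lt : e <= t * (L 'X_i - s i).
  have : e + t * s i <= L (t%:MP * 'X_i).
    apply: (H _ _).1; exists 0%N => j _ _ [k [w [_ _ ew ->]]].
    by rewrite scalarCM; lra.
  rewrite scalarCM; lra.
have [a [Ma ga pa]] := @face_point R N _ BM L g g.@[s] (- (t%:MP * 'X_i)) SL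
  (fun b Mb => s_opt (level_minimizer Mb)) Lg.
have as_ : a = s := generic_unique (level_minimizer Ma) ga.
move: pa; rewrite mevalN mevalM mevalC mevalXU linearN /= scalarCM as_; lra.
Qed.

Lemma optimizers_converge (h : R) : 0 < h ->
  exists K, forall k (w : tms R N (2 * k)), (K <= k)%N -> min_optimizer f xi c w ->
    forall i, `|rieszL w 'X_i - s i| < h.
Proof.
move=> h0.
have each i : exists K, forall k (w : tms R N (2 * k)), (K <= k)%N ->
    min_optimizer f xi c w -> `|rieszL w 'X_i - s i| < h.
  have [K1 h1] := @optimizer_coordinate i h 1 h0 (expr1n _ _).
  have [K2 h2] := @optimizer_coordinate i h (-1) h0 (etrans (sqrrN _) (expr1n _ _)).
  exists (maxn K1 K2) => k w; rewrite geq_max => /andP[k1 k2] ow.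
  by have := h1 k w k1 ow; have := h2 k w k2 ow; rewrite ltr_norml => ? ?; apply/andP; split; lra.
have [K hK] := choice each; exists (\max_i K i) => k w Kk ow i.
by apply: (hK i) => //; apply: leq_trans Kk; apply: leq_bigmax.
Qed.
End Generic.
End Convergence.

Section Algorithm.
Variables (R : realType) (n m d : nat).
Local Notation N := (sigma n + m)%N.
Local Notation P := {mpoly R[N]}.
Variables (f : P) (f_homog : f \is d.-homog) (nm_gt0 : (0 < n + m)%N).
Variable xi : tms R N d.

Lemma stepP st st' : step f xi st st' ->
  match st with
  | Step1 k => ((0 <= mom_value f d k)%E /\ st' = Halt IsCopositive) \/
      exists2 c, mom_value f d k = c%:E /\ c < 0 & st' = Step2 n m k c
  | Step2 k c => (exists2 w : tms R N (2 * k), min_optimizer f xi c w & st' = Step3 w) \/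
      ((forall w : tms R N (2 * k), ~ min_feasible f c w) /\ st' = Step1 R n m k.+1)
  | Step3 k w => (evalxy f (xpart w) (ypart w) < 0 /\
        st' = Halt (NotCopositive (xpart w) (ypart w))) \/
      (0 <= evalxy f (xpart w) (ypart w) /\ st' = Step1 R n m k.+1)
  | Halt _ => False
  end.
Proof.
case=> [k h|k c e c0|k c w o|k c no|k w lt|k w ge].
- by left.
- by right; exists c.
- by left; exists w.
- by right.
- by left.
- by right.
Qed.

Lemma halts_mono (Q Q' : outcome R n m -> Prop) st : (forall o, Q o -> Q' o) ->
  halts_with f xi Q st -> halts_with f xi Q' st.
Proof.
move=> QQ'; elim=> {st} [o Qo|st ex _ IH]; first exact/halts_now/QQ'.
exact: halts_later.
Qed.

Lemma mom_value_lower k : exists C : R, (C%:E <= mom_value f d k)%E.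
Proof.
have [C Cb] := bs_riesz_bounded k f; exists (- C).
apply: le_ereal_inf_tmp => _ [z mz ->]; rewrite lee_fin.
by have := Cb z (mom_base mz); rewrite ler_norml => /andP[].
Qed.

Lemma mom_value_cases k :
  (0 <= mom_value f d k)%E \/ exists2 c, mom_value f d k = c%:E & c < 0.
Proof.
have [C] := mom_value_lower k; case: (mom_value f d k) => [c| |] //= _.
  have [c0|c0] := leP 0 c; first by left; rewrite lee_fin.
  by right; exists c.
by left; rewrite leey.
Qed.

(** Below the order K any outcome is acceptable as long as it is correct, and an
    execution that does not stop moves on to the next order. *)
Lemma halts_from (Q : outcome R n m -> Prop) :
  (forall k, (uphalf d.+1 <= k)%N -> (0 <= mom_value f d k)%E -> Q IsCopositive) ->
  (forall k c (w : tms R N (2 * k)), (uphalf d.+1 <= k)%N -> min_feasible f c w ->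
     evalxy f (xpart w) (ypart w) < 0 -> Q (NotCopositive (xpart w) (ypart w))) ->
  (exists K, forall k, (K <= k)%N -> (uphalf d.+1 <= k)%N ->
     halts_with f xi Q (Step1 R n m k)) ->
  halts_with f xi Q (start n m d).
Proof.
move=> Qc Qn [K hK]; rewrite /start.
suff H j k : (uphalf d.+1 <= k)%N -> (K <= k + j)%N -> halts_with f xi Q (Step1 R n m k).
  by apply: (H K) => //; rewrite leq_addl.
elim: j k => [|j IH] k kd Kk; first by apply: hK; rewrite // -[k]addn0.
have next : halts_with f xi Q (Step1 R n m k.+1).
  by apply: IH; [exact: leqW | rewrite addSnnS].
apply: halts_later.
  have [h|[c e c0]] := mom_value_cases k; first by eexists; exact: Step1_stop.
  by eexists; apply: Step1_continue e c0.
move=> st' /stepP[[h ->]|[c [e c0] ->]]; first exact/halts_now/(Qc k).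
apply: halts_later.
  have [fw|nf] := pselect (exists w : tms R N (2 * k), min_feasible f c w).
    by have [w ow] := min_optimizer_exists f_homog xi kd fw; eexists; apply: Step2_feasible ow.
  eexists; apply: Step2_infeasible => w fw; apply: nf; by exists w.
move=> st2 /stepP[[w [fw _] ->]|[_ ->]] //.
apply: halts_later.
  have [ge|lt] := leP 0 (evalxy f (xpart w) (ypart w)).
    by eexists; exact: Step3_continue.
  by eexists; exact: Step3_stop.
move=> st3 /stepP[[lt ->]|[_ ->]] //.
by apply/halts_now/(Qn k c).
Qed.

Definition point (u : 'rV[R]_(sigma n)) (v : 'rV[R]_m) (i : 'I_N) : R := row_mx u v 0 i.

Lemma point_cone (u : 'rV[R]_(sigma n)) (v : 'rV[R]_m) :
  in_cone u v <-> cone (point u v).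
Proof.
have -> : cone (point u v) <-> psdmx (symmx (u 0)) /\ forall t, 0 <= v 0 t.
  rewrite /cone; have -> : \matrix_(i, j) point u v (xvar m i j) = symmx (u 0).
    by apply/matrixP => i j; rewrite !mxE /point /xvar row_mxEl.
  by split=> -[h1 h2]; split=> // t; have := h2 t; rewrite /point /yvar row_mxEr.
by [].
Qed.

Lemma point_surj a : exists u v, point u v = a.
Proof.
exists (\row_k a (lshift m k)), (\row_t a (rshift (sigma n) t)).
apply: funext => i; case: (split_ordP i) => k ->.
  by rewrite /point row_mxEl mxE.
by rewrite /point row_mxEr mxE.
Qed.

Lemma copositiveP : copositive f <-> forall a, cone a -> 0 <= f.@[a].
Proof.
split=> [h a|h u v /point_cone]; last exact: h.
by have [u [v <-]] := point_surj a; move/point_cone; apply: h.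
Qed.

Lemma first_moments k (w : tms R N (2 * k)) :
  point (xpart w) (ypart w) = fun i => rieszL w 'X_i.
Proof.
apply: funext => i; rewrite riesz_monomial; case: (split_ordP i) => j ->.
  by rewrite /point row_mxEl mxE.
by rewrite /point row_mxEr mxE.
Qed.

(** The multipliers used are constants, which are admissible at every order. *)
Lemma min_feasible_simplex k c (w : tms R N (2 * k)) :
  min_feasible f c w -> simplex (point (xpart w) (ypart w)).
Proof.
move=> /min_base; rewrite first_moments; move: (rieszL w) => L bs.
have L1 := bs_mass bs; split.
- apply/psdmxP; split=> [i j|v]; first by rewrite !mxE /xvar symidxC.
  have := bs_X bs (fun i => degleC N k.-1 (v i)); congr (0 <= _).
  rewrite linear_sum; apply: eq_bigr => i _; rewrite linear_sum; apply: eq_bigr => j _.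
  by rewrite mxE XmxE mulrC -mpolyCM scalarCM mulrC.
- move=> t; have := bs_y bs t (degle1 R N k.-1).
  by rewrite expr1n mulr1.
have := bs_trace bs (degle1 R N k.-1) (degle1 R N k.-1); rewrite !mulr1 meval_trace1.
rewrite /trace1 linearB linearD /= L1 /mxtrace !linear_sum /= => e.
by rewrite -[RHS]e; congr (_ + _ - _); apply: eq_bigr => i _; rewrite XmxE.
Qed.

Lemma simplex_nonzero u v : simplex (point u v) -> row_mx u v != 0.
Proof.
move=> /simplexE[_]; rewrite /mass => ma; apply/eqP => uv0.
have p0 i : point u v i = 0 by rewrite /point uv0 mxE.
move: ma; rewrite !big1 => [|i _|i _]; rewrite ?p0 // addr0 => /esym/eqP.
by rewrite oner_eq0.
Qed.

Lemma halts_copositive : copositive f ->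
  (exists K : nat, forall k : nat, (K <= k)%N -> (0 <= mom_value f d k)%E) /\
  halts_with f xi (fun o => o = IsCopositive) (start n m d).
Proof.
move=> /copositiveP cop.
have [K hK] : exists K : nat, forall k : nat, (K <= k)%N -> (0 <= mom_value f d k)%E.
  have [K hK] := @relaxation_tight R n m d f f_homog 0 (fun a sa => cop a (proj1 ((simplexE a).1 sa))).
  exists K => k Kk; apply: le_ereal_inf_tmp => _ [z mz ->]; rewrite lee_fin; exact: hK mz.
split; first by exists K.
apply: halts_from => //.
- move=> k c w _ /min_feasible_simplex/simplexE[cw _].
  by rewrite ltNge -[evalxy _ _ _]/(f.@[point _ _]) cop.
exists K => k Kk _; apply: halts_later; first by eexists; apply: Step1_stop (hK k Kk).
move=> st' /stepP[[_ ->]|[c [e c0] _]]; first exact: halts_now.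
by have := hK k Kk; rewrite e lee_fin leNgt c0.
Qed.

Lemma halts_noncopositive : ~ ambiguous f xi -> ~ copositive f ->
  halts_with f xi
    (fun o => exists (u : 'rV[R]_(sigma n)) (v : 'rV[R]_m),
       [/\ o = NotCopositive u v, row_mx u v != 0, psdmx (symmx (u 0)),
           forall t, 0 <= v 0 t & evalxy f u v < 0])
    (start n m d).
Proof.
move=> xi_gen ncop.
have [a0 sa0] := simplex_nonempty R nm_gt0.
have zero_ok (b : 'I_N -> R) : 0 <= (0 : P).@[b] by rewrite meval0.
have [a [sa _ amin]] := argmin_exists f (ex_intro2 _ _ a0 sa0 (zero_ok a0)).
have {}amin b : simplex b -> f.@[a] <= f.@[b] by move=> sb; apply: amin.
have c0 : f.@[a] < 0.
  rewrite ltNge; apply/negP => c0; apply: ncop; apply/copositiveP => b cb.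
  by apply: le_trans (cone_lower f_homog sa amin cb); rewrite mulr_ge0 // exprn_ge0 // cone_mass_ge0.
(* Among the minimizers of f, pick one that minimizes the generic polynomial. *)
have [|s [ss fs sopt]] := @argmin_exists R n m ((f.@[a])%:MP - f) (genpoly xi).
  by exists a; rewrite // mevalB mevalC subrr.
have fsa : f.@[s] = f.@[a].
  by apply/eqP; rewrite eq_le amin // andbT -subr_ge0 -[f.@[a]](mevalC s) -mevalB.
have smin : simplex_minimizer f s by split=> // b sb; rewrite fsa amin.
have {}sopt b : simplex_minimizer f b -> (genpoly xi : P).@[s] <= (genpoly xi : P).@[b].
  by move=> [sb bmin]; apply: sopt => //; rewrite mevalB mevalC subr_ge0 bmin.
have value_le k : (uphalf d.+1 <= k)%N -> (mom_value f d k <= (f.@[s])%:E)%E.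
  move=> kd; apply: ereal_inf_lbound; exists (moments (evL s) (2 * k)).
    by apply: mom_feasible_point => //; apply: kkt_minimizer => //; case: smin.
  congr (_%:E); rewrite -[RHS]/(rieszL _ f) riesz_moments //.
  exact: degleW (order_degree kd) (degle_f f_homog).
have [K1 hK1] := @relaxation_tight R n m d f f_homog _ (proj2 smin).
have value_eq k : (uphalf d.+1 <= k)%N -> (K1 <= k)%N -> mom_value f d k = (f.@[s])%:E.
  move=> kd Kk; apply/eqP; rewrite eq_le value_le //=.
  by apply: le_ereal_inf_tmp => _ [z mz ->]; rewrite lee_fin; apply: hK1 mz.
have [K2 hK2] : exists K, forall k (w : tms R N (2 * k)), (K <= k)%N ->
    min_optimizer f xi f.@[s] w -> evalxy f (xpart w) (ypart w) < 0.
  have [d0|d0] := posnP d.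
    exists 0%N => k w _ _; rewrite -[evalxy _ _ _]/(f.@[point _ _]).
    (* Monomials of degree 0 do not separate points, but f is constant. *)
    have const b : f.@[b] = f.@[fun=> 0].
      have := meval_homog f_homog b 0; rewrite d0 expr0 mul1r => <-.
      by congr meval; apply: funext => i; rewrite mul0r.
    by rewrite const -(const a).
  have nf0 : 0 < - f.@[s] by rewrite fsa oppr_gt0.
  have [h h0 hc] := @mpoly_continuous R N f s _ nf0.
  have [K hK] := optimizers_converge f_homog nm_gt0 xi_gen d0 smin sopt h0.
  exists K => k w Kk ow; rewrite -[evalxy _ _ _]/(f.@[point _ _]) first_moments.
  by have := hc _ (hK k w Kk ow); rewrite ltr_norml => /andP[_]; lra.
apply: halts_from => //.
- by move=> k kd ge; have := le_trans ge (value_le k kd); rewrite lee_fin fsa leNgt c0.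
- move=> k c w _ fw lt; have sw := min_feasible_simplex fw.
  exists (xpart w), (ypart w); split=> //; first exact: simplex_nonzero.
    by have /simplexE[/point_cone[]] := sw.
  by have /simplexE[/point_cone[]] := sw.
exists (maxn K1 K2) => k; rewrite geq_max => /andP[k1 k2] kd.
have ve := value_eq k kd k1.
apply: halts_later; first by eexists; apply: Step1_continue ve _; rewrite fsa.
move=> st' /stepP[[ge _]|[c [e _] ->]].
  by move: ge; rewrite ve lee_fin fsa leNgt c0.
have {}e : c = f.@[s] by move: e; rewrite ve => -[].
rewrite {c}e.
have fw := min_feasible_point f_homog kd nm_gt0 (proj1 smin) (lexx f.@[s]).
apply: halts_later.
  have [w ow] := min_optimizer_exists f_homog xi kd (ex_intro _ _ fw).
  by eexists; apply: Step2_feasible ow.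
move=> st2 /stepP[[w ow ->]|[no _]]; last by case: (no _ fw).
have lt := hK2 k w k2 ow.
apply: halts_later; first by eexists; exact: Step3_stop.
move=> st3 /stepP[[_ ->]|[ge _]]; last by move: ge; rewrite leNgt lt.
apply: halts_now; have sw := min_feasible_simplex (proj1 ow).
exists (xpart w), (ypart w); split=> //; first exact: simplex_nonzero.
  by have /simplexE[/point_cone[]] := sw.
by have /simplexE[/point_cone[]] := sw.
Qed.

End Algorithm.

Unset Implicit Arguments.

Theorem theorem5p4 (R : realType) (n m d : nat) (nm_gt0 : (0 < n + m)%N)
    (f : {mpoly R[sigma n + m]}) (f_homog : f \is d.-homog) :
  exists2 Omega : set {ffun 'X_{1..(sigma n + m) < d.+1} -> R},
    lebesgue_null Omega &
    forall xi : {ffun 'X_{1..(sigma n + m) < d.+1} -> R}, ~ Omega xi ->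
    [/\ halts_with f xi (fun _ => True) (start n m d),
        copositive f ->
          (exists K : nat, forall k : nat, (K <= k)%N ->
             (0 <= mom_value f d k)%E) /\
          halts_with f xi (fun o => o = IsCopositive) (start n m d)
      & ~ copositive f ->
          halts_with f xi
            (fun o => exists (u : 'rV[R]_(sigma n)) (v : 'rV[R]_m),
               [/\ o = NotCopositive u v, row_mx u v != 0, psdmx (symmx (u 0)),
                   forall t, 0 <= v 0 t & evalxy f u v < 0])
            (start n m d)].
Proof.
exists (@ambiguous R n m d f); first exact: ambiguous_null.
move=> xi xi_gen; have cop := halts_copositive f_homog xi.
have ncop := halts_noncopositive f_homog nm_gt0 xi_gen.
split=> //; have [/cop[_ h]|/ncop h] := pselect (copositive f);
  exact: halts_mono h.
Qed.
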